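(* Let $G$ be a locally compact group such that the minimal cardinality $\mu$ of a neighborhood basis at the identity $e$ equals $\aleph_0$. Then $\mathcal P_1(\widehat G)$ contains an orthogonal TI-sequence, i.e. a sequence $\{u_n\}_{n\in\mathbb N}\subset\mathcal P_1(\widehat G)$ of mutually orthogonal normal states such that $\lim_n\|vu_n - u_n\| = 0$ for all $v\in\mathcal P_1(\widehat G)$.
   Context: $\lambda$ is the left regular representation of $G$ on $L_2(G)$, and $VN(G) = \lambda[G]''$ is the group von Neumann algebra. $\mathcal P_1(\widehat G)$ is the set of normal states on $VN(G)$ ($\widehat G$ is only notation). $A(G)$, the Fourier algebra, is the linear span of $\mathcal P_1(\widehat G)$, the predual of $VN(G)$; it is identified with the algebra of functions $u_{f,g}(x) = \langle\lambda(x)f,g\rangle$, $f,g\in L_2(G)$, with pointwise multiplication, duality $\langle T,u_{f,g}\rangle = \langle Tf,g\rangle$, and norm $\|u\| = \sup_{\|T\|=1}|\langle T,u\rangle|$. Thus $\mathcal P_1(\widehat G) = \{u\in A(G) : \|u\| = u(e) = 1\}$. For a normal state $u$, its support $S(u)$ is the infimum of all projections $P\in VN(G)$ with $\langle P,u\rangle = 1$; normal states $u,v$ are orthogonal if $S(u)S(v) = 0$. *)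

(* Defs.v *)
From HB Require Import structures.
From mathcomp Require Import all_boot all_order all_algebra.
From mathcomp Require Import complex.
From mathcomp Require Import all_classical all_reals all_analysis.
From mathcomp Require Import measurable_realfun ring.

Set Implicit Arguments.
Unset Strict Implicit.
Unset Printing Implicit Defensive.

Import Order.TTheory GRing.Theory Num.Theory.
Import numFieldNormedType.Exports.

Local Open Scope classical_set_scope.
Local Open Scope ring_scope.

(* The modulus as an element of R (the norm of R[i] takes its values in R[i]). *)
Definition modc (R : realType) (z : R[i]) : R := ComplexField.Normc.normc z.

Section SquareIntegrable.
Context d (T : measurableType d) (R : realType) (mu : {measure set T -> \bar R}).

Definition sq_integrable (f : T -> R[i]^o) : Prop :=
  [/\ measurable_fun [set: T] (fun x => complex.Re (f x)),
      measurable_fun [set: T] (fun x => complex.Im (f x)) &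
      (\int[mu]_x (modc (f x) ^+ 2)%:E < +oo)%E].

Definition sqint : {pred T -> R[i]^o} := mem [set f | sq_integrable f].

Lemma modc2E (z : R[i]) :
  modc z ^+ 2 = complex.Re z ^+ 2 + complex.Im z ^+ 2.
Proof.
by case: z => a b; rewrite /modc/= sqr_sqrtr// addr_ge0 ?sqr_ge0.
Qed.

Lemma measurable_modc2 (f : T -> R[i]^o) :
  measurable_fun [set: T] (fun x => complex.Re (f x)) ->
  measurable_fun [set: T] (fun x => complex.Im (f x)) ->
  measurable_fun [set: T] (EFin \o (fun x => modc (f x) ^+ 2)).
Proof.
move=> mr mi; apply/measurable_EFinP; under eq_fun do rewrite modc2E.
by apply: measurable_funD; exact: measurable_funX.
Qed.

Lemma sqint_submod_closed : submod_closed sqint.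
Proof.
split.
  rewrite inE; split; [exact: measurable_cst|exact: measurable_cst|].
  under eq_integral do rewrite modc2E/= expr0n/= addr0.
  by rewrite integral0.
move=> a f g; rewrite !inE => -[fr fi fi2] [gr gi gi2].
have mr : measurable_fun [set: T] (fun x => complex.Re ((a *: f + g) x)).
  rewrite (_ : (fun _ => _) = fun x => complex.Re a * complex.Re (f x) -
     complex.Im a * complex.Im (f x) + complex.Re (g x)); last first.
    by apply/funext => x /=; rewrite !fctE/=; case: (f x) (g x) (a) => ? ? [? ?] [].
  apply: measurable_funD => //; apply: measurable_funB;
  by apply: measurable_funM => //; exact: measurable_cst.
have mi : measurable_fun [set: T] (fun x => complex.Im ((a *: f + g) x)).
  rewrite (_ : (fun _ => _) = fun x => complex.Re a * complex.Im (f x) +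
     complex.Im a * complex.Re (f x) + complex.Im (g x)); last first.
    by apply/funext => x /=; rewrite !fctE/=; case: (f x) (g x) (a) => ? ? [? ?] [].
  apply: measurable_funD => //; apply: measurable_funD;
  by apply: measurable_funM => //; exact: measurable_cst.
split=> //.
have mf := measurable_modc2 fr fi; have mg := measurable_modc2 gr gi.
pose c : R := 2 * modc a ^+ 2.
have c0 : 0 <= c by rewrite mulr_ge0// sqr_ge0.
apply: (@le_lt_trans _ _ (\int[mu]_x (c%:E * (modc (f x) ^+ 2)%:E +
    2%:E * (modc (g x) ^+ 2)%:E))%E).
  apply: ge0_le_integral => //.
  - by move=> x _; rewrite lee_fin sqr_ge0.
  - exact: measurable_modc2.
  - by apply: emeasurable_funD; apply: measurable_funeM.
  - move=> x _; rewrite -!EFinM -EFinD lee_fin /c !modc2E !fctE/=.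
    rewrite -subr_ge0 [leRHS](_ : _ =
        (complex.Re a * complex.Re (f x) - complex.Im a * complex.Im (f x)
           - complex.Re (g x)) ^+ 2 +
        (complex.Re a * complex.Im (f x) + complex.Im a * complex.Re (f x)
           - complex.Im (g x)) ^+ 2).
      by rewrite addr_ge0// sqr_ge0.
    by case: (f x) (g x) (a) => p q [r s] [u v] /=; rewrite /GRing.scale/=; ring.
rewrite ge0_integralD//.
- rewrite !ge0_integralZl_EFin//; try by move=> x _; rewrite lee_fin sqr_ge0.
  by rewrite lte_add_pinfty// lte_mul_pinfty// lee_fin.
- by move=> x _; rewrite -EFinM lee_fin mulr_ge0// sqr_ge0.
- exact: measurable_funeM.
- by move=> x _; rewrite -EFinM lee_fin mulr_ge0// sqr_ge0.
- exact: measurable_funeM.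
Qed.

HB.instance Definition _ :=
  GRing.isSubmodClosed.Build _ _ sqint sqint_submod_closed.

Record l2fun := L2fun { l2fun_val :> T -> R[i]^o ; _ : l2fun_val \in sqint }.
HB.instance Definition _ := [isSub for l2fun_val].
HB.instance Definition _ := gen_eqMixin l2fun.
HB.instance Definition _ := [Choice of l2fun by <:].
HB.instance Definition _ := [SubChoice_isSubLmodule of l2fun by <:].

Definition ae_null : {pred l2fun} := mem [set f : l2fun | \forall x \ae mu, f x = 0].

Lemma ae_null_submod_closed : submod_closed ae_null.
Proof.
split; first by rewrite inE; exact: aeW.
move=> a f g; rewrite !inE /=; apply: filterS2 => x fx gx.
by rewrite /= !fctE /= fx gx scaler0 addr0.
Qed.
HB.instance Definition _ :=
  GRing.isSubmodClosed.Build _ _ ae_null ae_null_submod_closed.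

Local Open Scope quotient_scope.

Definition L2 : Type := {ideal_quot ae_null}.
HB.instance Definition _ := GRing.Zmodule.on L2.
HB.instance Definition _ := Quotient.on L2.

Definition L2_scale (a : R[i]) (f : L2) : L2 := \pi_L2 (a *: repr f).

Lemma pi_L2_scale a (f : l2fun) : \pi_L2 (a *: f) = L2_scale a (\pi_L2 f).
Proof.
apply/eqP; have := Quotient.idealrBE ae_null (a *: f) (a *: repr (\pi_L2 f)).
rewrite -scalerBr rpredZ; first by move=> /esym.
by rewrite Quotient.idealrBE; apply/eqP; rewrite reprK.
Qed.

Lemma L2_scaleA a b f : L2_scale a (L2_scale b f) = L2_scale (a * b) f.
Proof. by elim/quotW: f => f; rewrite -(pi_L2_scale b f) -!pi_L2_scale scalerA. Qed.

Lemma L2_scale1 : left_id 1 L2_scale.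
Proof. by elim/quotW => f; rewrite -pi_L2_scale scale1r. Qed.

Lemma pi_L2D (f g : l2fun) : \pi_L2 (f + g) = \pi_L2 f + \pi_L2 g.
Proof. exact: (@pi_addr _ _ _ _ _ {ideal_quot ae_null}). Qed.

Lemma L2_scaleDr : right_distributive L2_scale +%R.
Proof.
move=> a; elim/quotW => f; elim/quotW => g.
by rewrite -pi_L2D -!pi_L2_scale -pi_L2D scalerDr.
Qed.

Lemma L2_scaleDl f : {morph L2_scale^~ f : a b / a + b}.
Proof.
by elim/quotW: f => f a b; rewrite -!pi_L2_scale -pi_L2D scalerDl.
Qed.

HB.instance Definition _ := GRing.Zmodule_isLmodule.Build R[i] L2
  L2_scaleA L2_scale1 L2_scaleDr L2_scaleDl.

End SquareIntegrable.

Section Hilbert.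
Context d (T : measurableType d) (R : realType) (mu : {measure set T -> \bar R}).
Implicit Types (f g : L2 mu) (S P Q : L2 mu -> L2 mu).

Local Open Scope quotient_scope.
Local Notation operator := (L2 mu -> L2 mu).

Definition L2_repr f : T -> R[i] := repr f.

(* The class of f, or 0 if f is not square-integrable. *)
Definition L2_class (f : T -> R[i]) : L2 mu := \pi_(L2 mu) (insubd (0 : l2fun mu) f).

Definition inner f g : R[i] :=
  let h x := L2_repr f x * (L2_repr g x)^*%C in
  Complex (\int[mu]_x complex.Re (h x)) (\int[mu]_x complex.Im (h x)).

Definition l2norm f : R := Num.sqrt (complex.Re (inner f f)).

Definition bounded_operator S : Prop :=
  linear S /\ exists M : R, forall f, l2norm (S f) <= M * l2norm f.

Definition opnorm S : R := sup [set l2norm (S f) | f in [set f | l2norm f <= 1]].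

(* On R[i], 0 <= z means that z is a nonnegative real. *)
Definition positive_operator S : Prop := forall f, 0 <= inner (S f) f.

Definition operator_le S Q : Prop := positive_operator (Q - S).

Definition orthogonal_projection P : Prop :=
  [/\ bounded_operator P, P \o P = P &
      forall f g, inner (P f) g = inner f (P g)].

Definition commutant (A : set operator) : set operator :=
  [set S | bounded_operator S /\ forall Q, A Q -> S \o Q = Q \o S].

Definition square_summable (f : nat -> L2 mu) : Prop :=
  cvgn (series (fun k => l2norm (f k) ^+ 2)).

Definition complex_series (z : nat -> R[i]) : R[i] :=
  Complex (limn (series (fun k => complex.Re (z k))))
          (limn (series (fun k => complex.Im (z k)))).

(* The functionals whose moduli are the seminorms of the ultraweak topology. *)
Definition ultraweak_form (f g : nat -> L2 mu) S : R[i] :=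
  complex_series (fun k => inner (S (f k)) (g k)).

(* A functional on a set M of operators is represented by a function on all
   operators, of which only the values on M matter. *)
Definition functional : Type := operator -> R[i].

Definition ultraweakly_continuous (M : set operator) (phi : functional) : Prop :=
  forall S0, M S0 -> forall e : R, 0 < e ->
  exists (n : nat) (f g : 'I_n -> nat -> L2 mu),
    (forall i, square_summable (f i) /\ square_summable (g i)) /\
    exists2 c : R, 0 < c & forall S, M S ->
      (forall i, modc (ultraweak_form (f i) (g i) (S - S0)) < c) ->
      modc (phi S - phi S0) < e.

Definition normal_state_on (M : set operator) (phi : functional) : Prop :=
  [/\ forall (a : R[i]) S Q, M S -> M Q -> phi (a *: S + Q) = a * phi S + phi Q,
      forall S, M S -> positive_operator S -> 0 <= phi S,
      phi id = 1 &
      ultraweakly_continuous M phi].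

Definition is_support (M : set operator) (phi : functional) P : Prop :=
  let carrier Q := [/\ M Q, orthogonal_projection Q & phi Q = 1] in
  [/\ M P /\ orthogonal_projection P,
      forall Q, carrier Q -> operator_le P Q &
      forall P', M P' -> orthogonal_projection P' ->
        (forall Q, carrier Q -> operator_le P' Q) -> operator_le P' P].

Definition orthogonal_states (M : set operator) (phi psi : functional) : Prop :=
  exists P Q, [/\ is_support M phi P, is_support M psi Q & P \o Q = 0].

End Hilbert.

(* The point is an arbitrary element, required by the library of
   sigma-algebras; it carries no information on a group. *)
HB.mixin Record isTopologicalGroup G of PointedTopological G & Group G := {
  mulg_continuous : continuous (fun xy : G * G => (xy.1 * xy.2)%g) ;
  invg_continuous : continuous (fun x : G => (x^-1)%g)
}.

#[short(type="topologicalGroupType")]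
HB.structure Definition TopologicalGroup :=
  {G of PointedTopological G & Group G & isTopologicalGroup G}.

Definition nbhs_basis (X : topologicalType) (x : X) (B : set (set X)) : Prop :=
  (forall U, B U -> nbhs x U) /\
  (forall V, nbhs x V -> exists2 U, B U & U `<=` V).

(* Some neighborhood basis at x has the cardinality of A, and none has a
   smaller one. *)
Definition min_nbhs_basis_card (X : topologicalType) (x : X)
    (I : Type) (A : set I) : Prop :=
  (exists2 B, nbhs_basis x B & (B #= A)%card) /\
  (forall B, nbhs_basis x B -> (A #<= B)%card).

Definition borel (X : ptopologicalType) := g_sigma_algebraType (@open X).

Section GroupVonNeumannAlgebra.
Context (R : realType) (G : topologicalGroupType).

(* A left Haar measure, in the sense of Radon measures. *)
Definition left_haar_measure (mu : {measure set (borel G) -> \bar R}) : Prop :=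
  [/\ mu [set: G] != 0%E,
      forall (x : G) (A : set (borel G)), measurable A ->
        mu [set (x * y)%g | y in (A : set G)] = mu A,
      forall K : set G, compact K -> (mu K < +oo)%E,
      forall A : set (borel G), measurable A ->
        mu A = ereal_inf [set mu U | U in [set U : set G | open U /\ A `<=` U]] &
      forall U : set G, open U ->
        mu U = ereal_sup [set mu K | K in [set K : set G | compact K /\ K `<=` U]]].

Variable mu : {measure set (borel G) -> \bar R}.

(* When mu is a left Haar measure, left translates of square-integrable
   functions are square-integrable, so that the default value of L2_class is
   not used. *)
Definition left_regular (x : G) (f : L2 mu) : L2 mu :=
  L2_class mu (fun y : G => L2_repr f (x^-1 * y)%g).

Definition VN : set (L2 mu -> L2 mu) := commutant (commutant (range left_regular)).

Definition P1 : set (functional mu) := [set u | normal_state_on VN u].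

(* The Fourier algebra A(G), as the linear span of P_1; an element u of it is
   identified with the function x |-> u (left_regular x) on G. *)
Definition fourier_algebra : set (functional mu) :=
  [set w | exists (n : nat) (c : 'I_n -> R[i]) (u : 'I_n -> functional mu),
     (forall i, P1 (u i)) /\
     forall S, VN S -> w S = \sum_(i < n) c i * u i S].

(* w is the product of v and u, for the pointwise product of functions on G;
   it is unique on VN(G), where the span of the left translations is
   ultraweakly dense. *)
Definition is_fourier_product (v u w : functional mu) : Prop :=
  fourier_algebra w /\
  forall x, w (left_regular x) = v (left_regular x) * u (left_regular x).

Definition fourier_norm (w : functional mu) : \bar R :=
  ereal_sup [set (modc (w S))%:E | S in [set S | VN S /\ opnorm S = 1]].

End GroupVonNeumannAlgebra.

Arguments VN {R G} mu _.

(* Main.v *)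
(* Take unit vectors f_n = 1_{V_n} / sqrt (mu V_n) of L_2(G), for neighborhoods V_n shrinking
   to e. A vector state supported near e is almost fixed by multiplication by a state v:
   writing v as a finite combination of forms S |-> sum_k <S xi_k, eta_k> and expanding the
   translates of eta along an orthonormal sequence (e_i), the product of v with the vector state
   of f is given by the square-summable families <xi, lambda(s) e_i> f(s) and
   <eta, lambda(s) e_i> f(s). For f carried near e these are close to the constant multiples
   <xi, e_i> f and <eta, e_i> f, which represent <xi, eta> times the vector state of f.

   To make the states orthogonal, let B_j be the average of lambda over V_j. Since G is not
   discrete, mu V_n -> 0, so that B_j f_n -> 0 for every j, and a = sum_j 4^-j B_j^* B_j is an
   injective positive element of VN(G) with <a f_n, f_n> -> 0. The spectral subspaces
   of a for ]-oo, d] decrease to 0 with d, while f_n is asymptotically in each of them. Hence a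
   subsequence of (f_n) can be perturbed to unit vectors g_k in mutually orthogonal spectral
   subspaces of a. As the commutant of VN(G) commutes with a, it maps these subspaces to
   themselves; the support of the vector state of g_k projects onto the closure of the orbit of
   g_k under the commutant, so these supports are orthogonal. *)
From HB Require Import structures.
Require Import Defs.
From mathcomp Require Import all_boot all_order all_algebra.
From mathcomp Require Import complex.
From mathcomp Require Import all_classical all_reals all_analysis.
From mathcomp Require Import measurable_realfun ring lra.

Set Implicit Arguments.
Unset Strict Implicit.
Unset Printing Implicit Defensive.

Import Order.TTheory GRing.Theory Num.Theory.
Import numFieldNormedType.Exports.

Local Open Scope classical_set_scope.
Local Open Scope ring_scope.
Arguments modc {R} z : simpl never.

(** The group is assumed neither second countable nor sigma-compact, so [L2 mu] may be nonseparable
    and [mu] not sigma-finite. No integral over the square of [G] is formed and no orthonormal basis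
    is used: each vector is carried by a sigma-compact set, over which the translates of a given
    vector are approximated by a sequence, and Parseval is used for these translates only. The
    product with [v] is written down on every operator at once, as a combination of ultraweak forms;
    it thus lies in the Fourier algebra, and its distance to the vector state is estimated on all
    contractions directly, without passing through a coproduct on [VN mu]. The vectors made
    orthogonal are no longer supported near the identity, so the estimate has to tolerate a small
    norm perturbation of a localized vector; this is why it involves two vectors, [f] and [f0]. The
    spectral subspaces come from the absolute value of a symmetric contraction, a limit of
    polynomials in that operator, so that commutation passes to them. *)

(** * The modulus of a complex number *)

Section Modulus.
Context (R : realType).
Implicit Types (z w : R[i]) (x : R).

Lemma modc_ge0 z : 0 <= modc z.
Proof. by case: z => a b; rewrite /modc/= sqrtr_ge0. Qed.

Lemma modc0 : modc (0 : R[i]) = 0.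
Proof. exact: ComplexField.Normc.normc0. Qed.

Lemma modc1 : modc (1 : R[i]) = 1.
Proof. exact: ComplexField.Normc.normc1. Qed.

Lemma modcM z w : modc (z * w) = modc z * modc w.
Proof. exact: ComplexField.Normc.normcM. Qed.

Lemma ler_modcD z w : modc (z + w) <= modc z + modc w.
Proof. exact: le_normcD. Qed.

Lemma modcN z : modc (- z) = modc z.
Proof. exact: normcN. Qed.

Lemma modcJ z : modc z^*%C = modc z.
Proof. by case: z => a b; rewrite /modc/= sqrrN. Qed.

Lemma modc_eq0 z : modc z = 0 -> z = 0.
Proof. exact: ComplexField.Normc.eq0_normc. Qed.

Lemma modc_real x : modc x%:C%C = `|x|.
Proof. by rewrite /modc/= expr0n addr0 sqrtr_sqr. Qed.

Lemma modc_Re z : `|complex.Re z| <= modc z.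
Proof.
rewrite -(@ler_pXn2r _ 2)// ?nnegrE ?modc_ge0//.
by rewrite modc2E real_normK ?num_real// lerDl sqr_ge0.
Qed.

Lemma modc_Im z : `|complex.Im z| <= modc z.
Proof.
rewrite -(@ler_pXn2r _ 2)// ?nnegrE ?modc_ge0//.
by rewrite modc2E real_normK ?num_real// lerDr sqr_ge0.
Qed.

Lemma RecM z w :
  complex.Re (z * w) = complex.Re z * complex.Re w - complex.Im z * complex.Im w.
Proof. by case: z w => [a b] [c d]. Qed.

Lemma Re_realM x z : complex.Re (x%:C%C * z) = x * complex.Re z.
Proof. by rewrite RecM /= mul0r subr0. Qed.

Lemma ImcM z w :
  complex.Im (z * w) = complex.Re z * complex.Im w + complex.Im z * complex.Re w.
Proof. by case: z w => [a b] [c d]. Qed.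

Lemma RecD z w : complex.Re (z + w) = complex.Re z + complex.Re w.
Proof. by case: z w => [a b] [c d]. Qed.

Lemma ImcD z w : complex.Im (z + w) = complex.Im z + complex.Im w.
Proof. by case: z w => [a b] [c d]. Qed.

Lemma RecN z : complex.Re (- z) = - complex.Re z.
Proof. by case: z => [a b]. Qed.

Lemma ImcN z : complex.Im (- z) = - complex.Im z.
Proof. by case: z => [a b]. Qed.

Lemma RecJ z : complex.Re z^*%C = complex.Re z.
Proof. by case: z => [a b]. Qed.

Lemma ImcJ z : complex.Im z^*%C = - complex.Im z.
Proof. by case: z => [a b]. Qed.

Lemma conjcM z w : (z * w)^*%C = z^*%C * w^*%C.
Proof. exact: rmorphM. Qed.

Lemma conjcD z w : (z + w)^*%C = z^*%C + w^*%C.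
Proof. exact: rmorphD. Qed.

Lemma conjcN z : (- z)^*%C = - z^*%C.
Proof. exact: rmorphN. Qed.

Lemma mulcJ z : z * z^*%C = (modc z ^+ 2)%:C%C.
Proof.
by rewrite modc2E; case: z => a b /=; apply/eqP; rewrite eq_complex /=; apply/andP;
  split; apply/eqP; ring.
Qed.

Lemma Rec_sum (I : Type) (r : seq I) (F : I -> R[i]) :
  complex.Re (\sum_(i <- r) F i) = \sum_(i <- r) complex.Re (F i).
Proof. by elim/big_rec2: _ => // i x y _ <-; rewrite RecD. Qed.

Lemma Imc_sum (I : Type) (r : seq I) (F : I -> R[i]) :
  complex.Im (\sum_(i <- r) F i) = \sum_(i <- r) complex.Im (F i).
Proof. by elim/big_rec2: _ => // i x y _ <-; rewrite ImcD. Qed.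

Lemma ler_modc_sum (I : Type) (r : seq I) (F : I -> R[i]) :
  modc (\sum_(i <- r) F i) <= \sum_(i <- r) modc (F i).
Proof.
elim/big_rec2: _ => [|i x y _ h]; first by rewrite modc0.
by rewrite (le_trans (ler_modcD _ _))// lerD2l.
Qed.

Lemma complexP z w :
  complex.Re z = complex.Re w -> complex.Im z = complex.Im w -> z = w.
Proof. by case: z w => [a b] [c d] /= -> ->. Qed.

End Modulus.

(** * Inner product spaces *)

Section PreHilbert.
Context (R : realType) (V : lmodType R[i]) (ip : V -> V -> R[i]).

(** A predicate on [ip], so that the same results serve [inner] on [L2 mu] and [ell2_inner] on
    square-summable sequences. *)
Record inner_product : Prop := InnerProduct {
  ipDl : forall x y z, ip (x + y) z = ip x z + ip y z ;
  ipZl : forall a x y, ip (a *: x) y = a * ip x y ;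
  ipC : forall x y, ip y x = (ip x y)^*%C ;
  ip_ge0 : forall x, 0 <= complex.Re (ip x x) ;
  ip_eq0 : forall x, complex.Re (ip x x) = 0 -> x = 0 }.

Definition hnorm x : R := Num.sqrt (complex.Re (ip x x)).

Hypothesis Hip : inner_product.

Lemma ip0l y : ip 0 y = 0.
Proof. by rewrite -(scale0r 0) (ipZl Hip) mul0r. Qed.

Lemma ip0r y : ip y 0 = 0.
Proof. by rewrite (ipC Hip) ip0l conjc0. Qed.

Lemma ipDr x y z : ip x (y + z) = ip x y + ip x z.
Proof. by rewrite (ipC Hip) (ipDl Hip) conjcD -!(ipC Hip). Qed.

Lemma ipZr a x y : ip x (a *: y) = a^*%C * ip x y.
Proof. by rewrite (ipC Hip) (ipZl Hip) conjcM -(ipC Hip). Qed.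

Lemma ipNl x y : ip (- x) y = - ip x y.
Proof. by rewrite -scaleN1r (ipZl Hip) mulN1r. Qed.

Lemma ipNr x y : ip x (- y) = - ip x y.
Proof. by rewrite (ipC Hip) ipNl conjcN -(ipC Hip). Qed.

Lemma ipBl x y z : ip (x - y) z = ip x z - ip y z.
Proof. by rewrite (ipDl Hip) ipNl. Qed.

Lemma ipBr x y z : ip x (y - z) = ip x y - ip x z.
Proof. by rewrite ipDr ipNr. Qed.

(** The expansion to which [polarization] is applied. *)
Lemma ip_comb a x y x' y' : ip (a *: x + y) (a *: x' + y') =
  (modc a ^+ 2)%:C%C * ip x x' + a * ip x y' + (a^*%C * ip y x' + ip y y').
Proof.
by rewrite (ipDl Hip) (ipZl Hip) !ipDr !ipZr -mulcJ mulrDr mulrA.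
Qed.

Lemma ip_suml (I : Type) (r : seq I) (F : I -> V) y :
  ip (\sum_(i <- r) F i) y = \sum_(i <- r) ip (F i) y.
Proof. by elim/big_rec2: _ => [|i x z _ <-]; rewrite ?ip0l ?(ipDl Hip). Qed.

Lemma ip_sumr (I : Type) (r : seq I) (F : I -> V) y :
  ip y (\sum_(i <- r) F i) = \sum_(i <- r) ip y (F i).
Proof. by elim/big_rec2: _ => [|i x z _ <-]; rewrite ?ip0r ?ipDr. Qed.

Lemma hnorm_ge0 x : 0 <= hnorm x. Proof. exact: sqrtr_ge0. Qed.

Lemma sqr_hnorm x : hnorm x ^+ 2 = complex.Re (ip x x).
Proof. by rewrite sqr_sqrtr// (ip_ge0 Hip). Qed.

Lemma ipxx x : ip x x = (hnorm x ^+ 2)%:C%C.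
Proof.
apply: complexP => /=; first by rewrite sqr_hnorm.
have := ipC Hip x x; case: (ip x x) => a b [] /= /eqP.
by rewrite -subr_eq0 opprK -mulr2n mulrn_eq0/= => /eqP.
Qed.

Lemma hnorm0 : hnorm 0 = 0.
Proof. by rewrite /hnorm ip0l sqrtr0. Qed.

Lemma hnorm_eq0 x : hnorm x = 0 -> x = 0.
Proof.
by move=> x0; apply: (ip_eq0 Hip); rewrite -sqr_hnorm x0 expr0n.
Qed.

Lemma hnorm_le0 x : hnorm x <= 0 -> x = 0.
Proof.
by move=> x0; apply: hnorm_eq0; apply/eqP; rewrite eq_le x0 hnorm_ge0.
Qed.

Lemma hnormZ a x : hnorm (a *: x) = modc a * hnorm x.
Proof.
rewrite /hnorm (ipZl Hip) ipZr mulrA mulcJ RecM/= mul0r subr0.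
by rewrite sqrtrM ?sqr_ge0// sqrtr_sqr ger0_norm// modc_ge0.
Qed.

Lemma hnormN x : hnorm (- x) = hnorm x.
Proof. by rewrite -scaleN1r hnormZ modcN modc1 mul1r. Qed.

Lemma hdistC x y : hnorm (x - y) = hnorm (y - x).
Proof. by rewrite -hnormN opprB. Qed.

Lemma sqr_hnormD x y :
  hnorm (x + y) ^+ 2 = hnorm x ^+ 2 + hnorm y ^+ 2 + 2 * complex.Re (ip x y).
Proof.
rewrite !sqr_hnorm (ipDl Hip) !ipDr !RecD (ipC Hip x y) RecJ; ring.
Qed.

Lemma sqr_hnormB x y :
  hnorm (x - y) ^+ 2 = hnorm x ^+ 2 + hnorm y ^+ 2 - 2 * complex.Re (ip x y).
Proof. by rewrite sqr_hnormD hnormN ipNr RecN mulrN. Qed.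

Lemma Re_ip_le x y : complex.Re (ip x y) <= hnorm x * hnorm y.
Proof.
have [->|/eqP x0] := eqVneq x 0; first by rewrite ip0l hnorm0 mul0r.
have [->|/eqP y0] := eqVneq y 0; first by rewrite ip0r hnorm0 mulr0.
have hx : 0 < hnorm x by rewrite lt_def hnorm_ge0 andbT; apply/eqP => /hnorm_eq0.
have hy : 0 < hnorm y by rewrite lt_def hnorm_ge0 andbT; apply/eqP => /hnorm_eq0.
(* The two scaled vectors have equal norms, so their squared distance is twice the product of the
   norms of [x] and [y] times the gap in the inequality. *)
have := sqr_ge0 (hnorm ((hnorm y)%:C%C *: x - (hnorm x)%:C%C *: y)).
rewrite sqr_hnormB !hnormZ !modc_real !ger0_norm ?hnorm_ge0// (ipZl Hip) ipZr.
rewrite conjc_real !RecM/= !mul0r !subr0 => h.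
have {}h : 0 <= (hnorm x * hnorm y) * (hnorm x * hnorm y - complex.Re (ip x y)) by nra.
by rewrite -subr_ge0 -(pmulr_rge0 _ (mulr_gt0 hx hy)).
Qed.

Lemma modc_ip_le x y : modc (ip x y) <= hnorm x * hnorm y.
Proof.
have [->|/eqP z0] := eqVneq (ip x y) 0.
  by rewrite modc0 mulr_ge0 ?hnorm_ge0.
have m0 : 0 < modc (ip x y).
  by rewrite lt_def modc_ge0 andbT; apply/eqP => /modc_eq0.
(* Multiplying [x] by the conjugate of [ip x y] turns the inner product into the square of its
   modulus, which is real. *)
have := Re_ip_le ((ip x y)^*%C *: x) y.
rewrite (ipZl Hip) mulrC mulcJ/= hnormZ modcJ -mulrA expr2.
by rewrite ler_pM2l.
Qed.

Lemma ler_hnormD x y : hnorm (x + y) <= hnorm x + hnorm y.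
Proof.
rewrite -(@ler_pXn2r _ 2)// ?nnegrE ?addr_ge0 ?hnorm_ge0//.
rewrite sqr_hnormD sqrrD; have := Re_ip_le x y; lra.
Qed.

Lemma ler_hnormB x y : hnorm (x - y) <= hnorm x + hnorm y.
Proof. by rewrite -(hnormN y) ler_hnormD. Qed.

Lemma ler_hdistD z x y : hnorm (x - y) <= hnorm (x - z) + hnorm (z - y).
Proof. by rewrite -[x - y](subrKA z) ler_hnormD. Qed.

Lemma ler_dist_hnorm x y : `|hnorm x - hnorm y| <= hnorm (x - y).
Proof.
rewrite ler_norml; apply/andP; split.
  by rewrite lerNl opprB lerBlDr -{1}(subrK x y) (le_trans (ler_hnormD _ _))// hdistC.
by rewrite lerBlDr -{1}(subrK y x) ler_hnormD.
Qed.

Lemma parallelogram x y :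
  hnorm (x + y) ^+ 2 + hnorm (x - y) ^+ 2 = 2 * hnorm x ^+ 2 + 2 * hnorm y ^+ 2.
Proof. rewrite sqr_hnormD sqr_hnormB; ring. Qed.

Lemma ip_extl x y : (forall z, ip x z = ip y z) -> x = y.
Proof.
move=> h; apply/eqP; rewrite -subr_eq0; apply/eqP/(ip_eq0 Hip).
by rewrite ipBl h subrr.
Qed.

End PreHilbert.

(** * Hilbert spaces: projections, Riesz representation, adjoints *)

Section HilbertSpace.
Context (R : realType) (V : lmodType R[i]) (ip : V -> V -> R[i]).
Hypothesis Hip : inner_product ip.
Local Notation "`[ x ]" := (hnorm ip x) (format "`[ x ]").

Definition hcvg (u : nat -> V) x := forall e : R, 0 < e ->
  exists N, forall n, (N <= n)%N -> `[u n - x] < e.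

Definition hcauchy (u : nat -> V) := forall e : R, 0 < e ->
  exists N, forall m n, (N <= m)%N -> (N <= n)%N -> `[u m - u n] < e.

Definition hcomplete := forall u, hcauchy u -> exists x, hcvg u x.

Definition hlinear (S : V -> V) := forall a x y, S (a *: x + y) = a *: S x + S y.

Definition hbounded (S : V -> V) :=
  hlinear S /\ exists M : R, forall x, `[S x] <= M * `[x].

Definition closed_subspace (K : set V) :=
  [/\ K 0, forall a x y, K x -> K y -> K (a *: x + y) &
      forall u x, (forall n, K (u n)) -> hcvg u x -> K x].

Definition orthocomp (S : set V) : set V := [set x | forall s, S s -> ip x s = 0].

Lemma hlinear0 S : hlinear S -> S 0 = 0.
Proof.
move=> lS; have := lS 1 0 0; rewrite scale1r addr0 scale1r => /esym/eqP.
by rewrite -subr_eq0 addrK => /eqP.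
Qed.

Lemma hlinearZ S a x : hlinear S -> S (a *: x) = a *: S x.
Proof. by move=> lS; rewrite -[a *: x]addr0 lS hlinear0// addr0. Qed.

Lemma hlinearD S x y : hlinear S -> S (x + y) = S x + S y.
Proof. by move=> lS; rewrite -{1}[x]scale1r lS scale1r. Qed.

Lemma hlinearN S x : hlinear S -> S (- x) = - S x.
Proof. by move=> lS; rewrite -scaleN1r hlinearZ// scaleN1r. Qed.

Lemma hlinearB S x y : hlinear S -> S (x - y) = S x - S y.
Proof. by move=> lS; rewrite hlinearD// hlinearN. Qed.

Lemma hbounded_gt0 S : hbounded S -> exists2 M : R, 0 < M & forall x, `[S x] <= M * `[x].
Proof.
move=> [_ [M hM]]; exists (`|M| + 1); first by rewrite ltr_wpDl.
move=> x; apply: (le_trans (hM x)); apply: ler_wpM2r; first exact: hnorm_ge0.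
by rewrite (le_trans (ler_norm _))// lerDl.
Qed.

Lemma hcvg_unique u x y : hcvg u x -> hcvg u y -> x = y.
Proof.
move=> ux uy; apply/eqP; rewrite -subr_eq0; apply/eqP/(hnorm_eq0 Hip)/eqP.
rewrite eq_le hnorm_ge0 andbT leNgt; apply/negP => h.
have h2 : 0 < `[x - y] / 2 by rewrite divr_gt0.
have [N hN] := ux _ h2; have [N' hN'] := uy _ h2.
have := hN (maxn N N') (leq_maxl _ _); have := hN' (maxn N N') (leq_maxr _ _).
set z := u _ => h1 h3; have := ler_hdistD Hip z x y.
rewrite (hdistC Hip x z); lra.
Qed.

Lemma hbounded_cvg S u x : hbounded S -> hcvg u x -> hcvg (S \o u) (S x).
Proof.
move=> bS ux e e0; have [M M0 hM] := hbounded_gt0 bS; case: bS => lS _.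
have [N hN] := ux (e / M) (divr_gt0 e0 M0); exists N => n /hN h /=.
by rewrite -hlinearB// (le_lt_trans (hM _))// mulrC -ltr_pdivlMr.
Qed.

Lemma hcvgD u v x y : hcvg u x -> hcvg v y -> hcvg (fun n => u n + v n) (x + y).
Proof.
move=> ux vy e e0; have e2 : 0 < e / 2 by rewrite divr_gt0.
have [N hN] := ux _ e2; have [N' hN'] := vy _ e2; exists (maxn N N') => n.
rewrite geq_max => /andP[/hN h1 /hN' h2].
rewrite (_ : _ - _ = (u n - x) + (v n - y)); last by rewrite opprD addrACA.
by rewrite (le_lt_trans (ler_hnormD Hip _ _))//; lra.
Qed.

Lemma hcvgZ a u x : hcvg u x -> hcvg (fun n => a *: u n) (a *: x).
Proof.
move=> ux; apply: (@hbounded_cvg ( *:%R a)) => //; split.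
  by move=> b y z; rewrite scalerDr !scalerA mulrC.
by exists (modc a) => y; rewrite (hnormZ Hip).
Qed.

Lemma hcvg_cst x : hcvg (fun=> x) x.
Proof. by move=> e e0; exists 0%N => n _; rewrite subrr (hnorm0 Hip). Qed.

Lemma hcvg_shift u x : hcvg u x -> hcvg (fun n => u n.+1) x.
Proof.
by move=> ux e e0; have [N hN] := ux e e0; exists N => n Nn; apply: hN; exact: leqW.
Qed.

Lemma hcvg_norm_le u x (B : R) : hcvg u x -> (forall n, `[u n] <= B) -> `[x] <= B.
Proof.
move=> ux uB; rewrite leNgt; apply/negP; rewrite -subr_gt0 => h.
have [N hN] := ux _ h; have := hN N (leqnn _).
have := ler_dist_hnorm Hip (u N) x; rewrite ler_norml => /andP[+ _].
have := uB N; lra.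
Qed.

Lemma hcvg_ipl u x y : (forall n, ip (u n) y = 0) -> hcvg u x -> ip x y = 0.
Proof.
move=> uy ux; apply/modc_eq0/eqP; rewrite eq_le modc_ge0 andbT leNgt; apply/negP => h.
have y1 : 0 < `[y] + 1 by rewrite ltr_wpDl// hnorm_ge0.
have [N hN] := ux (modc (ip x y) / (`[y] + 1)) (divr_gt0 h y1).
have := modc_ip_le Hip (u N - x) y; rewrite (ipBl Hip) uy sub0r modcN.
have := hN N (leqnn _); rewrite ltr_pdivlMr// => h1 h2.
have := hnorm_ge0 ip (u N - x); nra.
Qed.

Lemma orthocomp_closed (S : set V) : closed_subspace (orthocomp S).
Proof.
split.
- by move=> s _; rewrite (ip0l Hip).
- by move=> a x y xS yS s sS; rewrite (ipDl Hip) (ipZl Hip) xS// yS// mulr0 addr0.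
- by move=> u x uS ux s sS; apply: (hcvg_ipl _ ux) => n; exact: uS.
Qed.

Section Subspace.
Variable K : set V.
Hypothesis cK : closed_subspace K.

Lemma subspaceZ a x : K x -> K (a *: x).
Proof. by case: cK => K0 Kl _ Kx; rewrite -[_ *: _]addr0; exact: Kl. Qed.

Lemma subspaceD x y : K x -> K y -> K (x + y).
Proof. by case: cK => K0 Kl _ Kx Ky; rewrite -[x]scale1r; exact: Kl. Qed.

Lemma subspaceB x y : K x -> K y -> K (x - y).
Proof. by move=> Kx Ky; apply: subspaceD => //; rewrite -scaleN1r; exact: subspaceZ. Qed.

Hypothesis Vc : hcomplete.

Lemma projection_theorem x : exists p, K p /\ forall k, K k -> ip (x - p) k = 0.
Proof.
pose D := [set `[x - k] ^+ 2 | k in K].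
have D0 : D !=set0 by exists (`[x - 0] ^+ 2); exists 0 => //; case: cK.
have lbD : has_inf D.
  by split => //; exists 0 => _ [k _ <-]; rewrite sqr_ge0.
pose d := inf D.
have dle k : K k -> d <= `[x - k] ^+ 2.
  by move=> Kk; apply: (ge_inf (proj2 lbD)); exists k.
(* A minimizing sequence for the distance to [K]; the parallelogram law makes it Cauchy. *)
have /choice[u hu] : forall n, exists k, K k /\ `[x - k] ^+ 2 < d + n.+1%:R^-1.
  move=> n; have n0 : 0 < n.+1%:R^-1 :> R by rewrite invr_gt0.
  by have [_ [k Kk <-] h] := inf_adherent n0 lbD; exists k.
have uK n : K (u n) by case: (hu n).
have cu : hcauchy u.
  move=> e e0.
  (* The squared distance of two terms is at most twice the sum of their excesses over [d], each of
     which is made smaller than this quarter. *)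
  have e4 : 0 < e ^+ 2 / 4 by rewrite divr_gt0// exprn_gt0.
  have [N hN] : exists N, forall n, (N <= n)%N -> n.+1%:R^-1 < e ^+ 2 / 4.
    have /cvgrPdist_lt/(_ _ e4)[N _ hN] := @cvg_harmonic R.
    by exists N => n /hN /=; rewrite sub0r normrN ger0_norm ?invr_ge0.
  exists N => m n /hN hm /hN hn.
  rewrite -(@ltr_pXn2r _ 2)// ?nnegrE ?hnorm_ge0 ?(ltW e0)//.
  have := parallelogram Hip (x - u m) (x - u n).
  have -> : x - u m + (x - u n) = (2%:R)%:C%C *: (x - (2%:R^-1)%:C%C *: (u m + u n)).
    rewrite scalerBr scalerA -rmorphM mulfV ?pnatr_eq0// rmorph1 scale1r.
    by rewrite rmorph_nat scaler_nat mulr2n opprD addrACA.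
  have -> : x - u m - (x - u n) = u n - u m by rewrite opprB addrC subrKA.
  rewrite (hnormZ Hip) modc_real ger0_norm// (hdistC Hip (u n) (u m)).
  have := dle _ (subspaceZ (2%:R^-1)%:C%C (subspaceD (uK m) (uK n))).
  have [_] := hu m; have [_] := hu n; rewrite exprMn.
  move: (m.+1%:R^-1) (n.+1%:R^-1) hm hn => a b.
  move: (`[_] ^+ 2) (`[_] ^+ 2) (`[_] ^+ 2) => X Y Z; lra.
have [p up] := Vc cu; exists p.
have Kp : K p by case: cK => _ _ /(_ u p); apply.
split=> // k Kk.
have pmin : `[x - p] ^+ 2 <= d.
  apply/ler_addgt0Pr => e e0.
  have d0 : 0 <= d by apply: lb_le_inf => // _ [l _ <-]; rewrite sqr_ge0.
  have de0 : 0 <= d + e by rewrite addr_ge0// ltW.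
  suff h : `[x - p] <= Num.sqrt (d + e).
    rewrite -(@sqr_sqrtr _ (d + e))//.
    by rewrite ler_pXn2r// nnegrE ?hnorm_ge0 ?sqrtr_ge0.
  have [N hN] : exists N, forall n, (N <= n)%N -> n.+1%:R^-1 < e.
    have /cvgrPdist_lt/(_ _ e0)[N _ hN] := @cvg_harmonic R.
    by exists N => n /hN /=; rewrite sub0r normrN ger0_norm ?invr_ge0.
  apply: (@hcvg_norm_le (fun n => x - u (n + N)%N)).
    move=> e' e'0; have [N' hN'] := up _ e'0; exists N' => n Nn.
    rewrite (_ : x - u (n + N)%N - (x - p) = - (u (n + N)%N - p)); last first.
      by rewrite !opprB addrC subrKA.
    by rewrite (hnormN Hip); apply: hN'; rewrite (leq_trans Nn)// leq_addr.
  move=> n; rewrite -(@ger0_norm _ (`[_])) ?hnorm_ge0// -sqrtr_sqr ler_wsqrtr//.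
  have [_ /ltW/le_trans] := hu (n + N)%N; apply; rewrite lerD2l ltW// hN//.
  by rewrite leq_addl.
set z := ip (x - p) k.
apply/eqP/negPn/negP => /eqP z0.
have mz : 0 < modc z by rewrite lt_def modc_ge0 andbT; apply/eqP => /modc_eq0.
(* Moving [p] by [s z k] changes the squared distance by [s |z|^2 (s |k|^2 - 2)], which is negative
   because [s |k|^2 < 1]. *)
pose s : R := (1 + `[k] ^+ 2)^-1.
have k1 : 0 < 1 + `[k] ^+ 2 by rewrite ltr_pwDl// sqr_ge0.
have s0 : 0 < s by rewrite invr_gt0.
have sk : s * `[k] ^+ 2 < 1.
  by rewrite /s mulrC ltr_pdivrMr// mul1r ltrDr.
have := dle _ (subspaceD Kp (subspaceZ (s%:C%C * z) Kk)).
rewrite opprD addrA (sqr_hnormB Hip) (hnormZ Hip) (ipZr Hip) -/z.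
rewrite conjcM conjc_real -mulrA [_^*%C * z]mulrC mulcJ -rmorphM /= modcM modc_real.
rewrite gtr0_norm// !exprMn => h.
have m2 : 0 < modc z ^+ 2 by rewrite exprn_gt0.
have : 0 < modc z ^+ 2 * s by rewrite mulr_gt0.
nra.
Qed.

Definition hproj x : V := xget 0 [set p | K p /\ forall k, K k -> ip (x - p) k = 0].

Lemma hprojP x : K (hproj x) /\ forall k, K k -> ip (x - hproj x) k = 0.
Proof.
rewrite /hproj; case: (xgetP 0) => [p _ //|h].
by have [p hp] := projection_theorem x; case: (h p).
Qed.

Lemma hproj_in x : K (hproj x). Proof. by case: (hprojP x). Qed.

Lemma hproj_orth x k : K k -> ip (x - hproj x) k = 0.
Proof. by case: (hprojP x) => _; apply. Qed.

Lemma hproj_unique x p : K p -> (forall k, K k -> ip (x - p) k = 0) -> hproj x = p.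
Proof.
move=> Kp hp; apply/eqP; rewrite -subr_eq0; apply/eqP/(ip_eq0 Hip).
have Kd : K (hproj x - p) by apply: subspaceB => //; exact: hproj_in.
have -> : ip (hproj x - p) (hproj x - p) =
    ip (x - p) (hproj x - p) - ip (x - hproj x) (hproj x - p).
  by rewrite -(ipBl Hip); congr (ip _ _); rewrite opprB [RHS]addrC subrKA.
by rewrite hp// hproj_orth// subrr.
Qed.

Lemma hproj_id x : K x -> hproj x = x.
Proof. by move=> Kx; apply: hproj_unique => // k _; rewrite subrr (ip0l Hip). Qed.

Lemma hproj_idem x : hproj (hproj x) = hproj x.
Proof. by rewrite hproj_id//; exact: hproj_in. Qed.

Lemma hproj_linear : hlinear hproj.
Proof.
move=> a x y; apply: hproj_unique.
  by apply: subspaceD; [apply: subspaceZ|]; exact: hproj_in.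
move=> k Kk; rewrite opprD addrACA -scalerBr (ipDl Hip) (ipZl Hip).
by rewrite !hproj_orth// mulr0 addr0.
Qed.

Lemma hproj_sym x y : ip (hproj x) y = ip x (hproj y).
Proof.
have h u v : ip (hproj u) (hproj v) = ip u (hproj v).
  by apply/eqP; rewrite eq_sym -subr_eq0 -(ipBl Hip) hproj_orth//; exact: hproj_in.
by rewrite -h (ipC Hip) -h -(ipC Hip).
Qed.

Lemma hproj_pythagoras x : `[x] ^+ 2 = `[hproj x] ^+ 2 + `[x - hproj x] ^+ 2.
Proof.
rewrite -{1}[x](subrK (hproj x)) (sqr_hnormD Hip (x - hproj x)).
rewrite hproj_orth; last exact: hproj_in.
by rewrite mulr0 addr0 addrC.
Qed.

Lemma hproj_le x : `[hproj x] <= `[x].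
Proof.
rewrite -(@ler_pXn2r _ 2)// ?nnegrE ?hnorm_ge0// (hproj_pythagoras x).
by rewrite lerDl sqr_ge0.
Qed.

Lemma hproj_bounded : hbounded hproj.
Proof. by split; [exact: hproj_linear|exists 1 => x; rewrite mul1r hproj_le]. Qed.

(** Invariance under [A] puts [A (hproj x)] in [K]; invariance under the adjoint [A'] keeps the
    residual orthogonal to [K]. *)
Lemma hproj_commute A A' : hlinear A -> (forall x y, ip (A x) y = ip x (A' y)) ->
  (forall x, K x -> K (A x)) -> (forall x, K x -> K (A' x)) ->
  forall x, hproj (A x) = A (hproj x).
Proof.
move=> lA AA' KA KA' x; apply: hproj_unique; first by apply: KA; exact: hproj_in.
by move=> k Kk; rewrite -hlinearB// AA' hproj_orth//; exact: KA'.
Qed.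

End Subspace.

Hypothesis Vc : hcomplete.

Lemma Riesz_representation (phi : V -> R[i]) (M : R) :
  (forall a x y, phi (a *: x + y) = a * phi x + phi y) ->
  (forall x, modc (phi x) <= M * `[x]) -> exists y, forall x, phi x = ip x y.
Proof.
move=> lphi bphi.
have phi0 : phi 0 = 0.
  have := lphi 1 0 0; rewrite scale1r addr0 mul1r => /esym/eqP.
  by rewrite -subr_eq0 addrK => /eqP.
have phiZ a x : phi (a *: x) = a * phi x by rewrite -[_ *: _]addr0 lphi phi0 addr0.
have phiB x y : phi (x - y) = phi x - phi y.
  by rewrite addrC -scaleN1r lphi mulN1r addrC.
pose K : set V := [set x | phi x = 0].
have cK : closed_subspace K.
  split => //.
  - by move=> a x y; rewrite /K/= lphi => -> ->; rewrite mulr0 addr0.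
  - move=> u x uK ux; apply/modc_eq0/eqP; rewrite eq_le modc_ge0 andbT leNgt.
    apply/negP => h.
    have M1 : 0 < `|M| + 1 by rewrite ltr_wpDl.
    have [N hN] := ux (modc (phi x) / (`|M| + 1)) (divr_gt0 h M1).
    have := bphi (u N - x); rewrite phiB uK sub0r modcN.
    have := hN N (leqnn _); rewrite ltr_pdivlMr// => h1 h2.
    have := hnorm_ge0 ip (u N - x); have := ler_norm M; nra.
have [h|/existsNP[x0 /eqP px0]] := pselect (forall x, phi x = 0).
  by exists 0 => x; rewrite h (ip0r Hip).
(* Every [x] differs from [(phi x / phi z) z] by an element of the kernel [K], to which [z] is
   orthogonal. *)
pose z := x0 - hproj K x0.
have pz : phi z = phi x0 by rewrite phiB (hproj_in cK Vc x0 : phi _ = 0) subr0.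
have z0 : `[z] ^+ 2 != 0.
  rewrite expf_neq0//; apply: contra px0 => /eqP/(hnorm_eq0 Hip) z0.
  by rewrite -pz z0 phi0.
exists ((phi z)^*%C * ((`[z] ^+ 2)^-1)%:C%C *: z) => x.
have : K (x - (phi x / phi z) *: z).
  by rewrite /K/= phiB phiZ divfK ?subrr// pz.
move=> /(hproj_orth cK Vc x0); rewrite -/z => /eqP.
rewrite (ipBr Hip) (ipZr Hip) subr_eq0 (ipxx Hip) => /eqP h.
rewrite (ipZr Hip) (ipC Hip z x) h !conjcM !conjcK !conjc_real.
have Z : (((`[z] ^+ 2)^-1)%:C * (`[z] ^+ 2)%:C)%C = 1 :> R[i].
  by rewrite -rmorphM mulVf// rmorph1.
rewrite -mulrA [X in _ * X]mulrCA Z mulr1 mulrC divfK// pz//.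
Qed.

(** Operators given by integrals or series are obtained weakly through this lemma, as are
    adjoints. *)
Lemma form_operator (q : V -> V -> R[i]) (M : R) :
  (forall a x y z, q (a *: x + y) z = a * q x z + q y z) ->
  (forall a x y z, q x (a *: y + z) = a^*%C * q x y + q x z) ->
  (forall x y, modc (q x y) <= M * `[x] * `[y]) ->
  exists S, [/\ hlinear S, forall x, `[S x] <= M * `[x] & forall x y, q x y = ip (S x) y].
Proof.
move=> ql qr qb.
have /choice[S hS] x : exists y, forall z, q x z = ip y z.
  have [||y hy] := @Riesz_representation (fun z => (q x z)^*%C) (M * `[x]).
  - by move=> a y z; rewrite qr conjcD conjcM conjcK.
  - by move=> y; rewrite modcJ.
  by exists y => z; rewrite (ipC Hip) -hy conjcK.
exists S; split => //.
- move=> a x y; apply: (ip_extl Hip) => z.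
  by rewrite (ipDl Hip) (ipZl Hip) -!hS ql.
- move=> x; have [->|/eqP Sx] := eqVneq (S x) 0.
    rewrite (hnorm0 Hip); have [->|x0] := eqVneq x 0; first by rewrite (hnorm0 Hip) mulr0.
    have xp : 0 < `[x].
      by rewrite lt_def hnorm_ge0 andbT; apply: contra x0 => /eqP/(hnorm_eq0 Hip)/eqP.
    by have := le_trans (modc_ge0 _) (qb x x); rewrite pmulr_lge0.
  have Sxp : 0 < `[S x].
    by rewrite lt_def hnorm_ge0 andbT; apply/eqP => /(hnorm_eq0 Hip).
  (* The bound tested on [y = S x] reads [|S x|^2 <= M |x| |S x|]. *)
  have := qb x (S x); rewrite hS (ipxx Hip) modc_real ger0_norm ?sqr_ge0// expr2.
  by rewrite ler_pM2r.
Qed.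

Lemma adjoint_exists S : hbounded S ->
  exists S', hbounded S' /\ forall x y, ip (S x) y = ip x (S' y).
Proof.
move=> [lS [M hM]].
have [|||S' [lS' bS' hS']] := @form_operator (fun x y => ip x (S y)) M.
- by move=> a x y z; rewrite (ipDl Hip) (ipZl Hip).
- by move=> a x y z; rewrite lS (ipDr Hip) (ipZr Hip).
- move=> x y; rewrite (le_trans (modc_ip_le Hip _ _))// mulrAC mulrC.
  by rewrite ler_wpM2r// hnorm_ge0.
exists S'; split; first by split => //; exists M.
by move=> x y; rewrite (ipC Hip) hS' -(ipC Hip).
Qed.

End HilbertSpace.

(** * The absolute value of a symmetric contraction *)

Section Spectral.
Context (R : realType) (V : lmodType R[i]) (ip : V -> V -> R[i]).
Hypothesis Hip : inner_product ip.
Hypothesis Vc : hcomplete ip.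
Local Notation "`[ x ]" := (hnorm ip x) (format "`[ x ]").

Definition symmetric (S : V -> V) := forall x y, ip (S x) y = ip x (S y).

Definition positive (S : V -> V) := forall x, 0 <= complex.Re (ip (S x) x).

Section AbsoluteValue.
Variable c : V -> V.
Hypotheses (cl : hlinear c) (cs : symmetric c) (c1 : forall x, `[c x] <= `[x]).

Let t x := x - c (c x).

(* The iteration for y = 1 - sqrt (1 - t), from y = (t + y ^ 2) / 2. *)
Fixpoint sqrt_iter n (x : V) : V :=
  if n is n'.+1 then (2^-1)%:C%C *: (t x + sqrt_iter n' (sqrt_iter n' x)) else 0.

(** The same iteration for the scalar [t = 1]. It majorizes the norms of the iterates and of their
    differences, so convergence is inherited from a bounded monotone real sequence. *)
Fixpoint sqrt_iter_bound n : R :=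
  if n is n'.+1 then 2^-1 * (1 + sqrt_iter_bound n' ^+ 2) else 0.

Local Notation y := sqrt_iter.
Local Notation alpha := sqrt_iter_bound.

(** The squared norm of [x - c (c x)] is [|x|^2 + |c (c x)|^2 - 2 |c x|^2], and
    [|c (c x)| <= |c x|]. *)
Let t_le x : `[t x] <= `[x].
Proof.
rewrite -(@ler_pXn2r _ 2)// ?nnegrE ?hnorm_ge0// (sqr_hnormB Hip).
rewrite -cs -(sqr_hnorm Hip).
have : `[c (c x)] ^+ 2 <= `[c x] ^+ 2.
  by rewrite ler_pXn2r// ?nnegrE ?hnorm_ge0.
by have := sqr_ge0 (`[c x]); lra.
Qed.

Let alpha01 n : 0 <= alpha n <= 1.
Proof.
elim: n => [|n /andP[a0 a1]] /=; first by rewrite lexx ler01.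
have : alpha n ^+ 2 <= 1 by rewrite exprn_ile1.
by have := sqr_ge0 (alpha n); move: (alpha n ^+ 2) => b *; apply/andP; split; lra.
Qed.

Let alpha_mono n : alpha n <= alpha n.+1.
Proof.
elim: n => [|n IH]; first by case/andP: (alpha01 1).
rewrite [leLHS]/= [leRHS]/=.
have /andP[a0 a1] := alpha01 n; have /andP[b0 b1] := alpha01 n.+1.
by rewrite ler_pM2l ?invr_gt0// lerD2l ler_pXn2r.
Qed.

Lemma sqrt_iter_linear n : hlinear (y n).
Proof.
elim: n => [|n IH] a u v; first by rewrite /= scaler0 addr0.
rewrite /= !IH /t !cl [in RHS]scalerA [in RHS]mulrC -scalerA -scalerDr; congr (_ *: _).
by rewrite scalerDr scalerBr opprD (addrACA (a *: u)) (addrACA (a *: u - _)).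
Qed.

(** The iterates are polynomials in [c]. Whatever commutes with [c] commutes with them, and when
    bounded also with their limit. *)
Lemma sqrt_iter_commute (A : V -> V) n : hlinear A -> (forall x, A (c x) = c (A x)) ->
  forall x, A (y n x) = y n (A x).
Proof.
move=> lA Ac; elim: n => [|n IH] x; first by rewrite /= (hlinear0 lA).
by rewrite /= (hlinearZ _ _ lA) (hlinearD _ _ lA) (hlinearB _ _ lA) !IH !Ac.
Qed.

Let y_commute m n x : y m (y n x) = y n (y m x).
Proof.
apply: sqrt_iter_commute; first exact: sqrt_iter_linear.
by move=> z; apply/esym/sqrt_iter_commute.
Qed.

Lemma sqrt_iter_sym n : symmetric (y n).
Proof.
elim: n => [|n IH] u v; first by rewrite /= (ip0l Hip) (ip0r Hip).
rewrite /= (ipZl Hip) (ipZr Hip) conjc_real (ipDl Hip) (ipDr Hip) (ipBl Hip) (ipBr Hip).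
by rewrite !IH !cs.
Qed.

Let y_le n x : `[y n x] <= alpha n * `[x].
Proof.
elim: n x => [|n IH] x; first by rewrite /= (hnorm0 Hip) mul0r.
rewrite /= (hnormZ Hip) modc_real ger0_norm ?invr_ge0// -mulrA.
rewrite ler_wpM2l ?invr_ge0// mulrDl mul1r (le_trans (ler_hnormD Hip _ _))// lerD//.
have /andP[a0 a1] := alpha01 n.
rewrite (le_trans (IH _))// expr2 -mulrA ler_wpM2l//.
Qed.

(** Since the iterates commute, the difference of the squares of two of them factors, and each
    factor is bounded by the corresponding scalar one. *)
Let y_diff n x : `[y n.+1 x - y n x] <= (alpha n.+1 - alpha n) * `[x].
Proof.
elim: n x => [|n IH] x.
  by rewrite [y 0 x]/= [alpha 0]/= !subr0 y_le.
pose w := y n.+1 x + y n x.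
have -> : y n.+2 x - y n.+1 x = (2^-1)%:C%C *: (y n.+1 w - y n w).
  have -> : y n.+1 w - y n w = y n.+1 (y n.+1 x) - y n (y n x).
    rewrite /w !(hlinearD _ _ (sqrt_iter_linear _)) (y_commute n.+1 n).
    by rewrite opprD addrA addrK.
  transitivity ((2^-1)%:C%C *: (t x + y n.+1 (y n.+1 x)) - (2^-1)%:C%C *: (t x + y n (y n x))) => //.
  rewrite -scalerBr; by congr (_ *: _); rewrite opprD addrACA subrr add0r.
rewrite (hnormZ Hip) modc_real ger0_norm ?invr_ge0//.
have -> : alpha n.+2 - alpha n.+1 = 2^-1 * ((alpha n.+1 - alpha n) * (alpha n.+1 + alpha n)).
  transitivity (2^-1 * (1 + alpha n.+1 ^+ 2) - 2^-1 * (1 + alpha n ^+ 2)) => //.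
  by move: (alpha n.+1) (alpha n) => p q; ring.
rewrite -mulrA ler_wpM2l ?invr_ge0//.
rewrite (le_trans (IH _))// -mulrA ler_wpM2l ?subr_ge0//.
by rewrite (le_trans (ler_hnormD Hip _ _))// mulrDl lerD.
Qed.

Let y_diffm n k x : `[y (n + k)%N x - y n x] <= (alpha (n + k)%N - alpha n) * `[x].
Proof.
elim: k => [|k IH]; first by rewrite addn0 !subrr (hnorm0 Hip) mul0r.
rewrite addnS (le_trans (ler_hdistD Hip (y (n + k) x) _ _))//.
by rewrite (le_trans (lerD (y_diff _ _) IH))// -mulrDl subrKA.
Qed.

Let alpha_homo m n : (m <= n)%N -> alpha m <= alpha n.
Proof. by move/(homo_leq (@lexx _ _) (@le_trans _ _) alpha_mono). Qed.

Let alpha_cauchy e : 0 < e -> exists N, forall k, alpha (N + k)%N - alpha N < e.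
Proof.
move=> e0.
have sA : has_sup (range alpha).
  split; first by exists (alpha 0); exists 0%N.
  by exists 1 => _ [n _ <-]; case/andP: (alpha01 n).
have [_ [N _ <-] hN] := sup_adherent e0 sA; exists N => k.
have : alpha (N + k)%N <= sup (range alpha) by apply: (ub_le_sup (proj2 sA)); exists (N + k)%N.
lra.
Qed.

Let y_cauchy x : hcauchy ip (fun n => y n x).
Proof.
move=> e e0.
have x1 : 0 < `[x] + 1 by rewrite ltr_wpDl// hnorm_ge0.
have e2 : 0 < e / 2 / (`[x] + 1) by rewrite !divr_gt0.
have [N hN] := alpha_cauchy e2; exists N.
have h m : (N <= m)%N -> `[y m x - y N x] < e / 2.
  move=> /subnKC <-; rewrite (le_lt_trans (y_diffm _ _ _))//.
  have := hN (m - N)%N; rewrite ltr_pdivlMr//.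
  have := hnorm_ge0 ip x.
  have : alpha N <= alpha (N + (m - N))%N by apply: alpha_homo; exact: leq_addr.
  nra.
move=> m n /h hm /h hn; rewrite (le_lt_trans (ler_hdistD Hip (y N x) _ _))//.
by rewrite (hdistC Hip (y N x)); lra.
Qed.

Lemma abs_operator : exists b, [/\ hbounded ip b, symmetric b, positive b,
  forall x, b (b x) = c (c x) &
  forall A, hbounded ip A -> (forall x, A (c x) = c (A x)) ->
    forall x, A (b x) = b (A x)].
Proof.
have /choice[z hz] : forall x, exists z, hcvg ip (fun n => y n x) z.
  by move=> x; exact: Vc (y_cauchy x).
have zl : hlinear z.
  move=> a u v; apply: (hcvg_unique Hip (hz _)).
  rewrite (_ : (fun n => _) = (fun n => a *: y n u + y n v)); last first.
    by apply/funext => n; rewrite sqrt_iter_linear.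
  by apply: (hcvgD Hip) => //; exact: (hcvgZ Hip).
have z1 x : `[z x] <= `[x].
  apply: (hcvg_norm_le Hip (hz x)) => n; rewrite (le_trans (y_le _ _))//.
  by case/andP: (alpha01 n) => _ a1; rewrite ler_piMl// hnorm_ge0.
have zs : symmetric z.
  move=> u v; apply/eqP; rewrite -subr_eq0; apply/eqP.
  have -> : ip (z u) v - ip u (z v) = 0 => //.
  suff h e : 0 < e -> modc (ip (z u) v - ip u (z v)) <= e.
    apply/modc_eq0/eqP; rewrite eq_le modc_ge0 andbT.
    by apply/ler_addgt0Pr => e e0; rewrite add0r h.
  move=> e0.
  have w1 : 0 < `[u] + `[v] + 1 by rewrite ltr_wpDl// addr_ge0// hnorm_ge0.
  have [N hN] := hz u _ (divr_gt0 e0 w1); have [N' hN'] := hz v _ (divr_gt0 e0 w1).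
  pose n := maxn N N'.
  have -> : ip (z u) v - ip u (z v) = ip u (y n v - z v) - ip (y n u - z u) v.
    by rewrite (ipBr Hip) (ipBl Hip) sqrt_iter_sym; ring.
  rewrite (le_trans (ler_modcD _ _))// modcN.
  rewrite (le_trans (lerD (modc_ip_le Hip _ _) (modc_ip_le Hip _ _)))//.
  have := hN n (leq_maxl _ _); have := hN' n (leq_maxr _ _).
  move: (`[y n v - z v]) (`[y n u - z u]) => p q.
  rewrite !ltr_pdivlMr//; have := hnorm_ge0 ip u; have := hnorm_ge0 ip v.
  move: (`[u]) (`[v]) w1 => U W w1 W0 U0 hp hq.
  have h1 : U * p <= U * (e / (U + W + 1)) by rewrite ler_wpM2l// ler_pdivlMr// ltW.
  have h2 : q * W <= (e / (U + W + 1)) * W by rewrite ler_wpM2r// ler_pdivlMr// ltW.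
  apply: (le_trans (lerD h1 h2)).
  rewrite mulrC -mulrDr mulrAC ler_pdivrMr// ler_pM2l//; lra.
(* The recursion passes to the limit because the iterates are contractions. *)
have zz x : z x = (2^-1)%:C%C *: (t x + z (z x)).
  apply: (hcvg_unique Hip (hcvg_shift (hz x))).
  apply: (hcvgZ Hip); apply: (hcvgD Hip); first exact: hcvg_cst.
  have h : hcvg ip (fun n => y n (z x)) (z (z x)) by [].
  move=> e e0; have e2 : 0 < e / 2 by rewrite divr_gt0.
  have [N hN] := h _ e2; have [N' hN'] := hz x _ e2; exists (maxn N N') => n.
  rewrite geq_max => /andP[/hN h1 /hN' h2].
  rewrite (le_lt_trans (ler_hdistD Hip (y n (z x)) _ _))//.
  rewrite -(hlinearB _ _ (sqrt_iter_linear n)).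
  have /andP[a0 a1] := alpha01 n.
  have := y_le n (y n x - z x); have := hnorm_ge0 ip (y n x - z x).
  nra.
have zc A : hbounded ip A -> (forall x, A (c x) = c (A x)) -> forall x, A (z x) = z (A x).
  move=> bA Ac x; apply: (hcvg_unique Hip (hbounded_cvg bA (hz x))).
  rewrite (_ : _ \o _ = (fun n => y n (A x)))//.
  by apply/funext => n /=; apply: sqrt_iter_commute => //; case: bA.
have cz x : c (z x) = z (c x).
  by apply: zc => //; split => //; exists 1 => u; rewrite mul1r.
(* The equation [2 z = t + z^2] says that the square of [1 - z] is [1 - t], that is the square of
   [c]; positivity holds because [z] is a contraction. *)
exists (fun x => x - z x); split.
- split; first by move=> a u v; rewrite zl opprD addrACA -scalerBr.
  by exists 2 => x; rewrite (le_trans (ler_hnormB Hip _ _))// mulr2n mulrDl mul1r lerD.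
- by move=> u v; rewrite (ipBl Hip) (ipBr Hip) zs.
- move=> x; rewrite (ipBl Hip) RecD RecN -(sqr_hnorm Hip) subr_ge0.
  by rewrite (le_trans (Re_ip_le Hip _ _))// expr2 ler_wpM2r// hnorm_ge0.
- move=> x; rewrite (hlinearB _ _ zl).
  have zx2 : z x + z x = t x + z (z x).
    rewrite {1 2}(zz x) -scalerDl -rmorphD /=.
    by rewrite (_ : 2^-1 + 2^-1 = 1 :> R) ?rmorph1 ?scale1r//; lra.
  rewrite opprB addrACA -opprD zx2 opprD [- _ - _]addrC addrA addrK.
  by rewrite /t opprB addrC subrK.
- by move=> A bA Ac x; rewrite -zc// (hlinearB _ _ (proj1 bA)).
Qed.

End AbsoluteValue.

End Spectral.

(** * Spectral subspaces of a symmetric operator *)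

Section SpectralSubspaces.
Context (R : realType) (V : lmodType R[i]) (ip : V -> V -> R[i]).
Hypothesis Hip : inner_product ip.
Hypothesis Vc : hcomplete ip.
Local Notation "`[ x ]" := (hnorm ip x) (format "`[ x ]").
Variable a : V -> V.
Hypotheses (ab : hbounded ip a) (asym : symmetric ip a).

(** Applied to [a] itself, to projections on its spectral subspaces, and finally to the operators in
    the commutant of the translations. *)
Definition commutes_with (A : V -> V) := hbounded ip A /\ forall x, A (a x) = a (A x).

(* K is the range of the spectral projection of ]-oo, d], obtained as the
   kernel of the positive part of (a multiple of) a - d. *)
Lemma spectral_subspace (d : R) : exists K : set V,
  [/\ closed_subspace ip K,
      forall A, commutes_with A -> forall x, K x -> K (A x),
      forall x, K x -> complex.Re (ip (a x) x) <= d * `[x] ^+ 2 &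
      forall x, (forall k, K k -> ip x k = 0) -> d * `[x] ^+ 2 <= complex.Re (ip (a x) x)].
Proof.
have [M M0 aM] := hbounded_gt0 ab; have al := proj1 ab.
(* Scales [a - d] to a contraction, as [abs_operator] requires. *)
pose s : R := (M + `|d|)^-1.
have s0 : 0 < s by rewrite invr_gt0 ltr_pwDl.
pose c x := s%:C%C *: (a x - d%:C%C *: x).
have cl : hlinear c.
  move=> t x y; rewrite /c al [in RHS]scalerA [in RHS]mulrC -scalerA -scalerDr; congr (_ *: _).
  by rewrite scalerBr scalerDr opprD addrACA !scalerA [d%:C%C * t]mulrC.
have cs : symmetric ip c.
  move=> x y; rewrite /c (ipZl Hip) (ipZr Hip) conjc_real (ipBl Hip) (ipBr Hip).
  by rewrite (ipZl Hip) (ipZr Hip) conjc_real asym.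
have c1 x : `[c x] <= `[x].
  rewrite /c (hnormZ Hip) modc_real gtr0_norm// mulrC ler_pdivrMr ?ltr_pwDl//.
  rewrite (le_trans (ler_hnormB Hip _ _))// (hnormZ Hip) modc_real.
  by rewrite mulrDr lerD// mulrC// aM.
have cq x : complex.Re (ip (c x) x) = s * (complex.Re (ip (a x) x) - d * `[x] ^+ 2).
  rewrite /c (ipZl Hip) (ipBl Hip) (ipZl Hip) (sqr_hnorm Hip).
  by rewrite Re_realM RecD RecN Re_realM.
have [b [bb bs bp bbc bA]] := abs_operator Hip Vc cl cs c1.
have bl := proj1 bb.
have bc x : c (b x) = b (c x).
  by apply: bA => //; split => //; exists 1 => y; rewrite mul1r.
(* As [b] is the absolute value of [c], the sum [b + c] is twice the positive part of [c]. *)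
exists [set x | b x = - c x]; split.
- split.
  + by rewrite /= (hlinear0 bl) (hlinear0 cl) oppr0.
  + by move=> t x y /= hx hy; rewrite bl cl hx hy opprD scalerN.
  + move=> u x hu ux; apply: (hcvg_unique Hip (hbounded_cvg bb ux)).
    rewrite (_ : b \o u = (fun n => -1 *: c (u n))); last first.
      by apply/funext => n /=; rewrite hu scaleN1r.
    rewrite -scaleN1r; apply: (hcvgZ Hip).
    apply: (@hbounded_cvg _ _ _ c) => //; split => //.
    by exists 1 => y; rewrite mul1r.
- move=> A [Ab Aa] x /= hx.
  have Ac y : A (c y) = c (A y).
    have Al := proj1 Ab.
    by rewrite /c (hlinearZ _ _ Al) (hlinearB _ _ Al) (hlinearZ _ _ Al) Aa.
  by rewrite -bA// hx (hlinearN _ (proj1 Ab)) Ac.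
- move=> x /= hx; have := bp x; rewrite hx (ipNl Hip) RecN cq oppr_ge0.
  by rewrite pmulr_rle0// subr_le0.
- move=> x hx; rewrite -subr_ge0 -(pmulr_rge0 _ s0) -cq.
  (* Since [(b + c) (b - c) = 0], the operator [b - c] maps into the subspace; hence [b] and [c]
     agree on the orthogonal complement. *)
  have h y : ip x (b y - c y) = 0.
    apply: hx => /=; rewrite (hlinearB _ _ bl) (hlinearB _ _ cl) bbc -bc.
    by rewrite opprB.
  have -> : c x = b x.
    apply: (ip_extl Hip) => y; rewrite bs cs; apply/eqP.
    by rewrite eq_sym -subr_eq0 -(ipBr Hip) h.
  exact: bp.
Qed.

Hypothesis apos : positive ip a.

Lemma harmonic_lt (e : R) : 0 < e -> exists N, forall n, (N <= n)%N -> n.+1%:R^-1 < e.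
Proof.
move=> e0; have /cvgrPdist_lt/(_ _ e0)[N _ hN] := @cvg_harmonic R.
by exists N => n /hN /=; rewrite sub0r normrN ger0_norm ?invr_ge0.
Qed.

Hypothesis ainj : forall x, complex.Re (ip (a x) x) = 0 -> x = 0.

Lemma spectral_chain : exists K : nat -> set V,
  [/\ forall n, closed_subspace ip (K n),
      forall n A, commutes_with A -> forall x, K n x -> K n (A x),
      forall m n, (m <= n)%N -> K n `<=` K m,
      forall x e, 0 < e -> exists N, forall n, (N <= n)%N -> `[hproj ip (K n) x] < e &
      forall n x, (forall k, K n k -> ip x k = 0) ->
        n.+1%:R^-1 * `[x] ^+ 2 <= complex.Re (ip (a x) x)].
Proof.
have /choice[K hK] := fun n => spectral_subspace (n.+1%:R^-1).
have cK n : closed_subspace ip (K n) by case: (hK n).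
have KA n A : commutes_with A -> forall x, K n x -> K n (A x).
  by case: (hK n) => _ h _ _; exact: h.
have Kle n x : K n x -> complex.Re (ip (a x) x) <= n.+1%:R^-1 * `[x] ^+ 2.
  by case: (hK n) => _ _ h _; exact: h.
have Kge n x : (forall k, K n k -> ip x k = 0) ->
    n.+1%:R^-1 * `[x] ^+ 2 <= complex.Re (ip (a x) x).
  by case: (hK n) => _ _ _ h; exact: h.
have aa : commutes_with a by [].
have Pa n : commutes_with (hproj ip (K n)).
  split; first exact: hproj_bounded.
  by move=> x; apply: (hproj_commute Hip (cK n) Vc (proj1 ab) asym) => y; exact: KA.
(* The part [h] of [x] orthogonal to [K m] stays in [K n]. Its energy is at least [1/(m+1)] and at
   most [1/(n+1)] times its squared norm, which forces [h = 0] when [m < n]. *)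
have Kmono m n : (m <= n)%N -> K n `<=` K m.
  rewrite leq_eqVlt => /predU1P[->//|mn] x Knx.
  pose h := x - hproj ip (K m) x.
  have Knh : K n h by apply: (subspaceB (cK n)) => //; exact: (KA n _ (Pa m)).
  have h0 : h = 0.
    apply: (hnorm_eq0 Hip); apply/eqP; rewrite -sqrf_eq0 eq_le sqr_ge0 andbT leNgt.
    apply/negP => hp.
    have := le_trans (Kge m h (fun k Kk => hproj_orth Hip (cK m) Vc x Kk)) (Kle n h Knh).
    rewrite ler_pM2r// leNgt; apply/negP/negPn.
    by rewrite ltf_pV2 ?posrE// ltr_nat.
  have -> : x = hproj ip (K m) x by apply/eqP; rewrite -subr_eq0 -/h h0.
  exact: (hproj_in Hip).
exists K; split => // x e e0.
pose p n := hproj ip (K n) x.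
(* By nesting, [p n] is also the projection of [p m]. The squared norms therefore decrease, and
   Pythagoras turns their convergence into the Cauchy property. *)
have pp m n : (m <= n)%N -> `[p m] ^+ 2 = `[p n] ^+ 2 + `[p m - p n] ^+ 2.
  move=> mn.
  have -> : p n = hproj ip (K n) (p m); last exact: hproj_pythagoras.
  symmetry; apply: (hproj_unique Hip (cK n)) => //; first exact: (hproj_in Hip).
  move=> k Kk; rewrite -(subrKA x) (ipDl Hip) (hproj_orth Hip (cK n) Vc)// addr0.
  by rewrite -opprB (ipNl Hip) (hproj_orth Hip (cK m) Vc) ?oppr0//; exact: Kmono Kk.
have cp : hcauchy ip p.
  move=> e' e'0.
  have sA : has_inf [set `[p n] ^+ 2 | n in setT].
    by split; [exists (`[p 0] ^+ 2); exists 0|exists 0 => _ [n _ <-]; rewrite sqr_ge0].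
  have [_ [N _ <-] hN] := inf_adherent (exprn_gt0 2 (divr_gt0 e'0 (@ltr0n R 2))) sA.
  exists N => m n.
  have h k : (N <= k)%N -> `[p k - p N] < e' / 2.
    move=> Nk; rewrite (hdistC Hip) -(@ltr_pXn2r _ 2)// ?nnegrE ?hnorm_ge0 ?divr_ge0 ?ltW//.
    have := pp _ _ Nk.
    have : inf [set `[p n] ^+ 2 | n in setT] <= `[p k] ^+ 2.
      by apply: (ge_inf (proj2 sA)); exists k.
    lra.
  move=> /h hm /h hn; rewrite (le_lt_trans (ler_hdistD Hip (p N) _ _))//.
  by rewrite (hdistC Hip (p N)); lra.
have [q pq] := Vc cp.
(* The limit lies in every [K n], so its energy is at most its squared norm over [n + 1] for all
   [n], and [ainj] applies. *)
have q0 : q = 0.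
  have Kq n : K n q.
    case: (cK n) => _ _ /(_ (fun k => p (n + k)%N) q); apply.
      by move=> k; apply: (Kmono n (n + k)%N (leq_addr _ _)); exact: (hproj_in Hip).
    move=> e' /pq[N hN]; exists N => k Nk; apply: hN.
    by rewrite (leq_trans Nk)// leq_addl.
  apply: ainj; apply/eqP; rewrite eq_le apos andbT.
  apply/ler_addgt0Pr => e' e'0; rewrite add0r.
  have q1 : 0 < `[q] ^+ 2 + 1 by rewrite ltr_wpDl// sqr_ge0.
  have [N /(_ N (leqnn _)) hN] := harmonic_lt (divr_gt0 e'0 q1).
  rewrite (le_trans (Kle N q (Kq N)))//; move: hN; rewrite ltr_pdivlMr//.
  have i0 : 0 <= N.+1%:R^-1 :> R by rewrite invr_ge0.
  by rewrite mulrDr mulr1 => hN; rewrite (le_trans _ (ltW hN))// lerDl.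
have [N hN] := pq e e0; exists N => n /hN; by rewrite q0 subr0.
Qed.

(* The spectral subspaces decrease to 0 while the f n are asymptotically in each of them,
   so cutting a late f n down to the difference of two of them costs little. *)
Lemma orthogonalize (f : nat -> V) :
  (forall n, `[f n] = 1) ->
  (forall e, 0 < e -> exists N, forall n, (N <= n)%N -> complex.Re (ip (a (f n)) (f n)) < e) ->
  exists (r : nat -> nat) (g : nat -> V),
    [/\ forall k, (k <= r k)%N, forall k, `[g k] = 1,
        forall k, `[g k - f (r k)] <= k.+1%:R^-1 &
        forall j k A A', j <> k -> commutes_with A -> commutes_with A' ->
          (forall x y, ip (A x) y = ip x (A' y)) -> ip (A (g j)) (g k) = 0].
Proof.
move=> f1 fa; have [K [cK KA Kmono K0 Kge]] := spectral_chain.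
have Pa n : commutes_with (hproj ip (K n)).
  split; first exact: hproj_bounded.
  by move=> x; apply: (hproj_commute Hip (cK n) Vc (proj1 ab) asym) => y; exact: KA.
(* The triple holds the index of the chosen [f], the next level, and a unit vector in [K m]
   orthogonal to the spectral subspace of that next level. *)
have step m k : exists q : nat * nat * V,
    [/\ (k <= q.1.1)%N, (m < q.1.2)%N, `[q.2] = 1, `[q.2 - f q.1.1] <= k.+1%:R^-1 &
      K m q.2 /\ forall z, K q.1.2 z -> ip q.2 z = 0].
  have k0 : 0 < k.+1%:R^-1 :> R by rewrite invr_gt0.
  have k1 : k.+1%:R^-1 <= 1 :> R by rewrite invf_le1// ler1n.
  move: (k.+1%:R^-1 : R) k0 k1 => i k0 k1.
  (* The cut costs less than [2 * e], and the normalization as much again. *)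
  pose e : R := i / 4.
  have e0 : 0 < e by rewrite divr_gt0.
  have m0 : 0 < m.+1%:R^-1 :> R by rewrite invr_gt0.
  (* On the complement of [K m] the operator is at least [1/(m+1)], so an energy this small leaves a
     residual of norm below [e]. *)
  have [N hN] := fa (m.+1%:R^-1 * e ^+ 2) (mulr_gt0 m0 (exprn_gt0 2 e0)).
  pose n := maxn k N; pose P i := hproj ip (K i).
  have fP : `[f n - P m (f n)] < e.
    rewrite -(@ltr_pXn2r _ 2)// ?nnegrE ?hnorm_ge0 ?ltW// -(ltr_pM2l m0).
    have ho z : K m z -> ip (f n - P m (f n)) z = 0 by exact: (hproj_orth Hip).
    apply: (le_lt_trans (Kge m _ ho)).
    apply: le_lt_trans (hN n (leq_maxr _ _)).
    (* [K m] and its complement are both invariant under [a], so the energy of [f n] is the sum of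
       the energies of its two parts. *)
    have fE : f n = P m (f n) + (f n - P m (f n)) by rewrite addrC subrK.
    have Ka x : K m x -> K m (a x) by apply: KA.
    have z1 : ip (a (P m (f n))) (f n - P m (f n)) = 0.
      rewrite (ipC Hip) ho ?conjc0//; apply: Ka; exact: (hproj_in Hip).
    have z2 : ip (a (f n - P m (f n))) (P m (f n)) = 0.
      by rewrite asym ho//; apply: Ka; exact: (hproj_in Hip).
    have aD p h : ip (a p) h = 0 -> ip (a h) p = 0 -> complex.Re (ip (a (p + h)) (p + h)) =
        complex.Re (ip (a p) p) + complex.Re (ip (a h) h).
      by move=> ph hp; rewrite (hlinearD _ _ (proj1 ab)) (ipDl Hip) !(ipDr Hip) ph hp add0r addr0 RecD.
    by rewrite [in leRHS]fE (aD _ _ z1 z2) lerDr apos.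
  have [N' hN'] := K0 (f n) e e0; pose m' := maxn m.+1 N'.
  have Pe : `[P m' (f n)] < e by apply: hN'; exact: leq_maxr.
  have mm' : (m < m')%N by exact: leq_maxl.
  pose g := P m (f n) - P m' (f n).
  have gf : `[g - f n] < 2 * e.
    rewrite (_ : g - f n = - (f n - P m (f n)) - P m' (f n)); last first.
      by rewrite opprB addrAC.
    by rewrite (le_lt_trans (ler_hnormB Hip _ _))// (hnormN Hip) mulr2n mulrDl mul1r ltrD.
  have := ler_dist_hnorm Hip g (f n); rewrite f1 => g1.
  have {}g1 : `| `[g] - 1| < 2 * e by apply: le_lt_trans gf.
  have g0 : 0 < `[g].
    by move: g1; rewrite ltr_norml /e => /andP[+ _]; lra.
  exists (n, m', (`[g]^-1)%:C%C *: g) => /=; split => //.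
  - exact: leq_maxl.
  - by rewrite (hnormZ Hip) modc_real gtr0_norm ?invr_gt0// mulVf// gt_eqF.
  - rewrite (le_trans (ler_hdistD Hip g _ _))//.
    have -> : `[(`[g]^-1)%:C%C *: g - g] = `| `[g] - 1|.
      have -> : (`[g]^-1)%:C%C *: g - g = (`[g]^-1 - 1)%:C%C *: g.
        by rewrite rmorphB rmorph1 scalerBl scale1r.
      rewrite (hnormZ Hip) modc_real -[X in _ * X](gtr0_norm g0) -normrM.
      by rewrite mulrBl mul1r mulVf ?gt_eqF// distrC.
    by move: gf g1; rewrite /e; lra.
  - have KP l : K l (P l (f n)) by exact: (hproj_in Hip).
    split.
      apply: (subspaceZ (cK m)); apply: (subspaceB (cK m)) => //.
      exact: (Kmono m m' (ltnW mm')).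
    move=> z Kz; rewrite (ipZl Hip) /g -(subrKA (f n)) (ipDl Hip).
    rewrite (hproj_orth Hip (cK m') Vc)// addr0 -opprB (ipNl Hip).
    by rewrite (hproj_orth Hip (cK m) Vc) ?oppr0 ?mulr0//; exact: (Kmono m m' (ltnW mm')).
have /choice[F hF] : forall p : nat * nat, exists q : nat * nat * V,
    [/\ (p.2 <= q.1.1)%N, (p.1 < q.1.2)%N, `[q.2] = 1, `[q.2 - f q.1.1] <= p.2.+1%:R^-1 &
      K p.1 q.2 /\ forall z, K q.1.2 z -> ip q.2 z = 0].
  by move=> [m k]; exact: step.
(* The levels: [g k] lies in [K (m k)] and is orthogonal to [K (m k.+1)]. *)
pose fix m k := if k is k'.+1 then (F (m k', k')).1.2 else 0%N.
pose r k := (F (m k, k)).1.1; pose g k := (F (m k, k)).2.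
have mS k : (m k < m k.+1)%N by case: (hF (m k, k)).
have mm j k : (j <= k)%N -> (m j <= m k)%N.
  by move/(homo_leq (@leqnn) (@leq_trans)); apply => i; exact: ltnW.
have gK k : K (m k) (g k) by case: (hF (m k, k)) => _ _ _ _ [].
have gO k z : K (m k.+1) z -> ip (g k) z = 0 by case: (hF (m k, k)) => _ _ _ _ [_]; apply.
exists r, g; split.
- by move=> k; case: (hF (m k, k)).
- by move=> k; case: (hF (m k, k)).
- by move=> k; case: (hF (m k, k)).
(* If [j < k], then [A' (g k)] stays in [K (m k)], which is contained in [K (m j.+1)], and [g j] is
   orthogonal to the latter. The other case is symmetric. *)
- move=> j k A A' jk Ac A'c AA'.
  have /orP[jk'|kj'] : (j < k)%N || (k < j)%N by rewrite -neq_ltn; apply/eqP.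
    by rewrite AA' gO//; apply: KA => //; apply: (Kmono _ (m k)) => //; exact: mm.
  rewrite (ipC Hip) gO ?conjc0//.
  by apply: KA => //; apply: (Kmono _ (m j)) => //; exact: mm.
Qed.

End SpectralSubspaces.

(** * Integrals of complex functions *)

Section ComplexIntegral.
Context d (T : measurableType d) (R : realType) (mu : {measure set T -> \bar R}).
Implicit Types (f g h : T -> R[i]).

Definition cmeasurable h : Prop :=
  measurable_fun [set: T] (fun x => complex.Re (h x)) /\
  measurable_fun [set: T] (fun x => complex.Im (h x)).

Definition cintegrable h : Prop :=
  mu.-integrable [set: T] (fun x => (complex.Re (h x))%:E) /\
  mu.-integrable [set: T] (fun x => (complex.Im (h x))%:E).

Definition cint h : R[i] :=
  Complex (\int[mu]_x complex.Re (h x)) (\int[mu]_x complex.Im (h x)).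

Lemma cmeasurableD f g : cmeasurable f -> cmeasurable g -> cmeasurable (fun x => f x + g x).
Proof.
move=> [fr fi] [gr gi]; split.
  by under eq_fun do rewrite RecD; exact: measurable_funD.
by under eq_fun do rewrite ImcD; exact: measurable_funD.
Qed.

Lemma cmeasurableM f g : cmeasurable f -> cmeasurable g -> cmeasurable (fun x => f x * g x).
Proof.
move=> [fr fi] [gr gi]; split.
  by under eq_fun do rewrite RecM; apply: measurable_funB; exact: measurable_funM.
by under eq_fun do rewrite ImcM; apply: measurable_funD; exact: measurable_funM.
Qed.

Lemma cmeasurableJ f : cmeasurable f -> cmeasurable (fun x => (f x)^*%C).
Proof.
move=> [fr fi]; split; first by under eq_fun do rewrite RecJ.
by under eq_fun do rewrite ImcJ; exact: measurableT_comp.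
Qed.

Lemma cmeasurable_cst z : cmeasurable (fun=> z).
Proof. by split; exact: measurable_cst. Qed.

Lemma cmeasurableB f g : cmeasurable f -> cmeasurable g -> cmeasurable (fun x => f x - g x).
Proof.
move=> [fr fi] [gr gi]; split.
  by under eq_fun do rewrite RecD RecN; exact: measurable_funB.
by under eq_fun do rewrite ImcD ImcN; exact: measurable_funB.
Qed.

Lemma cmeasurable_sum n (F : nat -> T -> R[i]) : (forall i, cmeasurable (F i)) ->
  cmeasurable (fun x => \sum_(i < n) F i x).
Proof.
move=> mF; elim: n => [|n IH].
  by under eq_fun do rewrite big_ord0; exact: cmeasurable_cst.
by under eq_fun do rewrite big_ord_recr; exact: cmeasurableD.
Qed.

Lemma cmeasurable_indic (A : set T) : measurable A -> cmeasurable (fun x => (\1_A x)%:C%C).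
Proof.
move=> mA; split => /=; [exact: measurable_indic|exact: measurable_cst].
Qed.

Lemma cintegrable_le h (k : T -> R) : cmeasurable h ->
  mu.-integrable [set: T] (EFin \o k) -> (forall x, modc (h x) <= k x) -> cintegrable h.
Proof.
move=> [hr hi] ik hk; split.
  apply: (le_integrable _ _ _ ik) => //; first exact/measurable_EFinP.
  move=> x _ /=; rewrite lee_fin (le_trans (modc_Re _))// (le_trans (hk x))//.
  exact: ler_norm.
apply: (le_integrable _ _ _ ik) => //; first exact/measurable_EFinP.
move=> x _ /=; rewrite lee_fin (le_trans (modc_Im _))// (le_trans (hk x))//.
exact: ler_norm.
Qed.

Lemma cintD f g : cintegrable f -> cintegrable g ->
  cint (fun x => f x + g x) = cint f + cint g.
Proof.
move=> [fr fi] [gr gi]; apply: complexP; rewrite /= -RintegralD//.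
  by apply: eq_Rintegral => x _; rewrite RecD.
by apply: eq_Rintegral => x _; rewrite ImcD.
Qed.

Lemma cintZ a f : cintegrable f -> cint (fun x => a * f x) = a * cint f.
Proof.
move=> [fr fi].
have Z (k : R) (p : T -> R) : mu.-integrable [set: T] (EFin \o p) ->
    mu.-integrable [set: T] (fun x => (k * p x)%:E).
  by move=> ip; under eq_fun do rewrite EFinM; exact: integrableZl.
apply: complexP; rewrite ?RecM ?ImcM /= -!RintegralZl//.
  by rewrite -RintegralB//; [|exact: Z|exact: Z]; apply: eq_Rintegral => x _; rewrite RecM.
by rewrite -RintegralD//; [|exact: Z|exact: Z]; apply: eq_Rintegral => x _; rewrite ImcM.
Qed.

Lemma cintJ f : cintegrable f -> cint (fun x => (f x)^*%C) = (cint f)^*%C.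
Proof.
move=> [fr fi]; apply: complexP => /=.
  by apply: eq_Rintegral => x _; rewrite RecJ.
rewrite -mulN1r -RintegralZl//.
by apply: eq_Rintegral => x _; rewrite ImcJ mulN1r.
Qed.

Lemma cintegrableD f g : cintegrable f -> cintegrable g -> cintegrable (fun x => f x + g x).
Proof.
move=> [fr fi] [gr gi]; split.
  by under eq_fun do rewrite RecD EFinD; exact: integrableD.
by under eq_fun do rewrite ImcD EFinD; exact: integrableD.
Qed.

Lemma cint_ae_eq f g : cmeasurable f -> cmeasurable g ->
  (\forall x \ae mu, f x = g x) -> cint f = cint g.
Proof.
move=> [fr fi] [gr gi] fg; apply: complexP => /=; congr fine; apply: ae_eq_integral => //.
- exact/measurable_EFinP.
- exact/measurable_EFinP.
- by apply: filterS fg => x /= -> _.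
- exact/measurable_EFinP.
- exact/measurable_EFinP.
- by apply: filterS fg => x /= -> _.
Qed.

Lemma integrable_indic_lty (A : set T) : measurable A -> (mu A < +oo)%E ->
  mu.-integrable [set: T] (fun x => (\1_A x)%:E).
Proof.
move=> mA Aoo; apply/integrableP; split; first exact/measurable_EFinP.
under eq_integral do rewrite gee0_abs ?lee_fin//.
by rewrite integral_indic// setIT.
Qed.

(** The factor 2 comes from bounding the real and imaginary parts separately; it reappears in the
    bounds on the averaging operators. *)
Lemma modc_cint_le f (k : R) (A : set T) : measurable A -> (mu A < +oo)%E ->
  cmeasurable f -> (forall x, modc (f x) <= k * \1_A x) -> modc (cint f) <= 2 * k * fine (mu A).
Proof.
move=> mA Aoo mf fk.
have iA : mu.-integrable [set: T] (EFin \o (fun x => k * \1_A x)).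
  rewrite (_ : _ \o _ = (fun x => k%:E * (\1_A x)%:E)%E); last by apply/funext => x /=.
  by apply: integrableZl => //; exact: integrable_indic_lty.
have [fr fi] := cintegrable_le mf iA fk.
have IA : \int[mu]_x (k * \1_A x) = k * fine (mu A).
  rewrite RintegralZl//; last exact: integrable_indic_lty.
  by rewrite /Rintegral integral_indic// setIT.
have n (p : T -> R) : mu.-integrable [set: T] (EFin \o p) ->
   (forall x, `|p x| <= k * \1_A x) -> `|\int[mu]_x p x| <= k * fine (mu A).
  move=> hi hk; rewrite (le_trans (le_normr_Rintegral _ hi))// -IA.
  apply: le_Rintegral => //; by have := integrable_norm hi.
have : modc (cint f) <= `|complex.Re (cint f)| + `|complex.Im (cint f)|.
  rewrite -(@ler_pXn2r _ 2)// ?nnegrE ?addr_ge0 ?modc_ge0// modc2E sqrrD !real_normK ?num_real//.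
  by rewrite lerD2r lerDl mulrn_wge0// mulr_ge0.
move=> /le_trans; apply; rewrite -mulrA mulr2n mulrDl mul1r lerD//=; apply: n => // x.
  by rewrite (le_trans (modc_Re _)).
by rewrite (le_trans (modc_Im _)).
Qed.

End ComplexIntegral.

(** * [L2 mu] as an inner product space *)

Section L2Functions.
Context d (T : measurableType d) (R : realType) (mu : {measure set T -> \bar R}).
Implicit Types (f g : T -> R[i]) (u v : L2 mu).
Local Open Scope quotient_scope.

Lemma sq_integrable_measurable f : sq_integrable mu f -> cmeasurable f.
Proof. by case. Qed.

Lemma sq_integrable_modc2 f : sq_integrable mu f ->
  mu.-integrable [set: T] (fun x => (modc (f x) ^+ 2)%:E).
Proof.
move=> [fr fi foo]; apply/integrableP; split; first exact: measurable_modc2.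
by under eq_integral do rewrite gee0_abs ?lee_fin ?sqr_ge0//.
Qed.

Lemma sq_integrable_pair f g : sq_integrable mu f -> sq_integrable mu g ->
  cintegrable mu (fun x => f x * (g x)^*%C).
Proof.
move=> sf sg.
apply: (@cintegrable_le _ _ _ _ _ (fun x => modc (f x) ^+ 2 + modc (g x) ^+ 2)).
- apply: cmeasurableM; first exact: sq_integrable_measurable sf.
  by apply: cmeasurableJ; exact: sq_integrable_measurable sg.
- by apply: (@integrableD _ _ _ _ _ _ (fun x => (modc (f x) ^+ 2)%:E)
    (fun x => (modc (g x) ^+ 2)%:E)) => //; exact: sq_integrable_modc2.
- move=> x; rewrite modcM modcJ.
  have := modc_ge0 (f x); have := modc_ge0 (g x).
  by have := sqr_ge0 (modc (f x) - modc (g x)); nra.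
Qed.

Lemma sq_integrable_le f g (k : R) : cmeasurable f -> sq_integrable mu g ->
  (forall x, modc (f x) <= k * modc (g x)) -> sq_integrable mu f.
Proof.
move=> [fr fi] sg fg; split => //.
have ig := sq_integrable_modc2 sg.
have [gr gi goo] := sg.
apply: (@le_lt_trans _ _ (\int[mu]_x ((k ^+ 2)%:E * (modc (g x) ^+ 2)%:E))%E).
  apply: ge0_le_integral => //.
  - by move=> x _; rewrite lee_fin sqr_ge0.
  - exact: measurable_modc2.
  - by apply: measurable_funeM; exact: measurable_modc2.
  - move=> x _; rewrite -EFinM lee_fin -exprMn ler_pXn2r// ?nnegrE ?modc_ge0//.
    exact: le_trans (modc_ge0 _) (fg x).
rewrite ge0_integralZl_EFin ?sqr_ge0//; first by rewrite lte_mul_pinfty// lee_fin sqr_ge0.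
- by move=> x _; rewrite lee_fin sqr_ge0.
- exact: measurable_modc2.
Qed.

Lemma sq_integrableZD a f g : sq_integrable mu f -> sq_integrable mu g ->
  sq_integrable mu (fun x => a * f x + g x).
Proof.
move=> sf sg; have [_ h] := @sqint_submod_closed _ T R mu.
have := h a f g; rewrite !inE; exact.
Qed.

Lemma L2_reprP u : sq_integrable mu (L2_repr u).
Proof. by have := valP (repr u : l2fun mu); rewrite inE. Qed.

Lemma eq_pi_L2 (p q : l2fun mu) :
  (\pi_(L2 mu) p = \pi_(L2 mu) q) <-> (\forall x \ae mu, p x = q x).
Proof.
have := Quotient.idealrBE (@ae_null _ T R mu) p q => E; split.
  move=> /eqP; rewrite -E inE /=; apply: filterS => x /eqP.
  by rewrite /= !fctE subr_eq0 => /eqP.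
move=> pq; apply/eqP; rewrite -E inE /=; apply: filterS pq => x pq.
by rewrite /= !fctE pq subrr.
Qed.

Lemma L2_classK f : sq_integrable mu f -> \forall x \ae mu, L2_repr (L2_class mu f) x = f x.
Proof.
move=> sf; set p : l2fun mu := insubd (0 : l2fun mu) f.
have pf : l2fun_val p = f by apply: insubdK; rewrite inE.
have : \pi_(L2 mu) (repr (L2_class mu f)) = \pi_(L2 mu) p by rewrite reprK.
by move=> /eq_pi_L2; apply: filterS => x; rewrite /= pf.
Qed.

Lemma L2_ext u v : (\forall x \ae mu, L2_repr u x = L2_repr v x) -> u = v.
Proof. by move=> /eq_pi_L2; rewrite !reprK. Qed.

Lemma L2_reprK u : L2_class mu (L2_repr u) = u.
Proof. by apply: L2_ext; apply: L2_classK; exact: L2_reprP. Qed.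

Lemma L2_reprZD a u v :
  \forall x \ae mu, L2_repr (a *: u + v) x = a * L2_repr u x + L2_repr v x.
Proof.
have : \pi_(L2 mu) (repr (a *: u + v)) = \pi_(L2 mu) (a *: repr u + repr v : l2fun mu).
  by rewrite pi_L2D pi_L2_scale !reprK.
by move=> /eq_pi_L2; apply: filterS => x h; exact: h.
Qed.

Lemma L2_repr0 : \forall x \ae mu, L2_repr (0 : L2 mu) x = 0.
Proof.
have := L2_reprZD (-1) 0 0; rewrite scaler0 addr0; apply: filterS => x ->.
by rewrite mulN1r addNr.
Qed.

Lemma eq_L2_class f g : sq_integrable mu f -> sq_integrable mu g ->
  (\forall x \ae mu, f x = g x) -> L2_class mu f = L2_class mu g.
Proof.
move=> sf sg fg; apply: L2_ext.
by apply: filterS3 (L2_classK sf) (L2_classK sg) fg => x -> -> ->.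
Qed.

Lemma L2_classZD a f g : sq_integrable mu f -> sq_integrable mu g ->
  L2_class mu (fun x => a * f x + g x) = a *: L2_class mu f + L2_class mu g.
Proof.
move=> sf sg; apply: L2_ext.
apply: filterS3 (L2_classK (sq_integrableZD a sf sg)) (L2_reprZD a (L2_class mu f) (L2_class mu g))
  (filterI (L2_classK sf) (L2_classK sg)) => x -> -> [-> ->] //.
Qed.

Lemma L2_classB f g : sq_integrable mu f -> sq_integrable mu g ->
  L2_class mu (fun x => f x - g x) = L2_class mu f - L2_class mu g.
Proof.
move=> sf sg; rewrite [RHS]addrC -scaleN1r -L2_classZD//.
by congr L2_class; apply/funext => x; rewrite mulN1r addrC.
Qed.

Lemma innerE u v : inner u v = cint mu (fun x => L2_repr u x * (L2_repr v x)^*%C).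
Proof. by []. Qed.

Lemma inner_class f g : sq_integrable mu f -> sq_integrable mu g ->
  inner (L2_class mu f) (L2_class mu g) = cint mu (fun x => f x * (g x)^*%C).
Proof.
move=> sf sg; rewrite innerE; apply: cint_ae_eq.
- apply: cmeasurableM; first exact/sq_integrable_measurable/L2_reprP.
  by apply: cmeasurableJ; exact/sq_integrable_measurable/L2_reprP.
- apply: cmeasurableM; first exact: sq_integrable_measurable sf.
  by apply: cmeasurableJ; exact: sq_integrable_measurable sg.
- by apply: filterS2 (L2_classK sf) (L2_classK sg) => x -> ->.
Qed.

Lemma inner_product_L2 : inner_product (@inner _ T R mu).
Proof.
have iI (u v : L2 mu) : cintegrable mu (fun x => L2_repr u x * (L2_repr v x)^*%C).
  by apply: sq_integrable_pair; exact: L2_reprP.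
have L a u v w : inner (a *: u + v) w = a * inner u w + inner v w.
  rewrite -(L2_reprK u) -(L2_reprK v) -(L2_reprK w).
  have su := L2_reprP u; have sv := L2_reprP v; have sw := L2_reprP w.
  rewrite -L2_classZD// !inner_class//; last exact: sq_integrableZD.
  rewrite -cintZ// -cintD//; first by congr (cint mu); apply/funext => x; ring.
  have := sq_integrable_pair (sq_integrableZD a su (L2_reprP 0)) sw.
  have [r i] := iI u w.
  have Z (k : R) (p : T -> R) : mu.-integrable [set: T] (EFin \o p) ->
      mu.-integrable [set: T] (fun x => (k * p x)%:E).
    by move=> ip; under eq_fun do rewrite EFinM; exact: integrableZl.
  move=> _; split.
    under eq_fun do rewrite RecM EFinB; apply: integrableB => //; exact: Z.
  under eq_fun do rewrite ImcM EFinD; apply: integrableD => //; exact: Z.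
split.
- by move=> u v w; rewrite -[u]scale1r L mul1r scale1r.
- move=> a u v; have z0 : inner (0 : L2 mu) v = 0.
    have := L 1 0 0 v; rewrite scale1r addr0 mul1r => /esym/eqP.
    by rewrite -subr_eq0 addrK => /eqP.
  by rewrite -[a *: u]addr0 L z0 addr0.
- move=> u v; rewrite !innerE -cintJ//; congr (cint mu); apply/funext => x.
  by rewrite conjcM conjcK mulrC.
- move=> u /=; apply: Rintegral_ge0 => x _.
  by rewrite mulcJ /= sqr_ge0.
- move=> u /= h; apply: L2_ext.
  have iu := sq_integrable_modc2 (L2_reprP u).
  have z : (\int[mu]_x `|(modc (L2_repr u x) ^+ 2)%:E| = 0)%E.
    under eq_integral do rewrite gee0_abs ?lee_fin ?sqr_ge0//.
    have e0 : \int[mu]_x (modc (L2_repr u x) ^+ 2) = 0.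
      by rewrite -[RHS]h; apply: eq_Rintegral => x _; rewrite mulcJ.
    rewrite -[LHS]fineK; last by apply: integrable_fin_num iu.
    by congr EFin; exact: e0.
  move/ae_eq_integral_abs : z => /(_ measurableT) z.
  have {}z := z (measurable_int mu iu).
  apply: filterS2 (z) L2_repr0 => x /= /(_ I) [] /eqP; rewrite sqrf_eq0 => /eqP/modc_eq0 -> ->.
  by [].
Qed.

Lemma l2normE u : l2norm u = hnorm (@inner _ T R mu) u. Proof. by []. Qed.

Lemma sqr_l2norm_class f : sq_integrable mu f ->
  l2norm (L2_class mu f) ^+ 2 = \int[mu]_x modc (f x) ^+ 2.
Proof.
move=> sf; rewrite (sqr_hnorm inner_product_L2) inner_class//=.
by apply: eq_Rintegral => x _; rewrite mulcJ.
Qed.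

Lemma EFin_sqr_l2norm_class f : sq_integrable mu f ->
  (l2norm (L2_class mu f) ^+ 2)%:E = (\int[mu]_x (modc (f x) ^+ 2)%:E)%E.
Proof.
move=> sf; rewrite sqr_l2norm_class// /Rintegral fineK//.
exact/integrable_fin_num/sq_integrable_modc2.
Qed.

Lemma EFin_sqr_l2norm u :
  (l2norm u ^+ 2)%:E = (\int[mu]_x (modc (L2_repr u x) ^+ 2)%:E)%E.
Proof. by rewrite -{1}(L2_reprK u); apply: EFin_sqr_l2norm_class; exact: L2_reprP. Qed.

Lemma l2norm_ge0 u : 0 <= l2norm u. Proof. exact: hnorm_ge0. Qed.

Lemma l2distC u v : l2norm (u - v) = l2norm (v - u).
Proof. exact: (hdistC inner_product_L2). Qed.

Lemma ler_l2distD w u v : l2norm (u - v) <= l2norm (u - w) + l2norm (w - v).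
Proof. exact: (ler_hdistD inner_product_L2). Qed.

Lemma ler_l2normD u v : l2norm (u + v) <= l2norm u + l2norm v.
Proof. exact: (ler_hnormD inner_product_L2). Qed.

Lemma l2normZ a u : l2norm (a *: u) = modc a * l2norm u.
Proof. exact: (hnormZ inner_product_L2). Qed.

Lemma l2norm0 : l2norm (0 : L2 mu) = 0.
Proof. exact: (hnorm0 inner_product_L2). Qed.

End L2Functions.

(** * Completeness of [L2 mu] *)

Section Completeness.

Lemma geometric_cvg (R : realType) (a : nat -> R) (s : R) :
  (forall k, `|a k.+1 - a k| <= s * 2^-1 ^+ k) ->
  cvgn a /\ forall k, `|limn a - a k| <= 2 * s * 2^-1 ^+ k.
Proof.
move=> ha.
(* Adding and subtracting the tail of the geometric series gives a nonincreasing and a nondecreasing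
   sequence that squeeze [a]. *)
pose p k := a k + 2 * s * 2^-1 ^+ k; pose q k := a k - 2 * s * 2^-1 ^+ k.
have pS k : p k.+1 <= p k.
  rewrite /p exprS; have := ha k; rewrite ler_norml => /andP[_].
  by move: (2^-1 ^+ k) => t; lra.
have qS k : q k <= q k.+1.
  rewrite /q exprS; have := ha k; rewrite ler_norml => /andP[+ _].
  by move: (2^-1 ^+ k) => t; lra.
have s0 : 0 <= s by have := ha 0%N; rewrite expr0 mulr1; exact: le_trans.
have t0 k : 0 <= 2 * s * 2^-1 ^+ k by rewrite mulr_ge0 ?mulr_ge0 ?exprn_ge0 ?invr_ge0.
have pni : nonincreasing_seq p by apply/nonincreasing_seqP.
have qnd : nondecreasing_seq q by apply/nondecreasing_seqP.
have qp k l : q k <= p l.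
  have [kl|lk] := leP k l.
    by rewrite (le_trans (qnd _ _ kl))// /p /q lerD2l ge0_cp// oppr_le0.
  by rewrite (le_trans _ (pni _ _ (ltnW lk)))// /p /q lerD2l ge0_cp// oppr_le0.
have cp : cvgn p.
  by apply: nonincreasing_is_cvgn => //; exists (q 0%N) => _ [k _ <-].
have t_cvg : 2 * s * 2^-1 ^+ k @[k --> \oo] --> (0 : R).
  rewrite -[0](mulr0 (2 * s)); apply: cvgMr; apply: cvg_expr.
  by rewrite ger0_norm// ?invr_ge0// invf_lt1// ltr1n.
have a_cvg : a @ \oo --> limn p.
  rewrite -[limn p]subr0 (_ : a = fun k => p k - 2 * s * 2^-1 ^+ k).
    exact: cvgB.
  by apply/funext => k; rewrite /p addrK.
have -> : limn a = limn p by exact: cvg_lim.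
split; first exact: a_cvg.
move=> k; rewrite ler_norml lerBrDr addrC.
have q_cvg : q @ \oo --> limn p by rewrite -[limn p]subr0; exact: cvgB.
apply/andP; split.
  rewrite -(cvg_lim _ q_cvg)//; apply: nondecreasing_cvgn_le => //.
  by apply/cvg_ex; exists (limn p); exact: q_cvg.
by rewrite lerBlDr addrC; apply: nonincreasing_cvgn_ge.
Qed.

Context d (T : measurableType d) (R : realType) (mu : {measure set T -> \bar R}).
Let ipL2 := inner_product_L2 mu.

Theorem L2_complete : hcomplete (@inner _ T R mu).
Proof.
move=> u cu.
(* The factor [4^k] pays for the weight in [C]; the factor [2^(k+1)] makes the weighted series of
   integrals summable, with sum at most 1. *)
pose e k : R := (4 ^+ k * 2 ^+ k.+1)^-1.
have e0 k : 0 < e k by rewrite invr_gt0 mulr_gt0 ?exprn_gt0.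
have e1 k : e k <= 1.
  by rewrite invf_le1 ?mulr_gt0 ?exprn_gt0// mulr_ege1// exprn_ege1// ler1n.
have /choice[N hN] := fun k => cu (e k) (e0 k).
pose fix M k := if k is k'.+1 then maxn (M k') (N k) else N 0%N.
have MN k : (N k <= M k)%N by case: k => //= k; exact: leq_maxr.
have MM k : (M k <= M k.+1)%N by exact: leq_maxl.
pose v k := u (M k); pose h k x := L2_repr (v k) x.
have sh k : sq_integrable mu (h k) by exact: L2_reprP.
have shB k : sq_integrable mu (fun x => h k.+1 x - h k x).
  have -> : (fun x => h k.+1 x - h k x) = fun x => -1 * h k x + h k.+1 x.
    by apply/funext => x; rewrite mulN1r addrC.
  exact: sq_integrableZD.
pose D k x : R := modc (h k.+1 x - h k x) ^+ 2.
have ID k : (\int[mu]_x (D k x)%:E <= (e k)%:E)%E.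
  rewrite -EFin_sqr_l2norm_class// lee_fin L2_classB// !L2_reprK.
  have /ltW h1 := hN k _ _ (leq_trans (MN k) (MM k)) (MN k).
  apply: (@le_trans _ _ (e k ^+ 2)); last by rewrite expr2 ler_piMl// ltW.
  by rewrite ler_pXn2r// nnegrE ?hnorm_ge0// ltW.
have mD k : measurable_fun setT (fun x => (D k x)%:E).
  by case: (shB k) => r i _; exact: measurable_modc2.
(* Where [C x] is finite, the increment of index [k] is at most [sqrt (C x) / 2^k], so the
   subsequence converges pointwise at a geometric rate. *)
pose C x := (\sum_(0 <= k <oo) ((4 ^+ k)%:E * (D k x)%:E))%E.
have D0 k x : (0 <= (4 ^+ k)%:E * (D k x)%:E)%E.
  by rewrite -EFinM lee_fin; apply: mulr_ge0; [exact: exprn_ge0|exact: sqr_ge0].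
have C0 x : (0 <= C x)%E by apply: nneseries_ge0 => k _ _; exact: D0.
have mC : measurable_fun setT C.
  apply: (@ge0_emeasurable_sum _ _ _ setT (fun k x => ((4 ^+ k)%:E * (D k x)%:E)%E) xpredT) => // k _.
  exact: measurable_funeM.
have IC : (\int[mu]_x C x < +oo)%E.
  rewrite /C integral_nneseries//; last by move=> k; exact: measurable_funeM.
  apply: (@le_lt_trans _ _ 1%E); last exact: ltry.
  apply: (le_trans _ (@epsilon_trick0 R 1 xpredT ler01)).
  apply: lee_nneseries => [k _ _|k _].
    by apply: integral_ge0.
  rewrite ge0_integralZl_EFin ?exprn_ge0//; last by move=> x _; rewrite lee_fin sqr_ge0.
  apply: (@le_trans _ _ ((4 ^+ k)%:E * (e k)%:E)%E).
    by apply: lee_wpmul2l; [rewrite lee_fin exprn_ge0|exact: ID].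
  rewrite -EFinM lee_fin /e invfM mulrA mulfV ?mul1r ?expf_neq0//.
  by rewrite ?mul1r natrX.
have iC : mu.-integrable setT C.
  by apply/integrableP; split => //; under eq_integral do rewrite gee0_abs//.
pose A := [set x | (C x < +oo)%E].
have mA : measurable A.
  by rewrite -[A]setTI; apply: emeasurable_fun_infty_o.
have aeA : \forall x \ae mu, A x.
  have := integrable_ae measurableT iC; apply: filterS => x /(_ I) /= fx.
  by rewrite /A/= ltey_eq fx.
(* Cutting by [A] makes the convergence hold everywhere, so that [g] is measurable as a pointwise
   limit. *)
pose h' k x := h k x * (\1_A x)%:C%C.
have h'B k x : modc (h' k.+1 x - h' k x) <= Num.sqrt (fine (C x)) * 2^-1 ^+ k.
  rewrite /h' indicE; have [xA|xA] := boolP (x \in A); last first.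
    by rewrite !mulr0 subrr modc0 mulr_ge0 ?sqrtr_ge0// exprn_ge0// invr_ge0.
  rewrite !mulr1 -(@ler_pXn2r _ 2)// ?nnegrE ?modc_ge0 ?mulr_ge0 ?sqrtr_ge0 ?exprn_ge0 ?invr_ge0//.
  rewrite exprMn sqr_sqrtr; last exact: fine_ge0.
  have -> : (2^-1 ^+ k) ^+ 2 = (4 ^+ k)^-1 :> R.
    by rewrite !exprVn -exprM mulnC exprM -natrX.
  rewrite ler_pdivlMr ?exprn_gt0// mulrC -lee_fin fineK; last first.
    by rewrite ge0_fin_numE//; exact: set_mem.
  rewrite EFinM; rewrite /C (@nneseriesD1 _ _ k)//.
  by rewrite leeDl//; apply: nneseries_ge0 => l _ _; exact: D0.
pose g x := Complex (limn (fun k => complex.Re (h' k x))) (limn (fun k => complex.Im (h' k x))).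
have gr x : cvgn (fun k => complex.Re (h' k x)) /\ forall k,
    `|complex.Re (g x) - complex.Re (h' k x)| <= 2 * Num.sqrt (fine (C x)) * 2^-1 ^+ k.
  apply: geometric_cvg => k; apply: le_trans (h'B k x).
  by rewrite -RecN -RecD; exact: modc_Re.
have gi x : cvgn (fun k => complex.Im (h' k x)) /\ forall k,
    `|complex.Im (g x) - complex.Im (h' k x)| <= 2 * Num.sqrt (fine (C x)) * 2^-1 ^+ k.
  apply: geometric_cvg => k; apply: le_trans (h'B k x).
  by rewrite -ImcN -ImcD; exact: modc_Im.
have mh' k : cmeasurable (h' k).
  apply: cmeasurableM; first exact: sq_integrable_measurable (sh k).
  exact: cmeasurable_indic.
have mg : cmeasurable g.
  split.
    apply: (@measurable_fun_cvg _ _ _ _ (fun k x => complex.Re (h' k x))) => [k|x _].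
      by case: (mh' k).
    by case: (gr x).
  apply: (@measurable_fun_cvg _ _ _ _ (fun k x => complex.Im (h' k x))) => [k|x _].
    by case: (mh' k).
  by case: (gi x).
(* The square of [2 sqrt (C x) / 2^k], counted once for each of the two parts. *)
have gh k x : modc (g x - h' k x) ^+ 2 <= 8 * (4^-1) ^+ k * fine (C x).
  rewrite modc2E RecD RecN ImcD ImcN.
  have [_ /(_ k) a1] := gr x; have [_ /(_ k) a2] := gi x.
  have sq (y b : R) : `|y| <= b -> y ^+ 2 <= b ^+ 2.
    move=> yb; rewrite -(real_normK (num_real y)) ler_pXn2r// nnegrE//.
    exact: le_trans yb.
  apply: (le_trans (lerD (sq _ _ a1) (sq _ _ a2))).
  have -> : (4^-1 : R) ^+ k = (2^-1 ^+ k) ^+ 2.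
    have -> : (4 : R) = 2 ^+ 2 by rewrite -natrX.
    by rewrite !exprVn -!exprM mulnC.
  rewrite !exprMn sqr_sqrtr; last exact: fine_ge0.
  by move: ((2^-1 ^+ _) ^+ 2) (fine _) => s t; lra.
have sh' k : sq_integrable mu (h' k).
  apply: (@sq_integrable_le _ _ _ _ _ (h k) 1) => // x.
  by rewrite /h' modcM modc_real mul1r ger0_norm// ler_piMr ?modc_ge0// indicE lern1 leq_b1.
have vh' k : L2_class mu (h' k) = v k.
  rewrite -[RHS]L2_reprK; apply: eq_L2_class; [exact: sh'|exact: sh|].
  by apply: filterS aeA => x Ax; rewrite /h' indicE mem_set// mulr1.
have Igh k : (\int[mu]_x (modc (g x - h' k x) ^+ 2)%:E <= (8 * (4^-1) ^+ k)%:E * \int[mu]_x C x)%E.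
  have mgh : measurable_fun setT (fun x => (modc (g x - h' k x) ^+ 2)%:E).
    by have [r i] := cmeasurableB mg (mh' k); exact: measurable_modc2.
  have c0 : 0 <= 8 * (4^-1) ^+ k :> R by rewrite mulr_ge0// exprn_ge0// invr_ge0.
  rewrite -ge0_integralZl_EFin//.
  apply: ge0_le_integral => //; first by move=> x _; rewrite lee_fin sqr_ge0.
    exact: measurable_funeM.
  move=> x _; have [Cx|Cx] := boolP (C x \is a fin_num).
    by rewrite -(fineK Cx) -EFinM lee_fin.
  rewrite (_ : C x = +oo%E); last by apply/eqP; move: Cx; rewrite ge0_fin_numE// ltey negbK.
  rewrite gt0_muley ?leey// lte_fin mulr_gt0// exprn_gt0//.
have fC : (\int[mu]_x C x)%E \is a fin_num by rewrite ge0_fin_numE// integral_ge0.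
have sgh k : sq_integrable mu (fun x => g x - h' k x).
  have [r i] := cmeasurableB mg (mh' k); split => //.
  by apply: le_lt_trans (Igh k) _; rewrite -(fineK fC) -EFinM ltry.
have sg : sq_integrable mu g.
  have -> : g = fun x => 1 * (g x - h' 0%N x) + h' 0%N x.
    by apply/funext => x; rewrite mul1r subrK.
  exact: sq_integrableZD.
exists (L2_class mu g) => eps eps0.
have eps2 : 0 < eps / 2 by rewrite divr_gt0.
set I := fine (\int[mu]_x C x)%E.
have I0 : 0 <= I by apply/fine_ge0/integral_ge0.
have [k [hk1 hk2]] : exists k, (4^-1) ^+ k < eps / 2 /\ 8 * (4^-1) ^+ k * I < (eps / 2) ^+ 2.
  have I1 : 0 < 8 * I + 1 by rewrite ltr_wpDl// mulr_ge0.
  have m0 : 0 < Num.min (eps / 2) ((eps / 2) ^+ 2 / (8 * I + 1)).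
    by rewrite lt_min eps2 divr_gt0// exprn_gt0.
  have t0 : (4^-1 : R) ^+ k @[k --> \oo] --> 0.
    by apply: cvg_expr; rewrite ger0_norm// ?invr_ge0// invf_lt1// ltr1n.
  have /cvgrPdist_lt/(_ _ m0)[k _ /(_ k (leqnn k))] := t0.
  rewrite /= sub0r normrN ger0_norm ?exprn_ge0 ?invr_ge0// lt_min => /andP[h1 h2].
  exists k; split => //; move: h2; rewrite ltr_pdivlMr// => h2.
  have : 0 <= (4^-1 : R) ^+ k by rewrite exprn_ge0// invr_ge0.
  move: h2; move: (4^-1 ^+ k) ((eps / 2) ^+ 2) => p q; nra.
exists (N k) => n nN.
rewrite (le_lt_trans (ler_hdistD ipL2 (v k) _ _))//.
rewrite [ltRHS]splitr ltrD//.
  apply: lt_le_trans (hN k _ _ nN (MN k)) _; rewrite (le_trans _ (ltW hk1))//.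
  by rewrite /e exprVn lef_pV2 ?posrE ?mulr_gt0 ?exprn_gt0// ler_peMr ?exprn_ge0// exprn_ege1// ler1n.
rewrite -(@ltr_pXn2r _ 2)// ?nnegrE ?hnorm_ge0 ?ltW//.
apply: le_lt_trans hk2; rewrite (hdistC ipL2) -vh' -L2_classB//.
rewrite -lee_fin EFin_sqr_l2norm_class//.
by apply: le_trans (Igh k) _; rewrite (EFinM _ I) /I fineK.
Qed.

End Completeness.

(** * Left translations on [G] and on [L2 mu] *)

Section Translation.
Context (R : realType) (G : topologicalGroupType).

Lemma open_measurable_borel (U : set G) : open U -> measurable (U : set (borel G)).
Proof. by move=> oU; exact: sub_sigma_algebra. Qed.

Lemma continuous_measurable_borel (f : G -> R) : continuous f ->
  measurable_fun [set: borel G] (f : borel G -> R).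
Proof.
move=> cf; apply: (measurability _ (RGenOpens.measurableE R)).
move=> _ [_ [a [b ->] <-]]; rewrite setTI; apply: open_measurable_borel.
by apply: open_comp; [move=> x _; exact: cf|exact: interval_open].
Qed.

(** Composition with this map is the left regular representation, and preimages under it are the
    left translates of sets, the form in which [haar] gives invariance. *)
Definition ltranslate (x : G) (y : borel G) : borel G := (x^-1 * y)%g.

Lemma continuous_mulgl (x : G) : continuous (fun y : G => (x * y)%g).
Proof.
move=> y; apply: (@continuous_comp _ _ _ (fun y : G => (x, y)) (fun p => (p.1 * p.2)%g)).
  by apply: cvg_pair => /=; [exact: cvg_cst|exact: cvg_id].
exact: mulg_continuous.
Qed.

Lemma measurable_ltranslate (x : G) : measurable_fun [set: borel G] (ltranslate x).
Proof.
apply: (@measurability _ _ (borel G) (borel G) _ _ (@open G)) => //.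
move=> _ [U oU <-]; rewrite setTI; apply: open_measurable_borel.
by apply: open_comp => // y _; exact: continuous_mulgl.
Qed.

Variable mu : {measure set (borel G) -> \bar R}.
Hypothesis haar : left_haar_measure mu.

Lemma preimage_ltranslate (x : G) (A : set G) :
  ltranslate x @^-1` A = [set (x * y)%g | y in A].
Proof.
rewrite eqEsubset; split => [y /= Ay|_ [y Ay <-]].
  by exists (x^-1 * y)%g => //; rewrite mulVKg.
by rewrite /= /ltranslate mulKg.
Qed.

Lemma measure_ltranslate (x : G) (A : set (borel G)) : measurable A ->
  mu (ltranslate x @^-1` A) = mu A.
Proof. by case: haar => _ h _ _ _ mA; rewrite preimage_ltranslate h. Qed.

Lemma ae_ltranslate (x : G) (P : G -> Prop) :
  (\forall y \ae mu, P y) -> \forall y \ae mu, P (ltranslate x y).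
Proof.
case=> N [mN N0 PN]; exists (ltranslate x @^-1` N); split.
- by rewrite -[_ @^-1` _]setTI; exact: measurable_ltranslate.
- by rewrite measure_ltranslate.
- by move=> y /= Py; apply: PN.
Qed.

Lemma ge0_integral_ltranslate (x : G) (f : borel G -> \bar R) :
  measurable_fun [set: borel G] f -> (forall y, 0 <= f y)%E ->
  (\int[mu]_y f (ltranslate x y) = \int[mu]_y f y)%E.
Proof.
move=> mf f0; have mt := measurable_ltranslate x.
rewrite -[LHS](@ge0_integral_pushforward _ _ _ _ _ (ltranslate x) mt mu setT f)//.
by apply: eq_measure_integral => A mA _; exact: measure_ltranslate.
Qed.

Lemma integral_ltranslate (x : G) (f : borel G -> \bar R) :
  measurable_fun [set: borel G] f ->
  (\int[mu]_y f (ltranslate x y) = \int[mu]_y f y)%E.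
Proof.
move=> mf; rewrite [LHS]integralE [RHS]integralE.
have p := ge0_integral_ltranslate x (measurable_funepos mf) (funepos_ge0 f).
have n := ge0_integral_ltranslate x (measurable_funeneg mf) (funeneg_ge0 f).
rewrite -[in RHS]p -[in RHS]n; congr (_ - _)%E; apply: eq_integral => y _.
  by rewrite !funeposE.
by rewrite !funenegE.
Qed.

Lemma cint_ltranslate (x : G) (h : borel G -> R[i]) : cmeasurable h ->
  cint mu (fun y => h (ltranslate x y)) = cint mu h.
Proof.
move=> [hr hi]; apply: complexP => /=; congr fine.
  apply: (integral_ltranslate x (f := fun y => (complex.Re (h y))%:E)).
  exact/measurable_EFinP.
apply: (integral_ltranslate x (f := fun y => (complex.Im (h y))%:E)).
exact/measurable_EFinP.
Qed.

Lemma cmeasurable_ltranslate (x : G) (h : borel G -> R[i]) : cmeasurable h ->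
  cmeasurable (fun y => h (ltranslate x y)).
Proof.
move=> [hr hi]; have mt := measurable_ltranslate x.
by split; [exact: (measurableT_comp hr)|exact: (measurableT_comp hi)].
Qed.

Lemma sq_integrable_ltranslate (x : G) (h : borel G -> R[i]) : sq_integrable mu h ->
  sq_integrable mu (fun y => h (ltranslate x y)).
Proof.
move=> [hr hi hoo]; have [r i] := cmeasurable_ltranslate x (conj hr hi); split => //.
rewrite (ge0_integral_ltranslate x (f := fun y => (modc (h y) ^+ 2)%:E))//.
- exact: measurable_modc2.
- by move=> y; rewrite lee_fin sqr_ge0.
Qed.

Local Notation lam := (@left_regular R G mu).

Lemma left_regularE (x : G) (f : L2 mu) :
  lam x f = L2_class mu (fun y => L2_repr f (ltranslate x y)).
Proof. by []. Qed.

Lemma left_regular_class (x : G) (h : borel G -> R[i]) : sq_integrable mu h ->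
  lam x (L2_class mu h) = L2_class mu (fun y => h (ltranslate x y)).
Proof.
move=> sh; rewrite left_regularE; apply: eq_L2_class.
- by apply: sq_integrable_ltranslate; exact: L2_reprP.
- exact: sq_integrable_ltranslate.
- by have := ae_ltranslate x (L2_classK sh).
Qed.

Lemma left_regular_linear (x : G) : hlinear (lam x).
Proof.
move=> a f g.
have sf := L2_reprP f; have sg := L2_reprP g.
rewrite -{1}(L2_reprK f) -{1}(L2_reprK g) -L2_classZD// left_regular_class//.
  by rewrite !left_regularE -L2_classZD//; exact: sq_integrable_ltranslate.
exact: sq_integrableZD.
Qed.

Lemma left_regular1 (f : L2 mu) : lam 1%g f = f.
Proof.
rewrite -[RHS]L2_reprK left_regularE; congr L2_class; apply/funext => y.
by rewrite /ltranslate invg1 mul1g.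
Qed.

Lemma left_regularM (x y : G) (f : L2 mu) : lam (x * y)%g f = lam x (lam y f).
Proof.
rewrite [lam y f]left_regularE left_regular_class.
  by rewrite left_regularE; congr L2_class; apply/funext => z; rewrite /ltranslate invgM mulgA.
by apply: sq_integrable_ltranslate; exact: L2_reprP.
Qed.

Lemma left_regularKV (x : G) (f : L2 mu) : lam x (lam x^-1%g f) = f.
Proof. by rewrite -left_regularM mulgV left_regular1. Qed.

Lemma left_regularVK (x : G) (f : L2 mu) : lam x^-1%g (lam x f) = f.
Proof. by rewrite -left_regularM mulVg left_regular1. Qed.

Lemma left_regular_inner (x : G) (f g : L2 mu) : inner (lam x f) (lam x g) = inner f g.
Proof.
have sf := L2_reprP f; have sg := L2_reprP g.
rewrite !left_regularE inner_class; [|exact: sq_integrable_ltranslate..].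
rewrite innerE; apply: (cint_ltranslate x (h := fun y => L2_repr f y * (L2_repr g y)^*%C)).
apply: cmeasurableM; first exact: sq_integrable_measurable sf.
by apply: cmeasurableJ; exact: sq_integrable_measurable sg.
Qed.

Lemma left_regular_adjoint (x : G) (f g : L2 mu) :
  inner (lam x f) g = inner f (lam x^-1%g g).
Proof. by rewrite -{1}(left_regularKV x g) left_regular_inner. Qed.

Lemma left_regular_norm (x : G) (f : L2 mu) : l2norm (lam x f) = l2norm f.
Proof. by rewrite /l2norm left_regular_inner. Qed.

Lemma left_regular_bounded (x : G) : bounded_operator (lam x).
Proof.
split; first exact: left_regular_linear.
by exists 1 => f; rewrite left_regular_norm mul1r.
Qed.

End Translation.

(** * Density of indicator functions *)

Section Density.
Context d (T : measurableType d) (R : realType) (mu : {measure set T -> \bar R}).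
Let ipL2 := inner_product_L2 mu.

Definition indic_fun (A : set T) (x : T) : R[i] := (\1_A x)%:C%C.

Lemma modc_indic (A : set T) x : modc (indic_fun A x) = \1_A x.
Proof. by rewrite /indic_fun modc_real ger0_norm. Qed.

Lemma sq_integrable_indic (A : set T) : measurable A -> (mu A < +oo)%E ->
  sq_integrable mu (indic_fun A).
Proof.
move=> mA Aoo; have [r i] := @cmeasurable_indic _ T R A mA; split => //.
rewrite (eq_integral (fun x => (\1_A x)%:E)); first by rewrite integral_indic// setIT.
move=> x _; rewrite modc_indic indicE.
by case: (x \in A); rewrite ?expr1n ?expr0n.
Qed.

Definition indic2 (A : set T) : L2 mu := L2_class mu (indic_fun A).

Lemma sqr_l2norm_indic (A : set T) : measurable A -> (mu A < +oo)%E ->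
  (l2norm (indic2 A) ^+ 2)%:E = mu A.
Proof.
move=> mA Aoo; rewrite EFin_sqr_l2norm_class; last exact: sq_integrable_indic.
rewrite (eq_integral (fun x => (\1_A x)%:E)); first by rewrite integral_indic// setIT.
move=> x _; rewrite modc_indic indicE.
by case: (x \in A); rewrite ?expr1n ?expr0n.
Qed.

Lemma sqr_l2norm_indicB (A B : set T) : measurable A -> measurable B -> A `<=` B ->
  (mu B < +oo)%E -> (l2norm (indic2 B - indic2 A) ^+ 2)%:E = (mu B - mu A)%E.
Proof.
move=> mA mB AB Boo.
have Aoo : (mu A < +oo)%E by rewrite (le_lt_trans _ Boo)// le_measure ?inE.
have mBA : measurable (B `\` A) by exact: measurableD.
have BAoo : (mu (B `\` A) < +oo)%E.
  by rewrite (le_lt_trans _ Boo)// le_measure ?inE//; exact: subDsetl.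
have -> : indic2 B - indic2 A = indic2 (B `\` A).
  rewrite /indic2 -L2_classB; [|exact: sq_integrable_indic..].
  congr L2_class; apply/funext => x; rewrite /indic_fun !indicE -rmorphB /= in_setD.
  have [xA|xA] := boolP (x \in A); last by rewrite subr0 andbT.
  by rewrite (mem_set (AB _ (set_mem xA))) subrr andbF.
rewrite sqr_l2norm_indic// measureD//; congr (_ - mu _)%E.
by rewrite setIidr.
Qed.

(** The set where the real part is at least [1/(n+1)] has finite measure by Chebyshev, whether or
    not [mu] is sigma-finite, so its indicator may be tested against [h]. *)
Let pos_part_null (h : L2 mu) :
  (forall A, measurable A -> (mu A < +oo)%E -> inner h (indic2 A) = 0) ->
  \forall x \ae mu, complex.Re (L2_repr h x) <= 0.
Proof.
move=> hA; have sh := L2_reprP h; have [hr hi hoo] := sh.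
pose P n := [set x | n.+1%:R^-1 <= complex.Re (L2_repr h x)].
have mP n : measurable (P n).
  by rewrite -[P n]setTI; apply: measurable_fun_le => //; exact: measurable_cst.
have Poo n : (mu (P n) < +oo)%E.
  have c0 : 0 < n.+1%:R^-1 ^+ 2 :> R by rewrite exprn_gt0// invr_gt0.
  have : ((n.+1%:R^-1 ^+ 2)%:E * mu (P n) < +oo)%E.
    apply: (le_lt_trans _ hoo).
    have mI : measurable_fun [set: T] (fun x => (\1_(P n) x : R)%:E).
      by apply/measurable_EFinP; exact: measurable_indic.
    have -> : ((n.+1%:R^-1 ^+ 2)%:E * mu (P n) =
        \int[mu]_x ((n.+1%:R^-1 ^+ 2)%:E * (\1_(P n) x)%:E))%E.
      by rewrite ge0_integralZl_EFin ?ltW// integral_indic// setIT.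
    apply: ge0_le_integral => //.
    - exact: measurable_funeM.
    - exact: measurable_modc2.
    move=> x _; rewrite -EFinM lee_fin indicE.
    have [xP|xP] := boolP (x \in P n); last by rewrite mulr0 sqr_ge0.
    have Px : n.+1%:R^-1 <= complex.Re (L2_repr h x) by exact: set_mem xP.
    rewrite mulr1 ler_pXn2r// ?nnegrE ?modc_ge0 ?invr_ge0//.
    by rewrite (le_trans Px)// (le_trans (ler_norm _))// modc_Re.
  by move=> H; rewrite ltey; apply/negP => /eqP E; move: H; rewrite E gt0_muley.
have P0 n : mu (P n) = 0%E.
  have := hA _ (mP n) (Poo n).
  rewrite -{1}(L2_reprK h) inner_class//; last exact: sq_integrable_indic.
  move=> /(congr1 (@complex.Re R)) /= I0.
  have sP := sq_integrable_indic (mP n) (Poo n).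
  have [ir _] := sq_integrable_pair sh sP.
  have iP : mu.-integrable [set: T] (fun x => (n.+1%:R^-1 * \1_(P n) x)%:E).
    by under eq_fun do rewrite EFinM; apply: integrableZl => //; exact: integrable_indic_lty.
  have : \int[mu]_x (n.+1%:R^-1 * \1_(P n) x) <= 0.
    rewrite -I0; apply: le_Rintegral => // x _.
    rewrite RecM /indic_fun /= oppr0 mulr0 subr0 indicE.
    have [xP|xP] := boolP (x \in P n); last by rewrite !mulr0.
    by rewrite !mulr1; exact: set_mem xP.
  rewrite RintegralZl//; last exact: integrable_indic_lty.
  rewrite pmulr_rle0 ?invr_gt0// /Rintegral integral_indic// setIT => f0.
  have fP : mu (P n) \is a fin_num by rewrite ge0_fin_numE.
  apply/eqP; rewrite eq_le measure_ge0 andbT -(fineK fP) lee_fin//.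
exists (\bigcup_n P n); split.
- exact: bigcup_measurable.
- apply/eqP; rewrite eq_le measure_ge0 andbT.
  apply: (le_trans (measure_sigma_subadditive mu _ _ (@subset_refl _ _))) => //.
    exact: bigcup_measurable.
  by rewrite eseries0.
- move=> x /= /negP; rewrite -ltNge => hx.
  have [N /(_ N (leqnn _)) hN] := harmonic_lt hx.
  by exists N => //; exact: ltW.
Qed.

(** Multiplying [h] by 1, -1, i and -i bounds both parts from both sides. *)
Lemma orthogonal_indic_eq0 (h : L2 mu) :
  (forall A, measurable A -> (mu A < +oo)%E -> inner h (indic2 A) = 0) -> h = 0.
Proof.
move=> hA.
have Z a : \forall x \ae mu, complex.Re (a * L2_repr h x) <= 0.
  have := @pos_part_null (a *: h); have := L2_reprZD a h 0; have := @L2_repr0 _ T R mu.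
  move=> h0 hz /(_ _) H; have {}H : \forall x \ae mu, complex.Re (L2_repr (a *: h) x) <= 0.
    by apply: H => A mA Aoo; rewrite (ipZl ipL2) hA// mulr0.
  move: hz; rewrite addr0 => hz; apply: filterS3 h0 hz H => x -> ->.
  by rewrite addr0.
apply: L2_ext.
apply: filterS3 (filterI (Z 1) (Z (-1))) (filterI (Z (Complex 0 1)) (Z (Complex 0 (-1)))) (@L2_repr0 _ T R mu).
move=> x [a1 a2] [b1 b2] ->.
move: a1 a2 b1 b2; case: (L2_repr h x) => a b /=.
rewrite mul0r mulN1r mul1r oppr0 !mul0r !sub0r mulN1r mul1r subr0 addr0 opprK => a1 a2 b1 b2.
by apply: complexP => /=; lra.
Qed.

(** Serves as an induction principle: a property stable under linear combinations and limits need
    only be checked on indicators. *)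
Lemma L2_indic_dense (K : set (L2 mu)) : closed_subspace (@inner _ T R mu) K ->
  (forall A, measurable A -> (mu A < +oo)%E -> K (indic2 A)) -> forall f, K f.
Proof.
move=> cK KA f; have Vc := @L2_complete _ T R mu.
suff <- : hproj (@inner _ T R mu) K f = f by exact: (hproj_in ipL2).
apply/eqP; rewrite eq_sym -subr_eq0; apply/eqP/orthogonal_indic_eq0 => A mA Aoo.
by rewrite (hproj_orth ipL2 cK Vc)//; exact: KA.
Qed.

End Density.

(** * Multiplication by bounded functions *)

Section Multiplication.
Context d (T : measurableType d) (R : realType) (mu : {measure set T -> \bar R}).
Let ipL2 := inner_product_L2 mu.

Lemma ler_l2norm_ae (f g : L2 mu) :
  (\forall x \ae mu, modc (L2_repr f x) <= modc (L2_repr g x)) -> l2norm f <= l2norm g.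
Proof.
move=> fg; rewrite -(@ler_pXn2r _ 2)// ?nnegrE ?l2norm_ge0//.
have sf := L2_reprP f; have sg := L2_reprP g.
rewrite -lee_fin (EFin_sqr_l2norm f) (EFin_sqr_l2norm g).
apply: ae_ge0_le_integral => //.
- by move=> x _; rewrite lee_fin sqr_ge0.
- by case: sf => r i _; exact: measurable_modc2.
- by move=> x _; rewrite lee_fin sqr_ge0.
- by case: sg => r i _; exact: measurable_modc2.
- by apply: filterS fg => x h _; rewrite lee_fin ler_pXn2r// nnegrE modc_ge0.
Qed.

Lemma sq_integrableB (f g : T -> R[i]) : sq_integrable mu f -> sq_integrable mu g ->
  sq_integrable mu (fun x => f x - g x).
Proof.
move=> sf sg; have -> : (fun x => f x - g x) = fun x => -1 * g x + f x.
  by apply/funext => x; rewrite mulN1r addrC.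
exact: sq_integrableZD.
Qed.

Definition cbounded (c : T -> R[i]) : Prop :=
  cmeasurable c /\ exists M : R, forall x, modc (c x) <= M.

Definition cmul (c : T -> R[i]) (f : L2 mu) : L2 mu :=
  L2_class mu (fun x => c x * L2_repr f x).

Lemma cbounded_indic (A : set T) : measurable A -> cbounded (@indic_fun _ T R A).
Proof.
move=> mA; split; first exact: cmeasurable_indic.
by exists 1 => x; rewrite modc_indic indicE lern1 leq_b1.
Qed.

Lemma cboundedB c c' : cbounded c -> cbounded c' -> cbounded (fun x => c x - c' x).
Proof.
move=> [mc [M hM]] [mc' [M' hM']]; split; first exact: cmeasurableB.
by exists (M + M') => x; rewrite (le_trans (ler_modcD _ _))// modcN lerD.
Qed.

Lemma cbounded_cst z : cbounded (fun=> z).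
Proof. by split; [exact: cmeasurable_cst|exists (modc z)]. Qed.

Lemma sq_integrable_cmul c (f : T -> R[i]) : cbounded c -> sq_integrable mu f ->
  sq_integrable mu (fun x => c x * f x).
Proof.
move=> [mc [M hM]] sf; apply: (sq_integrable_le (k := M) _ sf).
  apply: cmeasurableM => //; exact: sq_integrable_measurable sf.
by move=> x; rewrite modcM ler_wpM2r// modc_ge0.
Qed.

Lemma cmulK c f : cbounded c ->
  \forall x \ae mu, L2_repr (cmul c f) x = c x * L2_repr f x.
Proof. by move=> bc; apply: L2_classK; apply: sq_integrable_cmul => //; exact: L2_reprP. Qed.

Lemma cmul_class c h : cbounded c -> sq_integrable mu h ->
  cmul c (L2_class mu h) = L2_class mu (fun x => c x * h x).
Proof.
move=> bc sh; apply: eq_L2_class.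
- by apply: sq_integrable_cmul => //; exact: L2_reprP.
- exact: sq_integrable_cmul.
- by apply: filterS (L2_classK sh) => x ->.
Qed.

Lemma cmul_linear c : cbounded c -> hlinear (cmul c).
Proof.
move=> bc a f g; have sf := L2_reprP f; have sg := L2_reprP g.
rewrite -L2_classZD; [|exact: sq_integrable_cmul..].
rewrite -{1}(L2_reprK f) -{1}(L2_reprK g) -L2_classZD// cmul_class//; last exact: sq_integrableZD.
by congr L2_class; apply/funext => x; rewrite mulrDr mulrCA.
Qed.


Lemma cmulM c c' f : cbounded c -> cbounded c' ->
  cmul c (cmul c' f) = cmul (fun x => c x * c' x) f.
Proof.
move=> bc bc'; rewrite [cmul c' f]/cmul cmul_class//.
  by congr L2_class; apply/funext => x; rewrite mulrA.
by apply: sq_integrable_cmul => //; exact: L2_reprP.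
Qed.

Lemma cmulB c c' f : cbounded c -> cbounded c' ->
  cmul c f - cmul c' f = cmul (fun x => c x - c' x) f.
Proof.
move=> bc bc'; have sf := L2_reprP f; rewrite -L2_classB; [|exact: sq_integrable_cmul..].
by congr L2_class; apply/funext => x; rewrite mulrBl.
Qed.

Lemma cmul_cst z f : cmul (fun=> z) f = z *: f.
Proof.
apply: L2_ext; have := L2_reprZD z f 0; rewrite addr0 => h.
apply: filterS3 (cmulK f (cbounded_cst z)) h (@L2_repr0 _ T R mu) => x -> -> ->.
by rewrite addr0.
Qed.

Lemma l2norm_cmul_le c (M : R) f : cmeasurable c -> 0 <= M -> (forall x, modc (c x) <= M) ->
  l2norm (cmul c f) <= M * l2norm f.
Proof.
move=> mc M0 hM; have bc : cbounded c by split => //; exists M.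
have -> : M * l2norm f = l2norm (cmul (fun=> M%:C%C) f).
  by rewrite cmul_cst l2normZ modc_real ger0_norm.
apply: ler_l2norm_ae.
apply: filterS2 (cmulK f bc) (cmulK f (cbounded_cst M%:C%C)) => x -> ->.
by rewrite !modcM modc_real ger0_norm// ler_wpM2r// modc_ge0.
Qed.

Lemma cmul_bounded c : cbounded c -> hbounded (@inner _ T R mu) (cmul c).
Proof.
move=> bc; split; first exact: cmul_linear.
case: bc => mc [M hM]; exists `|M| => f; apply: l2norm_cmul_le => // x.
by rewrite (le_trans (hM x))// ler_norm.
Qed.

End Multiplication.

(** * Strong continuity of the left regular representation *)

Section Continuity.
Context (R : realType) (G : topologicalGroupType).
Variable mu : {measure set (borel G) -> \bar R}.
Hypotheses (G_hausdorff : hausdorff_space G) (haar : left_haar_measure mu).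
Let ipL2 := inner_product_L2 mu.
Local Notation lam := (@left_regular R G mu).

Lemma compact_measurable (K : set G) : compact K -> measurable (K : set (borel G)).
Proof.
move=> /(compact_closed G_hausdorff) cK.
rewrite -[K]setCK; apply: measurableC; apply: open_measurable_borel.
by rewrite openC.
Qed.

Lemma regular_approx (A : set (borel G)) (e : R) : measurable A -> (mu A < +oo)%E -> 0 < e ->
  exists (U K : set G), [/\ open U /\ compact K, A `<=` U /\ K `<=` U, (mu U < +oo)%E,
    l2norm (indic2 mu U - indic2 mu A) < e & l2norm (indic2 mu U - indic2 mu K) < e].
Proof.
case: (haar) => _ _ _ ho hi mA Aoo e0.
have e2 : 0 < e ^+ 2 by rewrite exprn_gt0.
have fA : mu A \is a fin_num by rewrite ge0_fin_numE.
have [_ [U [oU AU] <-] UA] : exists2 x : \bar R,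
    [set mu U | U in [set U : set G | open U /\ A `<=` U]] x & (x < mu A + (e ^+ 2)%:E)%E.
  by rewrite (ho A mA); apply: lb_ereal_inf_adherent => //; rewrite -ho.
have Uoo : (mu U < +oo)%E by rewrite (lt_le_trans UA)// leey.
have mU := open_measurable_borel oU.
have fU : mu U \is a fin_num by rewrite ge0_fin_numE.
have [_ [K [cK KU] <-] UK] : exists2 x : \bar R,
    [set mu K | K in [set K : set G | compact K /\ K `<=` U]] x & (mu U - (e ^+ 2)%:E < x)%E.
  by rewrite (hi U oU); apply: ub_ereal_sup_adherent => //; rewrite -hi.
have mK := compact_measurable cK.
have lt_norm (f : L2 mu) : ((l2norm f ^+ 2)%:E < (e ^+ 2)%:E)%E -> l2norm f < e.
  by rewrite lte_fin ltr_pXn2r// nnegrE ?l2norm_ge0// ltW.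
exists U, K; split => //; apply: lt_norm; rewrite sqr_l2norm_indicB//.
  by rewrite lteBlDl.
have fK : mu K \is a fin_num.
  by rewrite ge0_fin_numE// (le_lt_trans _ Uoo)// le_measure ?inE.
by rewrite lteBlDl// -lteBlDr.
Qed.

Lemma left_regular_indic (x : G) (A : set (borel G)) : measurable A -> (mu A < +oo)%E ->
  lam x (indic2 mu A) = indic2 mu (ltranslate x @^-1` A).
Proof.
by move=> mA Aoo; rewrite left_regular_class//; exact: sq_integrable_indic.
Qed.

Let lt_dist (w u v : L2 mu) (a b : R) : l2norm (w - u) < a -> l2norm (w - v) < b ->
  l2norm (u - v) < a + b.
Proof.
move=> h1 h2; apply: le_lt_trans (ler_l2distD w u v) _.
by rewrite l2distC ltrD.
Qed.

(** To be read with [u], [a], [c] and [cx] the indicators of [U], [A], a compact set [C] and its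
    translate by [x]. *)
Let left_regular_dist_lt (x : G) (a c cx u : L2 mu) (e : R) : lam x c = cx ->
  l2norm (u - a) < e / 6 -> l2norm (u - c) < e / 6 -> l2norm (u - cx) < e / 6 ->
  l2norm (lam x a - a) < e.
Proof.
have sixth : 0 < e / 6 -> e / 6 + e / 6 + (e / 6 + e / 6) <= e by lra.
move=> <- ua uc ucx.
have h1 : l2norm (lam x c - lam x a) < e / 6 + e / 6.
  rewrite -(hlinearB _ _ (left_regular_linear haar x)) (left_regular_norm haar).
  exact: lt_dist uc ua.
have h2 := lt_dist h1 (lt_dist ucx ua); apply: lt_le_trans h2 (sixth _).
exact: le_lt_trans (l2norm_ge0 _) ua.
Qed.

(** By density it is enough to treat an indicator. For [x] near the identity the translate of the
    compact set [C] stays inside [U]; having the measure of [C], it is as close to [U] as [C] is. *)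
Lemma left_regular_cvg1 (f : L2 mu) (e : R) : 0 < e ->
  \forall x \near (1%g : G), l2norm (lam x f - f) < e.
Proof.
pose K : set (L2 mu) := [set f | forall e : R, 0 < e ->
  \forall x \near (1%g : G), l2norm (lam x f - f) < e].
suff h : forall f, K f by exact: (h f).
have lamL x := left_regular_linear haar x.
move=> {f e}; apply: L2_indic_dense.
  split.
  - move=> e e0; near=> x; rewrite (hlinear0 (lamL x)) subrr.
    by rewrite l2norm0.
  - move=> a f g Kf Kg e e0.
    have a0 : 0 < modc a + 1 by rewrite ltr_wpDl// modc_ge0.
    have e2 : 0 < e / 2 by rewrite divr_gt0.
    have := Kf _ (divr_gt0 e2 a0); have := Kg _ e2; apply: filterS2 => x hg hf.
    rewrite lamL opprD addrACA -scalerBr (le_lt_trans (ler_l2normD _ _))//.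
    rewrite l2normZ [ltRHS]splitr ler_ltD//.
    have := l2norm_ge0 (lam x f - f); move: hf; rewrite ltr_pdivlMr//.
    move=> h1 h2; have := modc_ge0 a; nra.
  - move=> u f Ku uf e e0.
    have e3 : 0 < e / 3 by rewrite divr_gt0.
    have [N /(_ N (leqnn _)) hN'] := uf _ e3.
    have hN : l2norm (u N - f) < e / 3 by [].
    have := Ku N _ e3; apply: filterS => x hx.
    rewrite (le_lt_trans (ler_l2distD (lam x (u N)) _ _))//.
    rewrite -(hlinearB _ _ (lamL x)) (left_regular_norm haar).
    have := ler_l2distD (u N) (lam x (u N)) f.
    have : l2norm (f - u N) < e / 3 by rewrite l2distC.
    move: hx hN; lra.
move=> A mA Aoo e e0.
have e6 : 0 < e / 6 by rewrite divr_gt0.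
have [U [C [[oU cC] [AU CU] Uoo UA UC]]] := regular_approx mA Aoo e6.
have mC := compact_measurable cC; have mU := open_measurable_borel oU.
have Coo : (mu C < +oo)%E by rewrite (le_lt_trans _ Uoo)// le_measure ?inE.
have : \forall x \near (1%g : G), forall y, C y -> U (x * y)%g.
  apply: ((compact_near_coveringP C).1 cC G (nbhs (1%g : G)) (fun x y => U (x * y)%g)).
  move=> y Cy.
  have Uy : nbhs (1%g * y)%g U by rewrite mul1g; apply: open_nbhs_nbhs; split => //; exact: CU.
  have [[A1 B1] /= [A1n B1n] AB] := @mulg_continuous G (1%g, y) U Uy.
  by exists (B1, A1) => // -[y' x] [/= By' Ax]; exact: (AB (x, y')).
apply: filterS => x xCU.
have CxU : ltranslate x @^-1` C `<=` U.
  by move=> y /= Cy; have := xCU _ Cy; rewrite mulVKg.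
have mCx : measurable (ltranslate x @^-1` (C : set (borel G))).
  by rewrite -[_ @^-1` _]setTI; exact: measurable_ltranslate.
have UCx : l2norm (indic2 mu U - indic2 mu (ltranslate x @^-1` C)) < e / 6.
  have ltE (f : L2 mu) :
      (l2norm f < e / 6) = ((l2norm f ^+ 2)%:E < ((e / 6) ^+ 2)%:E)%E.
    by rewrite lte_fin ltr_pXn2r// nnegrE ?l2norm_ge0// ltW.
  rewrite ltE (sqr_l2norm_indicB mCx mU CxU Uoo) (measure_ltranslate haar x mC).
  by rewrite -(sqr_l2norm_indicB mC mU CU Uoo) -ltE.
exact: (left_regular_dist_lt (left_regular_indic x mC Coo) UA UC UCx).
Unshelve. all: by end_near.
Qed.

Lemma nbhs_mulVg (x0 : G) (P : set G) : nbhs (1%g : G) P ->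
  nbhs x0 (fun x => P (x0^-1 * x)%g).
Proof.
move=> P1; have P1' : nbhs (x0^-1 * x0)%g P by rewrite (mulVg x0).
exact: (@continuous_mulgl G x0^-1%g x0 P P1').
Qed.

Let left_regular_distM (x0 x : G) (f : L2 mu) :
  l2norm (lam x f - lam x0 f) = l2norm (lam (x0^-1 * x)%g f - f).
Proof.
rewrite -(left_regular_norm haar x0^-1%g (lam x f - lam x0 f)).
rewrite (hlinearB _ _ (left_regular_linear haar x0^-1%g)).
by rewrite (left_regularVK haar x0 f) -(left_regularM haar x0^-1%g x f).
Qed.

Lemma left_regular_cvg (x0 : G) (f : L2 mu) (e : R) : 0 < e ->
  \forall x \near x0, l2norm (lam x f - lam x0 f) < e.
Proof.
move=> e0; have := nbhs_mulVg x0 (left_regular_cvg1 f e0).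
apply: filterS => x.
by rewrite left_regular_distM.
Qed.

End Continuity.

(** * Sigma-compact carriers *)

Section SigmaCompact.
Context (R : realType) (G : topologicalGroupType).
Variable mu : {measure set (borel G) -> \bar R}.
Hypotheses (G_hausdorff : hausdorff_space G) (haar : left_haar_measure mu).
Let ipL2 := inner_product_L2 mu.

Definition sigma_compact (C : set G) :=
  exists2 K : nat -> set G, forall n, compact (K n) & C = \bigcup_n K n.

Lemma sigma_compact_bigcup (C : nat -> set G) : (forall n, sigma_compact (C n)) ->
  sigma_compact (\bigcup_n C n).
Proof.
move=> sC; have /choice[K hK] n : exists K : nat -> set G,
    (forall m, compact (K m)) /\ C n = \bigcup_m K m.
  by have [K cK CK] := sC n; exists K.
exists (fun k => if unpickle k is Some p then K p.1 p.2 else set0).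
  move=> k; case: unpickle => [[n m]|]; last exact: compact0.
  by have [cK _] := hK n; exact: cK.
rewrite eqEsubset; split => [x [n _]|x [k _]].
  have [_ ->] := hK n; move=> [m _ Kx]; exists (pickle (n, m)) => //.
  by rewrite pickleK.
case: unpickle => [[n m] Kx|//]; exists n => //; have [_ ->] := hK n.
by exists m.
Qed.

Lemma sigma_compact_measurable (C : set G) : sigma_compact C -> measurable (C : set (borel G)).
Proof.
by move=> [K cK ->]; apply: bigcup_measurable => k _; exact: compact_measurable.
Qed.

Lemma sigma_compactU (C D : set G) : sigma_compact C -> sigma_compact D -> sigma_compact (C `|` D).
Proof.
move=> sC sD; have -> : C `|` D = \bigcup_n (if n is 0%N then C else D).
  rewrite eqEsubset; split => [x [Cx|Dx]|x [[|n] _]]; [by exists 0%N|by exists 1%N|by left|by right].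
by apply: sigma_compact_bigcup => -[].
Qed.

Let out (C : set G) : borel G -> R[i] := indic_fun R (~` C : set (borel G)).

Let cmul_out_sub (C D : set (borel G)) (f : L2 mu) : measurable C -> measurable D -> C `<=` D ->
  cmul (out C) f = 0 -> cmul (out D) f = 0.
Proof.
move=> mC mD CD f0; have bC := cbounded_indic R (measurableC mC) : cbounded (out C).
have bD := cbounded_indic R (measurableC mD) : cbounded (out D).
rewrite -[RHS](hlinear0 (cmul_linear bD)) -f0 cmulM//.
congr cmul; apply/funext => x; rewrite /out /indic_fun !indicE -rmorphM /=.
have [xD|xD] := boolP (x \in ~` D); last by rewrite mul0r.
by rewrite mul1r mem_set// => /CD; exact: (set_mem xD).
Qed.

(** The vectors carried by some sigma-compact set form a closed subspace, so indicators suffice.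
    This stands in for sigma-finiteness and provides the set to which [dense_translates] is
    applied. *)
Lemma sigma_compact_carrier (f : L2 mu) : exists2 C : set G, sigma_compact C &
  \forall y \ae mu, ~ C y -> L2_repr f y = 0.
Proof.
pose K := [set f : L2 mu | exists2 C : set G, sigma_compact C & cmul (out C) f = 0].
suff : K f.
  move=> [C sC f0]; exists C => //.
  have mC := sigma_compact_measurable sC.
  have bC := cbounded_indic R (measurableC mC) : cbounded (out C).
  have := cmulK f bC; rewrite f0 => h; apply: filterS2 h (@L2_repr0 _ _ _ mu) => y -> h Cy.
  by move: h; rewrite /out /indic_fun indicE mem_set// mul1r.
move: f; apply: L2_indic_dense.
  split.
  - exists set0; first by exists (fun=> set0) => [n|]; [exact: compact0|rewrite bigcup0].
    have mC : measurable (~` set0 : set (borel G)) by exact: measurableC.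
    have bC := cbounded_indic R mC : cbounded (out set0).
    exact: (hlinear0 (@cmul_linear _ _ _ mu _ bC)).
  - move=> a f g [C sC f0] [D sD g0]; have sCD := sigma_compactU sC sD; exists (C `|` D) => //.
    have mC := sigma_compact_measurable sC; have mD := sigma_compact_measurable sD.
    have mCD := sigma_compact_measurable sCD.
    rewrite (@cmul_linear _ _ _ mu _ (cbounded_indic R (measurableC mCD)) a f g).
    rewrite (cmul_out_sub mC mCD _ f0); last exact: subsetUl.
    rewrite (cmul_out_sub mD mCD _ g0); last exact: subsetUr.
    by rewrite scaler0 addr0.
  - move=> u f Ku uf; have /choice[C hC] n : exists C, sigma_compact C /\ cmul (out C) (u n) = 0.
      by have [C sC u0] := Ku n; exists C.
    have sC : sigma_compact (\bigcup_n C n).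
      by apply: sigma_compact_bigcup => n; case: (hC n).
    have mC := sigma_compact_measurable sC; exists (\bigcup_n C n) => //.
    have := hbounded_cvg (@cmul_bounded _ _ _ mu _ (cbounded_indic R (measurableC mC))) uf => h.
    apply: (hcvg_unique ipL2 h).
    rewrite (_ : _ \o _ = fun=> 0); first exact: hcvg_cst.
    apply/funext => n /=; have [sCn un] := hC n.
    apply: cmul_out_sub un => //; first exact: sigma_compact_measurable.
    exact: bigcup_sup.
move=> A mA Aoo.
have /choice[U hU] n : exists U : set G, exists K : set G, [/\ open U /\ compact K, A `<=` U /\ K `<=` U, (mu U < +oo)%E,
    l2norm (indic2 mu U - indic2 mu A) < n.+1%:R^-1 & l2norm (indic2 mu U - indic2 mu K) < n.+1%:R^-1].
  by apply: regular_approx => //; rewrite invr_gt0.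
have {U hU}/choice[UK hUK] n : exists UK : set G * set G, [/\ open UK.1 /\ compact UK.2, A `<=` UK.1 /\ UK.2 `<=` UK.1, (mu UK.1 < +oo)%E,
    l2norm (indic2 mu UK.1 - indic2 mu A) < n.+1%:R^-1 & l2norm (indic2 mu UK.1 - indic2 mu UK.2) < n.+1%:R^-1].
  by have [K1 hK1] := hU n; exists (U n, K1).
(* Outside [C], the set [A] lies in the difference of [(UK n).1] and [(UK n).2] for every [n], whose
   indicator has norm below [1/(n+1)]. *)
pose C := \bigcup_n (UK n).2.
have sC : sigma_compact C by exists (fun n => (UK n).2) => // n; case: (hUK n) => -[].
have mC := sigma_compact_measurable sC; exists C => //.
have bC := cbounded_indic R (measurableC mC) : cbounded (out C).
apply: (hnorm_le0 ipL2); apply/ler_addgt0Pr => e e0; rewrite add0r.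
have [N /(_ N (leqnn _)) hN] := harmonic_lt e0.
have [[oU cK] [AU KU] Uoo _ UK1] := hUK N.
apply: le_trans (ltW hN); apply: le_trans (ltW UK1).
have mU := open_measurable_borel oU; have mK := compact_measurable G_hausdorff cK.
have Koo : (mu (UK N).2 < +oo)%E by rewrite (le_lt_trans _ Uoo)// le_measure ?inE.
have sU := sq_integrable_indic mU Uoo; have sK := sq_integrable_indic mK Koo.
have sA := sq_integrable_indic mA Aoo.
rewrite /indic2 (cmul_class bC sA) -(L2_classB sU sK).
apply: ler_l2norm_ae.
have sCA := sq_integrable_cmul bC sA.
have sUK := sq_integrableB sU sK.
apply: filterS2 (L2_classK sCA) (L2_classK sUK) => x -> ->.
rewrite /out /indic_fun !indicE -rmorphM -rmorphB !modc_real /=.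
have [xA|xA] := boolP (x \in A); last by rewrite mulr0 normr0.
have [xC|xC] := boolP (x \in ~` C); last by rewrite mul0r normr0.
rewrite (mem_set (AU _ (set_mem xA))) memNset ?subr0 ?mulr1// => Kx.
by apply: (set_mem xC); exists N.
Qed.

End SigmaCompact.

(** * Gram-Schmidt sequences, Bessel and Parseval *)

Section GramSchmidt.
Context (R : realType) (V : lmodType R[i]) (ip : V -> V -> R[i]).
Hypothesis Hip : inner_product ip.
Local Notation "`[ x ]" := (hnorm ip x) (format "`[ x ]").
Variable y : nat -> V.

(* The normalization of 0 is 0. *)
Let normalize (x : V) : V := (`[x]^-1)%:C%C *: x.

Fixpoint gram_schmidt_seq n : seq V :=
  if n is n'.+1 then
    rcons (gram_schmidt_seq n')
      (normalize (y n' - \sum_(e <- gram_schmidt_seq n') ip (y n') e *: e))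
  else [::].

Definition gram_schmidt n : V :=
  normalize (y n - \sum_(e <- gram_schmidt_seq n) ip (y n) e *: e).

Local Notation e := gram_schmidt.

Let P n x := \sum_(i < n) ip x (e i) *: e i.

Let gsE n x : \sum_(u <- gram_schmidt_seq n) ip x u *: u = P n x.
Proof.
rewrite /P; elim: n => [|n IH]; first by rewrite big_nil big_ord0.
by rewrite big_ord_recr -IH /= -cats1 big_cat big_seq1.
Qed.

Let eE n : e n = normalize (y n - P n (y n)).
Proof. by rewrite /gram_schmidt gsE. Qed.

Let e_unit n : ip (e n) (e n) = 1 \/ e n = 0.
Proof.
set r := y n - P n (y n).
have [r0|/eqP r0] := eqVneq `[r] 0.
  by right; rewrite eE -/r /normalize (hnorm_eq0 Hip r0) scaler0.
left; rewrite eE -/r (ipxx Hip) (hnormZ Hip) modc_real ger0_norm ?invr_ge0 ?hnorm_ge0//.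
by rewrite mulVf ?expr1n//; exact/eqP.
Qed.

Let e_orth n : forall i j, (i < n)%N -> (j < n)%N -> i <> j -> ip (e i) (e j) = 0.
Proof.
elim: n => [//|n IH] i j; wlog ij : i j / (i < j)%N.
  move=> h ilt jlt ij; have [lt|lt|/ij//] := ltngtP i j; first exact: h.
  by rewrite (ipC Hip) h ?conjc0//; exact/nesym.
move=> _; rewrite ltnS leq_eqVlt => /predU1P[jn _|jn ijE]; last first.
  by apply: IH => //; exact: ltn_trans jn.
rewrite jn in ij *; rewrite (ipC Hip) eE (ipZl Hip) (ipBl Hip) (ip_suml Hip).
rewrite (bigD1 (Ordinal ij))//= big1; last first.
  move=> k ki; rewrite (ipZl Hip) IH ?mulr0// => kiE; move: ki.
  by rewrite -val_eqE /= kiE eqxx.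
rewrite addr0 (ipZl Hip); have [->|->] := e_unit i; first by rewrite mulr1 subrr mulr0 conjc0.
by rewrite !(ip0r Hip) mulr0 subrr mulr0 conjc0.
Qed.

Let orth i j : i <> j -> ip (e i) (e j) = 0.
Proof. by apply: (e_orth (n := (maxn i j).+1)); rewrite ltnS ?leq_maxl ?leq_maxr. Qed.

Let residual n x : `[x - P n x] ^+ 2 = `[x] ^+ 2 - \sum_(i < n) modc (ip x (e i)) ^+ 2.
Proof.
elim: n => [|n IH]; first by rewrite /P !big_ord0 !subr0.
have -> : x - P n.+1 x = (x - P n x) - ip x (e n) *: e n.
  by rewrite /P big_ord_recr /= opprD addrA.
rewrite (sqr_hnormB Hip) IH big_ord_recr /= (hnormZ Hip (ip x (e n))) (ipZr Hip (ip x (e n))) (ipBl Hip).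
have -> : ip (P n x) (e n) = 0.
  rewrite (ip_suml Hip) big1// => i _; rewrite (ipZl Hip) orth ?mulr0//.
  by move=> E; have := ltn_ord i; rewrite E ltnn.
rewrite subr0 [_^*%C * _]mulrC mulcJ /= exprMn.
have -> : modc (ip x (e n)) ^+ 2 * `[e n] ^+ 2 = modc (ip x (e n)) ^+ 2.
  rewrite (sqr_hnorm Hip); have [->|e0] := e_unit n; first by rewrite mulr1.
  by rewrite e0 (ip0r Hip) modc0 expr0n mul0r.
ring.
Qed.

Lemma Bessel n x : \sum_(i < n) modc (ip x (e i)) ^+ 2 <= `[x] ^+ 2.
Proof. by rewrite -subr_ge0 -residual sqr_ge0. Qed.

Let residual_homo m n x : (m <= n)%N -> `[x - P n x] <= `[x - P m x].
Proof.
move=> mn; rewrite -(@ler_pXn2r _ 2)// ?nnegrE ?hnorm_ge0// !residual.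
rewrite lerD2l lerN2 -!(big_mkord xpredT (fun i => modc (ip x (e i)) ^+ 2)).
rewrite (big_cat_nat (leq0n m) mn) /= lerDl sumr_ge0// => i _.
exact: sqr_ge0.
Qed.

Let residual_le n x : `[x - P n x] <= `[x].
Proof. by rewrite (le_trans (residual_homo x (leq0n n)))// /P big_ord0 subr0. Qed.

Let P_lin n x z : P n (x + z) = P n x + P n z.
Proof.
by rewrite /P -big_split; apply: eq_bigr => i _; rewrite (ipDl Hip) scalerDl.
Qed.

(** What remains of [y n] after projection on the earlier vectors is a multiple of [e n], also when
    it vanishes and [e n = 0]. *)
Let residual_y n : y n - P n.+1 (y n) = 0.
Proof.
rewrite /P big_ord_recr /= -/(P n (y n)) opprD addrA.
set r := y n - P n (y n).
have rE : r = (`[r])%:C%C *: e n.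
  rewrite eE -/r scalerA -rmorphM /=.
  have [r0|r0] := eqVneq `[r] 0; last by rewrite mulfV// rmorph1 scale1r.
  by rewrite {1 4}(hnorm_eq0 Hip r0) scaler0.
have ye : ip (y n) (e n) = ip r (e n).
  rewrite (ipBl Hip) [X in _ - X](_ : _ = 0) ?subr0//.
  rewrite (ip_suml Hip) big1// => i _; rewrite (ipZl Hip) orth ?mulr0//.
  by move=> E; have := ltn_ord i; rewrite E ltnn.
rewrite ye {1 2}rE (ipZl Hip).
by have [->|->] := e_unit n; rewrite ?mulr1 ?scaler0 subrr.
Qed.

Lemma gram_schmidt_approx x : (forall eps : R, 0 < eps -> exists k, `[x - y k] < eps) ->
  forall eps : R, 0 < eps -> exists N, forall n, (N <= n)%N -> `[x - P n x] < eps.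
Proof.
move=> hx eps eps0; have [k hk] := hx eps eps0; exists k.+1 => n kn.
have -> : x - P n x = ((x - y k) - P n (x - y k)) + (y k - P n (y k)).
  have {1}-> : x = (x - y k) + y k by rewrite subrK.
  have {2}-> : x = (x - y k) + y k by rewrite subrK.
  by rewrite P_lin opprD addrACA.
have -> : y k - P n (y k) = 0.
  apply: (hnorm_le0 Hip); rewrite (le_trans (residual_homo _ kn))//.
  by rewrite residual_y (hnorm0 Hip).
by rewrite addr0 (le_lt_trans (residual_le _ _)).
Qed.

(** Only [x] has to lie in the closure of the range of [y]. As [z] is arbitrary, the sequence [e]
    does not have to be a basis. *)
Lemma Parseval x z : (forall eps : R, 0 < eps -> exists k, `[x - y k] < eps) ->
  forall eps : R, 0 < eps -> exists N, forall n, (N <= n)%N ->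
    modc (\sum_(i < n) ip z (e i) * (ip x (e i))^*%C - ip z x) < eps.
Proof.
move=> hx eps eps0; have z1 : 0 < `[z] + 1 by rewrite ltr_wpDl// hnorm_ge0.
have [N hN] := gram_schmidt_approx hx (divr_gt0 eps0 z1); exists N => n /hN h.
have -> : \sum_(i < n) ip z (e i) * (ip x (e i))^*%C = ip z (P n x).
  by rewrite (ip_sumr Hip); apply: eq_bigr => i _; rewrite (ipZr Hip (ip x (e i))) mulrC.
rewrite -(ipBr Hip) (le_lt_trans (modc_ip_le Hip _ _))//.
rewrite (hdistC Hip); move: h; rewrite ltr_pdivlMr// => h.
have := hnorm_ge0 ip (x - P n x); have := hnorm_ge0 ip z; nra.
Qed.

End GramSchmidt.

(** * Limits and series of complex numbers *)

Section ComplexLimits.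
Context (R : realType).
Implicit Types (z : nat -> R[i]) (l : R[i]).

Definition ccvg z l := forall e : R, 0 < e ->
  exists N, forall n, (N <= n)%N -> modc (z n - l) < e.

Lemma ccvg_unique z l l' : ccvg z l -> ccvg z l' -> l = l'.
Proof.
move=> zl zl'; apply/eqP; rewrite -subr_eq0; apply/eqP/modc_eq0/eqP.
rewrite eq_le modc_ge0 andbT; apply/ler_addgt0Pr => e e0; rewrite add0r.
have e2 : 0 < e / 2 by rewrite divr_gt0.
have [N hN] := zl _ e2; have [N' hN'] := zl' _ e2; pose n := maxn N N'.
have -> : l - l' = - (z n - l) + (z n - l') by rewrite opprB subrKA.
rewrite (le_trans (ler_modcD _ _))// modcN [leRHS]splitr lerD// ltW//.
  by apply: hN; exact: leq_maxl.
by apply: hN'; exact: leq_maxr.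
Qed.

Lemma ccvgD z z' l l' : ccvg z l -> ccvg z' l' -> ccvg (fun n => z n + z' n) (l + l').
Proof.
move=> zl zl' e e0; have e2 : 0 < e / 2 by rewrite divr_gt0.
have [N hN] := zl _ e2; have [N' hN'] := zl' _ e2; exists (maxn N N') => n.
rewrite geq_max => /andP[/hN h /hN' h'].
rewrite opprD addrACA (le_lt_trans (ler_modcD _ _))// [ltRHS]splitr ltrD//.
Qed.

Lemma ccvgZ a z l : ccvg z l -> ccvg (fun n => a * z n) (a * l).
Proof.
move=> zl e e0; have a0 : 0 < modc a + 1 by rewrite ltr_wpDl// modc_ge0.
have [N hN] := zl _ (divr_gt0 e0 a0); exists N => n /hN.
rewrite -mulrBr modcM ltr_pdivlMr// => h.
by have := modc_ge0 (z n - l); have := modc_ge0 a; nra.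
Qed.

Lemma ccvgJ z l : ccvg z l -> ccvg (fun n => (z n)^*%C) l^*%C.
Proof.
move=> zl e /zl[N hN]; exists N => n /hN.
by rewrite -conjcN -conjcD modcJ.
Qed.

Lemma eq_ccvg z z' l : z =1 z' -> ccvg z l -> ccvg z' l.
Proof. by move=> /funext ->. Qed.

Lemma ccvg_Re_le z l (B : R) : (forall n, complex.Re (z n) <= B) -> ccvg z l ->
  complex.Re l <= B.
Proof.
move=> zB zl; apply/ler_addgt0Pr => e e0; have [N /(_ N (leqnn _)) hN] := zl _ e0.
have := le_lt_trans (modc_Re _) hN; rewrite RecD RecN ltr_norml => /andP[+ _].
by have := zB N; lra.
Qed.

Lemma ccvg_Re_ge z l (B : R) N : (forall n, (N <= n)%N -> B <= complex.Re (z n)) -> ccvg z l ->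
  B <= complex.Re l.
Proof.
move=> zB zl; apply/ler_addgt0Pr => e e0; have [N' hN'] := zl _ e0.
have := le_lt_trans (modc_Re _) (hN' (maxn N N') (leq_maxr _ _)).
rewrite RecD RecN ltr_norml => /andP[_ +].
by have := zB (maxn N N') (leq_maxl _ _); lra.
Qed.

Lemma ccvg_Re z l : ccvg z l -> complex.Re (z n) @[n --> \oo] --> complex.Re l.
Proof.
move=> zl; apply/cvgrPdist_lt => e e0; have [N hN] := zl _ e0.
exists N => // n /= /hN; apply: le_lt_trans.
by rewrite distrC -RecN -RecD modc_Re.
Qed.

Lemma ccvg_Im z l : ccvg z l -> complex.Im (z n) @[n --> \oo] --> complex.Im l.
Proof.
move=> zl; apply/cvgrPdist_lt => e e0; have [N hN] := zl _ e0.
exists N => // n /= /hN; apply: le_lt_trans.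
by rewrite distrC -ImcN -ImcD modc_Im.
Qed.

Lemma cvg_ccvg z l : complex.Re (z n) @[n --> \oo] --> complex.Re l ->
  complex.Im (z n) @[n --> \oo] --> complex.Im l -> ccvg z l.
Proof.
move=> /cvgrPdist_lt hr /cvgrPdist_lt hi e e0; have e2 : 0 < e / 2 by rewrite divr_gt0.
have [N _ hN] := hr _ e2; have [N' _ hN'] := hi _ e2; exists (maxn N N') => n.
rewrite geq_max => /andP[/hN /= h /hN' /= h'].
have {}h : `|complex.Re (z n - l)| < e / 2 by rewrite RecD RecN distrC.
have {}h' : `|complex.Im (z n - l)| < e / 2 by rewrite ImcD ImcN distrC.
rewrite -(@ltr_pXn2r _ 2)// ?nnegrE ?modc_ge0 ?(ltW e0)// modc2E.
rewrite -(real_normK (num_real (complex.Re _))) -(real_normK (num_real (complex.Im _))).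
have : 0 <= `|complex.Re (z n - l)| by []; have : 0 <= `|complex.Im (z n - l)| by [].
by move: h h'; move: (`|_|) (`|_|) => p q; nra.
Qed.

Definition psum z n : R[i] := \sum_(i < n) z i.

Lemma psumS z n : psum z n.+1 = psum z n + z n.
Proof. by rewrite /psum big_ord_recr. Qed.

Lemma Re_psum z n : complex.Re (psum z n) = series (fun k => complex.Re (z k)) n.
Proof. by rewrite /psum Rec_sum /series /= big_mkord. Qed.

Lemma Im_psum z n : complex.Im (psum z n) = series (fun k => complex.Im (z k)) n.
Proof. by rewrite /psum Imc_sum /series /= big_mkord. Qed.

Lemma complex_seriesE z l : ccvg (psum z) l -> complex_series z = l.
Proof.
move=> zl; apply: complexP => /=; apply: cvg_lim => //.
  by have := ccvg_Re zl; under eq_fun do rewrite Re_psum.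
by have := ccvg_Im zl; under eq_fun do rewrite Im_psum.
Qed.

Lemma complex_series_cvg z : cvgn (series (fun k => modc (z k))) ->
  ccvg (psum z) (complex_series z).
Proof.
move=> cz; apply: cvg_ccvg.
  under eq_fun do rewrite Re_psum.
  suff : cvgn (series (fun k => complex.Re (z k))) by [].
  apply: normed_cvg; apply: series_le_cvg cz => k //=; first exact: modc_ge0.
  exact: modc_Re.
under eq_fun do rewrite Im_psum.
suff : cvgn (series (fun k => complex.Im (z k))) by [].
apply: normed_cvg; apply: series_le_cvg cz => k //=; first exact: modc_ge0.
exact: modc_Im.
Qed.

Lemma psumD z z' n : psum (fun k => z k + z' k) n = psum z n + psum z' n.
Proof. by rewrite /psum big_split. Qed.

Lemma psumZ a z n : psum (fun k => a * z k) n = a * psum z n.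
Proof. by rewrite /psum mulr_sumr. Qed.

Lemma psumJ z n : psum (fun k => (z k)^*%C) n = (psum z n)^*%C.
Proof. by rewrite /psum rmorph_sum. Qed.

End ComplexLimits.

(** * The Hilbert sum of countably many copies of [L2 mu] *)

Section HilbertSum.
Context d (T : measurableType d) (R : realType) (mu : {measure set T -> \bar R}).
Let ipL2 := inner_product_L2 mu.
Implicit Types f g : nat -> L2 mu.

Lemma square_summable_le f : square_summable f ->
  exists B : R, forall n, \sum_(k < n) l2norm (f k) ^+ 2 <= B.
Proof.
move=> cf; exists (limn (series (fun k => l2norm (f k) ^+ 2))) => n.
rewrite -(big_mkord xpredT (fun k => l2norm (f k) ^+ 2)).
apply: (nondecreasing_cvgn_le _ cf) => m k mk.
rewrite /series /= (big_cat_nat (leq0n m) mk) /= lerDl sumr_ge0// => i _; exact: sqr_ge0.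
Qed.

Lemma le_square_summable f (B : R) :
  (forall n, \sum_(k < n) l2norm (f k) ^+ 2 <= B) -> square_summable f.
Proof.
move=> fB; apply: nondecreasing_is_cvgn.
  move=> m k mk; rewrite /series /= (big_cat_nat (leq0n m) mk) /= lerDl sumr_ge0// => i _.
  exact: sqr_ge0.
by exists B => _ [n _ <-]; rewrite /series /= big_mkord.
Qed.

Definition sqsum : {pred nat -> L2 mu} := mem [set f | square_summable f].

Lemma sqsum_submod_closed : submod_closed sqsum.
Proof.
split.
  rewrite inE /=; apply: (@le_square_summable _ 0) => n.
  rewrite big1// => i _; have -> : (0 : nat -> L2 mu) i = 0 by [].
  by rewrite l2norm0 expr0n.
move=> a f g fs gs; rewrite inE.
have sf : square_summable f by have := fs; rewrite inE.
have sg : square_summable g by have := gs; rewrite inE.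
have [B hB] := square_summable_le sf; have [C hC] := square_summable_le sg.
apply: (@le_square_summable _ (2 * modc a ^+ 2 * B + 2 * C)) => n.
apply: (@le_trans _ _ (2 * modc a ^+ 2 * (\sum_(k < n) l2norm (f k) ^+ 2) +
  2 * \sum_(k < n) l2norm (g k) ^+ 2)); last first.
  by rewrite lerD// ler_wpM2l// mulr_ge0// sqr_ge0.
rewrite !mulr_sumr -big_split /=; apply: ler_sum => k _.
have -> : (a *: f + g) k = a *: f k + g k by [].
have := ler_l2normD (a *: f k) (g k); rewrite l2normZ.
move: (l2norm_ge0 (a *: f k + g k)) (l2norm_ge0 (f k)) (l2norm_ge0 (g k)) (modc_ge0 a).
move: (l2norm (_ + _)) (l2norm (f k)) (l2norm (g k)) (modc a) => s p q b s0 p0 q0 b0 h.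
apply: (@le_trans _ _ ((b * p + q) ^+ 2)).
  by rewrite ler_pXn2r// nnegrE addr_ge0// mulr_ge0.
by rewrite -subr_ge0 [leRHS](_ : _ = (b * p - q) ^+ 2) ?sqr_ge0//; ring.
Qed.

HB.instance Definition _ :=
  GRing.isSubmodClosed.Build _ _ sqsum sqsum_submod_closed.

(** On this space an ultraweak form of [S] becomes an ordinary vector functional of the
    amplification [ell2_map S], so that Cauchy-Schwarz and Parseval apply to it. *)
Record ell2 := Ell2 { ell2_val :> nat -> L2 mu ; _ : ell2_val \in sqsum }.
HB.instance Definition _ := [isSub for ell2_val].
HB.instance Definition _ := gen_eqMixin ell2.
HB.instance Definition _ := [Choice of ell2 by <:].
HB.instance Definition _ := [SubChoice_isSubLmodule of ell2 by <:].

Implicit Types p q : ell2.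

Lemma ell2P p : square_summable p.
Proof. by have := valP p; rewrite inE. Qed.

Lemma ell2ZD a p q k : (a *: p + q) k = a *: p k + q k.
Proof. by []. Qed.

Lemma ell2_ext p q : (forall k, p k = q k) -> p = q.
Proof. by move=> pq; apply: val_inj; apply/funext. Qed.

Lemma ell2B p q k : (p - q) k = p k - q k.
Proof. by []. Qed.

Definition ell2_of f : ell2 := insubd (0 : ell2) f.

Lemma ell2_ofK f : square_summable f -> ell2_of f = f :> (nat -> L2 mu).
Proof. by move=> sf; apply: insubdK; rewrite inE. Qed.

Definition ell2_inner p q : R[i] := complex_series (fun k => inner (p k) (q k)).

Lemma ell2_inner_cvg p q : ccvg (psum (fun k => inner (p k) (q k))) (ell2_inner p q).
Proof.
have [B hB] := square_summable_le (@ell2P p); have [C hC] := square_summable_le (@ell2P q).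
apply: complex_series_cvg; apply: nondecreasing_is_cvgn.
  move=> m k mk; rewrite /series /= (big_cat_nat (leq0n m) mk) /= lerDl sumr_ge0// => i _.
  exact: modc_ge0.
exists (B + C) => _ [n _ <-]; rewrite /series /= big_mkord.
rewrite (le_trans _ (lerD (hB n) (hC n)))// -big_split /=; apply: ler_sum => k _.
have := modc_ip_le ipL2 (p k) (q k).
have : l2norm (p k) * l2norm (q k) <= l2norm (p k) ^+ 2 + l2norm (q k) ^+ 2.
  move: (l2norm_ge0 (p k)) (l2norm_ge0 (q k)).
  move: (l2norm (p k)) (l2norm (q k)) => s t s0 t0; rewrite -subr_ge0.
  rewrite [leRHS](_ : _ = ((s - t) ^+ 2 + s * t)); last by ring.
  by rewrite addr_ge0 ?sqr_ge0 ?mulr_ge0.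
by move=> h1 h2; exact: le_trans h2 h1.
Qed.

Lemma Re_psum_ell2 p n :
  complex.Re (psum (fun k => inner (p k) (p k)) n) = \sum_(k < n) l2norm (p k) ^+ 2.
Proof. by rewrite /psum Rec_sum; apply: eq_bigr => k _; rewrite -(sqr_hnorm ipL2). Qed.

Lemma ell2_psum_le p n : \sum_(k < n) l2norm (p k) ^+ 2 <= complex.Re (ell2_inner p p).
Proof.
rewrite -Re_psum_ell2; apply: (ccvg_Re_ge (N := n)) (ell2_inner_cvg p p) => m nm.
rewrite !Re_psum_ell2 -!(big_mkord xpredT (fun k => l2norm (p k) ^+ 2)).
by rewrite (big_cat_nat (leq0n n) nm) /= lerDl sumr_ge0// => i _; exact: sqr_ge0.
Qed.

Lemma inner_product_ell2 : inner_product ell2_inner.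
Proof.
split.
- move=> p q r; apply: (ccvg_unique (ell2_inner_cvg (p + q) r)).
  apply: eq_ccvg (ccvgD (ell2_inner_cvg p r) (ell2_inner_cvg q r)) => n /=.
  by rewrite -psumD; apply: eq_bigr => k _; rewrite -(ipDl ipL2).
- move=> a p q; apply: (ccvg_unique (ell2_inner_cvg (a *: p) q)).
  apply: eq_ccvg (ccvgZ a (ell2_inner_cvg p q)) => n /=.
  by rewrite -psumZ; apply: eq_bigr => k _; rewrite -(ipZl ipL2).
- move=> p q; apply: (ccvg_unique (ell2_inner_cvg q p)).
  apply: eq_ccvg (ccvgJ (ell2_inner_cvg p q)) => n /=.
  by rewrite -psumJ; apply: eq_bigr => k _; rewrite -(ipC ipL2).
- by move=> p; have := ell2_psum_le p 0; rewrite big_ord0.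
- move=> p p0; apply: val_inj; apply/funext => k /=.
  apply: (hnorm_eq0 ipL2); apply/eqP; rewrite -sqrf_eq0 eq_le sqr_ge0 andbT.
  have := ell2_psum_le p k.+1; rewrite p0 big_ord_recr /=; apply: le_trans.
  by rewrite lerDr sumr_ge0// => i _; exact: sqr_ge0.
Qed.

Local Notation "`[ x ]" := (hnorm ell2_inner x) (format "`[ x ]").

Lemma sqr_ell2norm_le p (B : R) : (forall n, \sum_(k < n) l2norm (p k) ^+ 2 <= B) ->
  `[p] ^+ 2 <= B.
Proof.
move=> pB; rewrite (sqr_hnorm inner_product_ell2).
by apply: ccvg_Re_le (ell2_inner_cvg p p) => n; rewrite Re_psum_ell2.
Qed.

Lemma ell2norm_psum_le p n : \sum_(k < n) l2norm (p k) ^+ 2 <= `[p] ^+ 2.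
Proof. by rewrite (sqr_hnorm inner_product_ell2) ell2_psum_le. Qed.

Definition ell2_map (S : L2 mu -> L2 mu) p : ell2 := ell2_of (fun k => S (p k)).

Section Map.
Variables (S : L2 mu -> L2 mu) (M : R).
Hypotheses (M0 : 0 <= M) (bS : forall u : L2 mu, l2norm (S u) <= M * l2norm u).

Let map_le p n : \sum_(k < n) l2norm (S (p k)) ^+ 2 <= M ^+ 2 * `[p] ^+ 2.
Proof.
rewrite (le_trans _ (ler_wpM2l (sqr_ge0 M) (ell2norm_psum_le p n)))// mulr_sumr.
apply: ler_sum => k _; rewrite -exprMn ler_pXn2r// ?nnegrE ?l2norm_ge0//.
by rewrite mulr_ge0// l2norm_ge0.
Qed.

Lemma ell2_mapE p k : ell2_map S p k = S (p k).
Proof. by rewrite ell2_ofK//; apply: le_square_summable; exact: map_le. Qed.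

Lemma ell2_map_le p : `[ell2_map S p] <= M * `[p].
Proof.
rewrite -(@ler_pXn2r _ 2)// ?nnegrE ?mulr_ge0 ?hnorm_ge0// exprMn.
by apply: sqr_ell2norm_le => n; under eq_bigr do rewrite ell2_mapE; exact: map_le.
Qed.

End Map.

Lemma ultraweak_formE (S : L2 mu -> L2 mu) p q : bounded_operator S ->
  ultraweak_form p q S = ell2_inner (ell2_map S p) q.
Proof.
move=> bS; have [M M0 hM] := hbounded_gt0 bS.
by congr complex_series; apply/funext => k; rewrite (ell2_mapE (ltW M0)).
Qed.

Lemma ultraweak_form_cvg (S : L2 mu -> L2 mu) p q : bounded_operator S ->
  ccvg (psum (fun k => inner (S (p k)) (q k))) (ultraweak_form p q S).
Proof.
move=> bS; have [M M0 hM] := hbounded_gt0 bS.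
rewrite (ultraweak_formE p q bS).
apply: eq_ccvg (ell2_inner_cvg (ell2_map S p) q) => n; apply: eq_bigr => k _.
exact: (congr1 (fun u => inner u (q k)) (ell2_mapE (ltW M0) hM p k)).
Qed.

End HilbertSum.

(** * Dominated convergence and families of multiplication operators *)

Section DominatedConvergence.
Context d (T : measurableType d) (R : realType) (mu : {measure set T -> \bar R}).

Let real_dominated (F : nat -> T -> R) (F0 : T -> R) (g : T -> R) :
  (forall n, measurable_fun [set: T] (F n)) -> measurable_fun [set: T] F0 ->
  (\forall x \ae mu, F n x @[n --> \oo] --> F0 x) ->
  mu.-integrable [set: T] (EFin \o g) -> (forall n x, `|F n x| <= g x) ->
  \int[mu]_x F n x @[n --> \oo] --> \int[mu]_x F0 x.
Proof.
move=> mF mF0 cF ig Fg.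
have cF' : {ae mu, forall x, [set: T] x -> (F n x)%:E @[n --> \oo] --> (F0 x)%:E}.
  apply: filterS cF => x hx _; apply: cvg_EFin => //.
  exact: nearW.
have Fg' : {ae mu, forall x n, [set: T] x -> (`|(F n x)%:E| <= (EFin \o g) x)%E}.
  by apply: aeW => x n _ /=; rewrite lee_fin.
have mF' n : measurable_fun [set: T] (fun x => (F n x)%:E) by exact/measurable_EFinP.
have mF0' : measurable_fun [set: T] (fun x => (F0 x)%:E) by exact/measurable_EFinP.
have [iF0 _ h] := dominated_convergence measurableT mF' mF0' cF' ig Fg'.
have iF n : mu.-integrable [set: T] (EFin \o F n).
  apply: (le_integrable measurableT _ _ ig); first exact/measurable_EFinP.
  by move=> x _ /=; rewrite lee_fin (le_trans (Fg n x))// ler_norm.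
have := h; rewrite -[X in _ --> X](fineK (integrable_fin_num measurableT iF0)).
move=> /fine_cvgP[_]; exact.
Qed.

Lemma cint_dominated_cvg (F : nat -> T -> R[i]) (F0 : T -> R[i]) (g : T -> R) :
  (forall n, cmeasurable (F n)) -> cmeasurable F0 ->
  (\forall x \ae mu, ccvg (fun n => F n x) (F0 x)) ->
  mu.-integrable [set: T] (EFin \o g) -> (forall n x, modc (F n x) <= g x) ->
  ccvg (fun n => cint mu (F n)) (cint mu F0).
Proof.
move=> mF [mr mi] cF ig Fg; apply: cvg_ccvg => /=.
  apply: (@real_dominated (fun n x => complex.Re (F n x)) _ g) => //.
  - by move=> n; case: (mF n).
  - by apply: filterS cF => x; exact: ccvg_Re.
  - by move=> n x; rewrite (le_trans (modc_Re _)).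
apply: (@real_dominated (fun n x => complex.Im (F n x)) _ g) => //.
- by move=> n; case: (mF n).
- by apply: filterS cF => x; exact: ccvg_Im.
- by move=> n x; rewrite (le_trans (modc_Im _)).
Qed.

(** The pointwise bound is asked only where [h] is nonzero: a vector carried near the identity sees
    only the small variation of the coefficients there. *)
Lemma sum_sqr_cmul_le (c : nat -> T -> R[i]) (B : R) (h : L2 mu) n : 0 <= B ->
  (forall i, cbounded (c i)) ->
  (\forall s \ae mu, L2_repr h s <> 0 -> \sum_(i < n) modc (c i s) ^+ 2 <= B) ->
  \sum_(i < n) l2norm (cmul (c i) h) ^+ 2 <= B * l2norm h ^+ 2.
Proof.
move=> B0 bc hc; have sh := L2_reprP h; rewrite -lee_fin -sumEFin EFinM.
have mh := measurable_modc2 (sq_integrable_measurable sh).1 (sq_integrable_measurable sh).2.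
have sch i : sq_integrable mu (fun x => c i x * L2_repr h x) by exact: sq_integrable_cmul.
have mch i := measurable_modc2 (sq_integrable_measurable (sch i)).1
  (sq_integrable_measurable (sch i)).2.
rewrite (eq_bigr (fun i : 'I_n => (\int[mu]_x (modc (c i x * L2_repr h x) ^+ 2)%:E)%E)); last first.
  by move=> i _; exact: EFin_sqr_l2norm_class.
rewrite -(@ge0_integral_sum _ _ _ mu setT measurableT _
  (fun i : 'I_n => fun x => (modc (c i x * L2_repr h x) ^+ 2)%:E)); last 2 first.
- by move=> i; exact: mch.
- by move=> i x _; rewrite lee_fin sqr_ge0.
rewrite (EFin_sqr_l2norm h) -ge0_integralZl_EFin//; last by move=> x _; rewrite lee_fin sqr_ge0.
apply: ae_ge0_le_integral => //.
- by move=> x _; apply: sume_ge0 => i _; rewrite lee_fin sqr_ge0.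
- by apply: emeasurable_sum => i; exact: mch.
- by move=> x _; rewrite -EFinM lee_fin mulr_ge0// sqr_ge0.
- exact: measurable_funeM.
apply: filterS hc => x hx _; rewrite sumEFin -EFinM lee_fin.
have [->|/eqP h0] := eqVneq (L2_repr h x) 0.
  by rewrite modc0 expr0n mulr0 big1// => i _; rewrite mulr0 modc0 expr0n.
under eq_bigr do rewrite modcM exprMn.
by rewrite -mulr_suml ler_wpM2r ?sqr_ge0//; exact: hx.
Qed.

End DominatedConvergence.

(** * Translations on the Hilbert sum *)

Section TranslationSum.
Context (R : realType) (G : topologicalGroupType).
Variable mu : {measure set (borel G) -> \bar R}.
Hypotheses (G_hausdorff : hausdorff_space G) (haar : left_haar_measure mu).
Let ipL2 := inner_product_L2 mu.
Let ipE := inner_product_ell2 mu.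
Local Notation lam := (@left_regular R G mu).
Local Notation "`[ x ]" := (hnorm (@ell2_inner _ _ _ mu) x) (format "`[ x ]").
Implicit Types (p q : ell2 mu) (s t : G).

Definition lamE s p : ell2 mu := ell2_map (lam s) p.

Let lam_le s (u : L2 mu) : l2norm (lam s u) <= 1 * l2norm u.
Proof. by rewrite mul1r (left_regular_norm haar). Qed.

Lemma lamEE s p k : lamE s p k = lam s (p k).
Proof. exact: (ell2_mapE ler01 (lam_le s)). Qed.

Lemma lamEM s t p : lamE (s * t)%g p = lamE s (lamE t p).
Proof.
apply: ell2_ext => k.
apply: (eq_trans (lamEE (s * t)%g p k)); apply: (eq_trans (left_regularM haar s t (p k))).
apply: esym; apply: (eq_trans (lamEE s (lamE t p) k)); congr (lam s _); exact: lamEE.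
Qed.

Lemma lamE1 p : lamE 1%g p = p.
Proof. by apply: ell2_ext => k; apply: (eq_trans (lamEE 1%g p k)); exact: left_regular1. Qed.

Lemma lamE_inner s p q : ell2_inner (lamE s p) (lamE s q) = ell2_inner p q.
Proof.
congr complex_series; apply/funext => k.
apply: (eq_trans _ (left_regular_inner haar s (p k) (q k))).
by congr inner; exact: lamEE.
Qed.

Lemma lamE_adjoint s p q : ell2_inner (lamE s p) q = ell2_inner p (lamE s^-1%g q).
Proof. by rewrite -(lamE_inner s p (lamE s^-1%g q)) -(lamEM s s^-1%g q) mulgV lamE1. Qed.

Lemma lamE_norm s p : `[lamE s p] = `[p].
Proof. by rewrite /hnorm lamE_inner. Qed.

Let finite_cvg p s0 (e : R) N : 0 < e ->
  nbhs s0 (fun s => \sum_(k < N) l2norm (lam s (p k) - lam s0 (p k)) ^+ 2 < e).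
Proof.
elim: N e => [|N IH] e e0; first by apply: filterE => s; rewrite big_ord0.
have e2 : 0 < e / 2 by rewrite divr_gt0.
have m0 : 0 < Num.min 1 (e / 2) by rewrite lt_min ltr01.
have h := left_regular_cvg G_hausdorff haar s0 (p N) m0.
apply: (@filterS2 _ (nbhs s0) _ _ _ _ _ (IH _ e2) h) => s h1 h2.
rewrite big_ord_recr /= [ltRHS]splitr ltrD//; move: h2; rewrite lt_min => /andP[h3].
apply: le_lt_trans; rewrite expr2 ler_piMr ?l2norm_ge0// ltW//.
Qed.

Lemma lamE_cvg p s0 (e : R) : 0 < e -> nbhs s0 (fun s => `[lamE s p - lamE s0 p] < e).
Proof.
(* Each term of the difference is at most four times the squared norm of [p k], so this tail
   contributes at most [e^2 / 4]; the finite part is given [e^2 / 2]. *)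
move=> e0; have e4 : 0 < e ^+ 2 / 16 by rewrite divr_gt0// exprn_gt0.
have e2 : 0 < e ^+ 2 / 2 by rewrite divr_gt0// exprn_gt0.
pose sq k := l2norm (p k) ^+ 2.
have [N hN] : exists N, forall n, (N <= n)%N -> \sum_(N <= k < n) sq k <= e ^+ 2 / 16.
  have := @ell2P _ _ _ _ p => cp.
  have /cvgrPdist_lt/(_ _ e4)[N _ hN] := cp.
  exists N => n Nn; have := hN N (leqnn _).
  have : series sq n <= limn (series sq).
    apply: (nondecreasing_cvgn_le _ cp) => m k mk.
    by rewrite /series /= (big_cat_nat (leq0n m) mk) /= lerDl sumr_ge0// => i _; exact: sqr_ge0.
  rewrite /= -/(series sq) ltr_norml => h1 /andP[_ h2].
  have -> : \sum_(N <= k < n) sq k = series sq n - series sq N.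
    by rewrite /series /= (big_cat_nat (leq0n N) Nn) /= addrAC subrr add0r.
  by rewrite (le_trans _ (ltW h2))// lerB.
apply: (@filterS _ (nbhs s0) _ _ _ _ (finite_cvg p s0 N e2)) => s hs.
rewrite -(@ltr_pXn2r _ 2)// ?nnegrE ?hnorm_ge0 ?(ltW e0)//.
apply: (@le_lt_trans _ _ (\sum_(k < N) l2norm (lam s (p k) - lam s0 (p k)) ^+ 2 + e ^+ 2 / 4)).
  pose D k := l2norm (lam s (p k) - lam s0 (p k)) ^+ 2.
  have D4 k : D k <= 4 * sq k.
    have : l2norm (lam s (p k) - lam s0 (p k)) <= 2 * l2norm (p k).
      apply: (@le_trans _ _ (l2norm (lam s (p k)) + l2norm (lam s0 (p k)))).
        exact: (ler_hnormB ipL2).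
      by rewrite (left_regular_norm haar s (p k)) (left_regular_norm haar s0 (p k)) mulr2n mulrDl mul1r.
    move=> h; have -> : 4 * sq k = (2 * l2norm (p k)) ^+ 2 by rewrite exprMn -natrX.
    by rewrite ler_pXn2r// nnegrE ?mulr_ge0 ?l2norm_ge0.
  apply: sqr_ell2norm_le => n.
  rewrite (eq_bigr (fun k : 'I_n => D k)); last first.
    move=> k _; congr (l2norm _ ^+ 2).
    by apply: (eq_trans (ell2B _ _ k)); congr (_ - _); exact: lamEE.
  rewrite -(big_mkord xpredT D) -(big_mkord xpredT (fun k => D k)).
  have D0 k : 0 <= D k by exact: sqr_ge0.
  have [Nn|nN] := leqP N n.
    rewrite (big_cat_nat (leq0n N) Nn) /= lerD2l.
    apply: (@le_trans _ _ (\sum_(N <= k < n) 4 * sq k)); first exact: ler_sum.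
    rewrite -mulr_sumr; have := hN n Nn; lra.
  rewrite [in leRHS](big_cat_nat (leq0n n) (ltnW nN)) /= -addrA lerDl addr_ge0//.
    exact: sumr_ge0.
  by rewrite divr_ge0// sqr_ge0.
move: hs; move: (\sum_(_ < _) _) => X; lra.
Qed.

Lemma nbhs_invg (t : G) (P : set G) : nbhs (t^-1)%g P -> nbhs t (fun s => P s^-1%g).
Proof. exact: (@invg_continuous G t P). Qed.

(** Continuity and compactness give a finite net of translates at scale [1/(m+1)] on each compact
    piece; all nets are then enumerated together. This replaces separability of [L2 mu]. *)
Lemma dense_translates q (C : set G) : sigma_compact C ->
  exists y : nat -> ell2 mu, forall s, C s -> forall e : R, 0 < e ->
    exists k, `[lamE s^-1%g q - y k] < e.
Proof.
move=> [K cK ->].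
have fin n m : exists r : seq G, forall s, K n s ->
    exists2 t, t \in r & `[lamE s^-1%g q - lamE t^-1%g q] < m.+1%:R^-1.
  have m0 : 0 < m.+1%:R^-1 :> R by rewrite invr_gt0.
  pose U t : set G := fun s => `[lamE s^-1%g q - lamE t^-1%g q] < m.+1%:R^-1.
  have Ut t : nbhs t (U t).
    exact: (nbhs_invg (lamE_cvg q t^-1%g m0)).
  have := cK n; rewrite compact_cover => /(_ G (K n) (fun t => (U t)^°)) [].
  - by move=> t _; exact: open_interior.
  - by move=> s Ks; exists s => //; exact: Ut.
  - move=> D _ hD; exists (finmap.enum_fset D) => s /hD[t /= tD /interior_subset Us].
    by exists t.
have /choice[r hr] : forall nm : nat * nat, exists r : seq G, forall s, K nm.1 s ->
    exists2 t, t \in r & `[lamE s^-1%g q - lamE t^-1%g q] < nm.2.+1%:R^-1.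
  by move=> [n m]; exact: fin.
exists (fun j => if unpickle j is Some (n, m, i) then
  lamE (nth 1%g (r (n, m)) i)^-1%g q else 0) => s [n _ Ks] e e0.
have [m /(_ m (leqnn _)) hm] := harmonic_lt e0.
have [t tr h] := hr (n, m) s Ks.
exists (pickle (n, m, index t (r (n, m)))); rewrite pickleK nth_index//.
exact: lt_trans h hm.
Qed.

End TranslationSum.

(** * Finite sums of integrals *)

Section SumIntegral.
Context d (T : measurableType d) (R : realType) (mu : {measure set T -> \bar R}).

Lemma cintegrable_psum (F : nat -> T -> R[i]) n : (forall i, cintegrable mu (F i)) ->
  cintegrable mu (fun x => psum (fun i => F i x) n).
Proof.
move=> iF; elim: n => [|n IH].
  rewrite (_ : (fun x => _) = fun=> 0); last by apply/funext => x; rewrite /psum big_ord0.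
  by split => /=; exact: integrable0.
rewrite (_ : (fun x => _) = fun x => psum (fun i => F i x) n + F n x).
  exact: cintegrableD.
by apply/funext => x; rewrite /psum big_ord_recr.
Qed.

Lemma cint_psum (F : nat -> T -> R[i]) n : (forall i, cintegrable mu (F i)) ->
  psum (fun i => cint mu (F i)) n = cint mu (fun x => psum (fun i => F i x) n).
Proof.
move=> iF; elim: n => [|n IH].
  rewrite /psum big_ord0 (_ : (fun x => _) = fun=> 0); last first.
    by apply/funext => x; rewrite big_ord0.
  by apply: complexP => /=; rewrite /Rintegral integral0.
rewrite psumS IH -cintD//; last exact: cintegrable_psum.
by congr (cint mu); apply/funext => x; rewrite psumS.
Qed.

Lemma cmeasurable_psum (F : nat -> T -> R[i]) n : (forall i, cmeasurable (F i)) ->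
  cmeasurable (fun x => psum (fun i => F i x) n).
Proof. exact: cmeasurable_sum. Qed.

End SumIntegral.

(** * Coefficient functions and products of forms *)

Section Coefficients.
Context (R : realType) (G : topologicalGroupType).
Variable mu : {measure set (borel G) -> \bar R}.
Hypotheses (G_hausdorff : hausdorff_space G) (haar : left_haar_measure mu).
Let ipL2 := inner_product_L2 mu.
Let ipE := inner_product_ell2 mu.
Local Notation lam := (@left_regular R G mu).
Local Notation ipe := (@ell2_inner _ _ _ mu).
Local Notation "`[ x ]" := (hnorm ipe x) (format "`[ x ]").
Implicit Types (p q : ell2 mu) (s t : G).

Definition coef p q : borel G -> R[i] := fun s => ipe p (lamE s q).

Lemma coefE p q s : coef p q s = ipe (lamE s^-1%g p) q.
Proof. by rewrite /coef (lamE_adjoint haar) invgK. Qed.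

Lemma modc_coef_le p q s : modc (coef p q s) <= `[p] * `[q].
Proof. by apply: (le_trans (modc_ip_le ipE _ _)); rewrite (lamE_norm haar). Qed.

Lemma coef_cvg p q s0 (e : R) : 0 < e -> nbhs s0 (fun s => modc (coef p q s0 - coef p q s) < e).
Proof.
move=> e0; have p1 : 0 < `[p] + 1 by rewrite ltr_wpDl// hnorm_ge0.
apply: (@filterS _ (nbhs s0) _ _ _ _ (lamE_cvg G_hausdorff haar q s0 (divr_gt0 e0 p1))) => s.
rewrite ltr_pdivlMr// => h; rewrite /coef -(ipBr ipE).
apply: (le_lt_trans (modc_ip_le ipE _ _)); rewrite (hdistC ipE).
apply: le_lt_trans h; rewrite mulrC ler_wpM2l ?hnorm_ge0//.
by rewrite lerDl.
Qed.

Lemma coef_cbounded p q : cbounded (coef p q).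
Proof.
split; last by exists (`[p] * `[q]) => s; exact: modc_coef_le.
split; apply: continuous_measurable_borel => s0; apply/cvgrPdist_lt => e e0.
  apply: filterS (coef_cvg p q s0 e0) => s; apply: le_lt_trans.
  by rewrite -RecN -RecD modc_Re.
apply: filterS (coef_cvg p q s0 e0) => s; apply: le_lt_trans.
by rewrite -ImcN -ImcD modc_Im.
Qed.

Section Product.
Variable y : nat -> ell2 mu.
Local Notation e := (gram_schmidt ipe y).

Lemma coef_Bessel p s n : \sum_(i < n) modc (coef p (e i) s) ^+ 2 <= `[p] ^+ 2.
Proof.
under eq_bigr do rewrite coefE.
by rewrite -[in leRHS](lamE_norm haar s^-1%g p); exact: Bessel.
Qed.

Lemma coefB_Bessel p s n :
  \sum_(i < n) modc (coef p (e i) s - coef p (e i) 1%g) ^+ 2 <= `[lamE s^-1%g p - p] ^+ 2.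
Proof.
rewrite (eq_bigr (fun i : 'I_n => modc (ipe (lamE s^-1%g p - p) (e i)) ^+ 2)).
  exact: Bessel.
by move=> i _; rewrite coefE (ipBl ipE) /coef lamE1.
Qed.

(** The components along [e] of the function sending [s] to [h(s)] times [lamE s^-1 p]. This
    function is the image of the tensor of [p] and [h] under the unitary that implements the
    coproduct of the group von Neumann algebra. *)
Definition slice p (h : L2 mu) i : L2 mu := cmul (coef p (e i)) h.

Lemma slice_le p h n : \sum_(i < n) l2norm (slice p h i) ^+ 2 <= `[p] ^+ 2 * l2norm h ^+ 2.
Proof.
apply: (sum_sqr_cmul_le (sqr_ge0 _) (fun i => coef_cbounded p (e i))).
by apply: aeW => s _; exact: coef_Bessel.
Qed.

Lemma slice_summable p h : square_summable (slice p h).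
Proof. apply: le_square_summable; exact: slice_le. Qed.

Variables (f : L2 mu) (xi eta : ell2 mu) (C : set G).
Hypothesis f_C : {ae mu, forall s : borel G, ~ C s -> L2_repr f s = 0}.
Hypothesis y_dense : forall s, C s -> forall eps : R, 0 < eps ->
  exists k, `[lamE s^-1%g eta - y k] < eps.

Let ultraweak_lam p q x : ultraweak_form p q (lam x) = ipe (lamE x p) q.
Proof.
congr complex_series; apply/funext => k; congr inner.
by apply: esym; exact: (lamEE haar).
Qed.

Let F x i (s : borel G) : R[i] :=
  coef xi (e i) (ltranslate x s) * L2_repr f (ltranslate x s) *
  (coef eta (e i) s * L2_repr f s)^*%C.

Let fx x (s : borel G) : R[i] := L2_repr f (ltranslate x s) * (L2_repr f s)^*%C.

Let FE x i s : F x i s =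
  fx x s * (coef xi (e i) (ltranslate x s) * (coef eta (e i) s)^*%C).
Proof. by rewrite /F /fx conjcM; ring. Qed.

Let sq1 x i : sq_integrable mu (fun s => coef xi (e i) (ltranslate x s) * L2_repr f (ltranslate x s)).
Proof.
apply: (sq_integrable_ltranslate haar x (h := fun s => coef xi (e i) s * L2_repr f s)).
by apply: sq_integrable_cmul; [exact: coef_cbounded|exact: L2_reprP].
Qed.

Let sq2 i : sq_integrable mu (fun s => coef eta (e i) s * L2_repr f s).
Proof. by apply: sq_integrable_cmul; [exact: coef_cbounded|exact: L2_reprP]. Qed.

Let sqx x : sq_integrable mu (fun s => L2_repr f (ltranslate x s)).
Proof. by apply: sq_integrable_ltranslate => //; exact: L2_reprP. Qed.

Let iF x i : cintegrable mu (F x i).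
Proof. exact: (sq_integrable_pair (sq1 x i) (sq2 i)). Qed.

Let term x i : inner (lam x (slice xi f i)) (slice eta f i) = cint mu (F x i).
Proof.
have bc := coef_cbounded xi (e i).
have E : lam x (slice xi f i) =
    L2_class mu (fun s => coef xi (e i) (ltranslate x s) * L2_repr f (ltranslate x s)).
  apply: (left_regular_class haar x (h := fun s => coef xi (e i) s * L2_repr f s)).
  by apply: sq_integrable_cmul => //; exact: L2_reprP.
by apply: (eq_trans (congr1 (fun u => inner u _) E)); exact: (inner_class (sq1 x i) (sq2 i)).
Qed.

Let F0 x : cint mu (fx x) = inner (lam x f) f.
Proof.
have E : inner (lam x f) (L2_class mu (L2_repr f)) = cint mu (fx x).
  exact: (inner_class (sqx x) (L2_reprP f)).
by rewrite -E L2_reprK.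
Qed.

(** Parseval for [lamE s^-1 eta], which the sequence [y] approximates when [s] is in [C]. Invariance
    of the inner product under translation makes the resulting scalar independent of [s]. *)
Let F_cvg x : {ae mu, forall s : borel G,
  ccvg (fun n => psum (fun i => F x i s) n) (ipe (lamE x xi) eta * fx x s)}.
Proof.
apply: filterS f_C => s fC.
have [Cs|Cs] := pselect (C s); last first.
  rewrite /fx fC// conjc0 !mulr0 => eps eps0; exists 0%N => n _.
  by rewrite /psum big1 ?subrr ?modc0// => i _; rewrite FE /fx fC// conjc0 mulr0 mul0r.
have h : ccvg (psum (fun i => ipe (lamE (ltranslate x s)^-1%g xi) (e i) *
      (ipe (lamE s^-1%g eta) (e i))^*%C)) (ipe (lamE (ltranslate x s)^-1%g xi) (lamE s^-1%g eta)).
  exact: @Parseval _ _ _ ipE y (lamE s^-1%g eta) (lamE (ltranslate x s)^-1%g xi) (y_dense Cs).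
have E : ipe (lamE (ltranslate x s)^-1%g xi) (lamE s^-1%g eta) = ipe (lamE x xi) eta.
  have -> : (ltranslate x s)^-1%g = (s^-1 * x)%g by rewrite /ltranslate invgM invgK.
  apply: eq_trans (lamE_inner haar s^-1%g (lamE x xi) eta).
  exact: (congr1 (fun u => ipe u (lamE s^-1%g eta)) (lamEM haar s^-1%g x xi)).
have {}h : ccvg (psum (fun i => coef xi (e i) (ltranslate x s) * (coef eta (e i) s)^*%C))
    (ipe (lamE x xi) eta).
  rewrite -E; apply: eq_ccvg h => n; apply: eq_bigr => i _.
  exact: (congr2 (fun a b => a * b^*%C) (esym (coefE xi (e i) (ltranslate x s)))
    (esym (coefE eta (e i) s))).
rewrite [X in ccvg _ X]mulrC; apply: eq_ccvg (ccvgZ (fx x s) h) => n.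
by rewrite -psumZ; apply: eq_bigr => i _; rewrite FE.
Qed.

(** Bessel in both arguments gives a bound uniform in [n], the dominating function for
    [slice_product]. *)
Let F_le x n s : modc (psum (fun i => F x i s) n) <=
  (`[xi] ^+ 2 + `[eta] ^+ 2) * (modc (L2_repr f (ltranslate x s)) ^+ 2 + modc (L2_repr f s) ^+ 2).
Proof.
have -> : psum (fun i => F x i s) n =
    fx x s * psum (fun i => coef xi (e i) (ltranslate x s) * (coef eta (e i) s)^*%C) n.
  by rewrite -psumZ; apply: eq_bigr => i _; rewrite FE.
have mul_le (a b : R) : 0 <= a -> 0 <= b -> a * b <= a ^+ 2 + b ^+ 2.
  move=> a0 b0; rewrite -subr_ge0 [leRHS](_ : _ = (a - b) ^+ 2 + a * b); last by ring.
  by rewrite addr_ge0 ?sqr_ge0 ?mulr_ge0.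
rewrite modcM mulrC; apply: ler_pM; rewrite ?modc_ge0//.
  apply: (le_trans (ler_modc_sum _ _)).
  apply: (le_trans _ (lerD (coef_Bessel xi (ltranslate x s) n) (coef_Bessel eta s n))).
  rewrite -big_split; apply: ler_sum => i _; rewrite modcM modcJ.
  by apply: mul_le; exact: modc_ge0.
by rewrite /fx modcM modcJ; apply: mul_le; exact: modc_ge0.
Qed.

(** Dominated convergence exchanges the sum over [i] with the integral. Summed over the forms that
    represent a state [v], this yields the product of [v] with the vector state of [f]. *)
Lemma slice_product x : ultraweak_form (slice xi f) (slice eta f) (lam x) =
  ultraweak_form xi eta (lam x) * inner (lam x f) f.
Proof.
rewrite ultraweak_lam -F0; apply: complex_seriesE.
have ifx : cintegrable mu (fx x) := sq_integrable_pair (sqx x) (L2_reprP f).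
have mfx : cmeasurable (fx x).
  apply: cmeasurableM; first exact: sq_integrable_measurable (sqx x).
  by apply: cmeasurableJ; exact/sq_integrable_measurable/L2_reprP.
rewrite -cintZ//.
have mF i : cmeasurable (F x i).
  apply: cmeasurableM; first exact: sq_integrable_measurable (sq1 x i).
  by apply: cmeasurableJ; exact: sq_integrable_measurable (sq2 i).
have ig : mu.-integrable [set: borel G] (EFin \o (fun s => (`[xi] ^+ 2 + `[eta] ^+ 2) *
    (modc (L2_repr f (ltranslate x s)) ^+ 2 + modc (L2_repr f s) ^+ 2))).
  have h := integrableD measurableT (sq_integrable_modc2 (sqx x)) (sq_integrable_modc2 (L2_reprP f)).
  have := integrableZl measurableT (`[xi] ^+ 2 + `[eta] ^+ 2) h.
  by under eq_fun do rewrite /= -EFinD -EFinM.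
have mF0 : cmeasurable (fun s : borel G => ipe (lamE x xi) eta * fx x s).
  by apply: cmeasurableM => //; exact: cmeasurable_cst.
have := @cint_dominated_cvg _ _ _ mu (fun n s => psum (fun i => F x i s) n)
  (fun s : borel G => ipe (lamE x xi) eta * fx x s) _ (fun n => cmeasurable_psum n mF)
  mF0 (F_cvg x) ig (F_le x).
apply: eq_ccvg => n; rewrite -cint_psum; last exact: iF.
by apply: eq_bigr => i _; exact: esym (term x i).
Qed.

(** * Slices of vectors close to a localized one *)

Section Estimate.
Variables (f0 : L2 mu) (V : set G) (r : R) (S : L2 mu -> L2 mu).
Hypotheses (C1 : C 1%g) (r0 : 0 <= r).
Hypothesis f0_V : {ae mu, forall s : borel G, L2_repr f0 s <> 0 -> V s}.
Hypothesis V_xi : forall s, V s -> `[lamE s^-1%g xi - xi] <= r.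
Hypothesis V_eta : forall s, V s -> `[lamE s^-1%g eta - eta] <= r.
Hypotheses (Sl : hlinear S) (S1 : forall u : L2 mu, l2norm (S u) <= l2norm u).

(** A bound for the distance in the Hilbert sum between the slices of [p] along [f] and constant
    multiples of [f]. With [f] split into [f0] and [f - f0], the coefficients vary by at most [r]
    where [f0] lives and by at most [2 |p|] elsewhere; the factor 2 from the square of a sum gives
    the constants 2 and 8. *)
Definition slice_error p : R :=
  Num.sqrt (2 * (r ^+ 2 * l2norm f0 ^+ 2) + 8 * `[p] ^+ 2 * l2norm (f - f0) ^+ 2).

Let dc p i : borel G -> R[i] := fun s => coef p (e i) s - coef p (e i) 1%g.

Let dc_bounded p i : cbounded (dc p i).
Proof. by apply: cboundedB; [exact: coef_cbounded|exact: cbounded_cst]. Qed.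

Let sliceB p i : slice p f i - coef p (e i) 1%g *: f = cmul (dc p i) f.
Proof.
rewrite -(cmul_cst (coef p (e i) 1%g) f); apply: cmulB; first exact: coef_cbounded.
exact: cbounded_cst.
Qed.

Let sum2_split n (A B : nat -> R) : \sum_(i < n) (2 * A i + 2 * B i) =
  2 * \sum_(i < n) A i + 2 * \sum_(i < n) B i.
Proof. by rewrite big_split -!mulr_sumr. Qed.

Let arith_le (A B x a b : R) : A <= x -> B <= (2 * a) ^+ 2 * b ->
  2 * A + 2 * B <= 2 * x + 8 * a ^+ 2 * b.
Proof. by rewrite exprMn; move: (a ^+ 2) => d; lra. Qed.

Let add_sqr_le (u v w : L2 mu) : u = v + w ->
  l2norm u ^+ 2 <= 2 * l2norm v ^+ 2 + 2 * l2norm w ^+ 2.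
Proof. by move=> ->; rewrite -(parallelogram ipL2 v w) lerDl sqr_ge0. Qed.

Let sliceB_le p : (forall s, V s -> `[lamE s^-1%g p - p] <= r) ->
  forall n, \sum_(i < n) l2norm (slice p f i - coef p (e i) 1%g *: f) ^+ 2 <= slice_error p ^+ 2.
Proof.
move=> Vp n; rewrite sqr_sqrtr; last first.
  by apply: addr_ge0; apply: mulr_ge0; rewrite ?sqr_ge0// mulr_ge0 ?sqr_ge0.
have h0 : \sum_(i < n) l2norm (cmul (dc p i) f0) ^+ 2 <= r ^+ 2 * l2norm f0 ^+ 2.
  apply: (sum_sqr_cmul_le (sqr_ge0 r) (dc_bounded p)).
  apply: filterS f0_V => s hs /hs/Vp h; apply: (le_trans (coefB_Bessel p s n)).
  by rewrite ler_pXn2r// nnegrE hnorm_ge0.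
have h1 : \sum_(i < n) l2norm (cmul (dc p i) (f - f0)) ^+ 2 <=
    (2 * `[p]) ^+ 2 * l2norm (f - f0) ^+ 2.
  apply: (sum_sqr_cmul_le (sqr_ge0 _) (dc_bounded p)).
  apply: aeW => s _; apply: (le_trans (coefB_Bessel p s n)).
  rewrite ler_pXn2r// ?nnegrE ?mulr_ge0 ?hnorm_ge0//.
  apply: (le_trans (ler_hnormB ipE _ _)); rewrite (lamE_norm haar s^-1%g p).
  by rewrite mulr2n mulrDl mul1r.
have step i : l2norm (slice p f i - coef p (e i) 1%g *: f) ^+ 2 <=
    2 * l2norm (cmul (dc p i) f0) ^+ 2 + 2 * l2norm (cmul (dc p i) (f - f0)) ^+ 2.
  have E : cmul (dc p i) f = cmul (dc p i) f0 + cmul (dc p i) (f - f0).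
    by rewrite (hlinearB f f0 (cmul_linear (dc_bounded p i))) addrC subrK.
  exact: (add_sqr_le (eq_trans (sliceB p i) E)).
pose A i := l2norm (cmul (dc p i) f0) ^+ 2; pose B i := l2norm (cmul (dc p i) (f - f0)) ^+ 2.
have h2 : \sum_(i < n) l2norm (slice p f i - coef p (e i) 1%g *: f) ^+ 2 <=
    \sum_(i < n) (2 * A i + 2 * B i) by apply: ler_sum => i _; exact: (step i).
apply: (le_trans h2); rewrite (sum2_split n A B); exact: arith_le h0 h1.
Qed.

Let al p : ell2 mu := ell2_of (slice p f).
Let al0 p : ell2 mu := ell2_of (fun i => coef p (e i) 1%g *: f).

Let alE p i : al p i = slice p f i.
Proof. by rewrite (ell2_ofK (@slice_summable p f)). Qed.

Let al0_le p n : \sum_(i < n) l2norm (coef p (e i) 1%g *: f) ^+ 2 <= (`[p] * l2norm f) ^+ 2.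
Proof.
under eq_bigr do rewrite l2normZ exprMn.
by rewrite -mulr_suml exprMn ler_wpM2r ?sqr_ge0//; exact: coef_Bessel.
Qed.

Let al0E p i : al0 p i = coef p (e i) 1%g *: f.
Proof.
have h : square_summable (fun i => coef p (e i) 1%g *: f).
  by apply: le_square_summable; exact: al0_le.
by rewrite (ell2_ofK h).
Qed.

Let le_norm p (B : R) : 0 <= B -> (forall n, \sum_(i < n) l2norm (p i) ^+ 2 <= B ^+ 2) -> `[p] <= B.
Proof.
move=> B0 h; rewrite -(@ler_pXn2r _ 2)// ?nnegrE ?hnorm_ge0//.
exact: sqr_ell2norm_le.
Qed.

Let al_norm p : `[al p] <= `[p] * l2norm f.
Proof.
apply: le_norm; first by rewrite mulr_ge0 ?hnorm_ge0.
by move=> n; under eq_bigr do rewrite alE; rewrite exprMn; exact: slice_le.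
Qed.

Let al0_norm p : `[al0 p] <= `[p] * l2norm f.
Proof.
apply: le_norm; first by rewrite mulr_ge0 ?hnorm_ge0.
by move=> n; under eq_bigr do rewrite al0E; exact: al0_le.
Qed.

Let alB_norm p : (forall s, V s -> `[lamE s^-1%g p - p] <= r) -> `[al p - al0 p] <= slice_error p.
Proof.
move=> Vp; apply: le_norm; first exact: sqrtr_ge0.
move=> n; rewrite (eq_bigr (fun i : 'I_n => l2norm (slice p f i - coef p (e i) 1%g *: f) ^+ 2)).
  exact: sliceB_le.
move=> i _; congr (l2norm _ ^+ 2); apply: (eq_trans (ell2B _ _ i)).
by congr (_ - _); [exact: alE|exact: al0E].
Qed.

Let S1' (u : L2 mu) : l2norm (S u) <= 1 * l2norm u. Proof. by rewrite mul1r. Qed.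
Let mapS p : ell2 mu := ell2_map S p.
Let mapSE p i : mapS p i = S (p i). Proof. exact: (ell2_mapE ler01 S1'). Qed.
Let mapS_le p : `[mapS p] <= `[p].
Proof. by have := ell2_map_le ler01 S1' p; rewrite mul1r. Qed.

Let mapSB p q : mapS (p - q) = mapS p - mapS q.
Proof.
apply: ell2_ext => i; apply: (eq_trans (mapSE (p - q) i)).
apply: (eq_trans (hlinearB (p i) (q i) Sl)); apply: esym.
by apply: (eq_trans (ell2B _ _ i)); congr (_ - _); exact: mapSE.
Qed.

Let form_al : ultraweak_form (slice xi f) (slice eta f) S = ipe (mapS (al xi)) (al eta).
Proof.
congr complex_series; apply/funext => i; congr inner; last exact: esym (alE eta i).
by apply: esym; apply: (eq_trans (mapSE _ i)); congr S; exact: alE.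
Qed.

(** For the constant families the sum over [i] is Parseval at the identity; this is where [C1]
    enters. *)
Let form_al0 : ipe (mapS (al0 xi)) (al0 eta) = ipe xi eta * inner (S f) f.
Proof.
apply: complex_seriesE; rewrite mulrC.
have y1 (eps : R) : 0 < eps -> exists k, `[eta - y k] < eps.
  by move=> /(y_dense C1)[k hk]; exists k; move: hk; rewrite invg1 (lamE1 haar).
have h : ccvg (psum (fun i => ipe xi (e i) * (ipe eta (e i))^*%C)) (ipe xi eta).
  exact: @Parseval _ _ _ ipE y eta xi y1.
apply: eq_ccvg (ccvgZ (inner (S f) f) h) => n; rewrite -psumZ; apply: eq_bigr => i _.
have c1 p : coef p (e i) 1%g = ipe p (e i) by rewrite /coef (lamE1 haar).
apply: esym; apply: (eq_trans (y := inner (S (coef xi (e i) 1%g *: f)) (coef eta (e i) 1%g *: f))).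
  congr inner; last exact: al0E.
  by apply: (eq_trans (mapSE _ i)); congr S; exact: al0E.
rewrite (hlinearZ _ _ Sl) (ipZl ipL2) (ipZr ipL2) !c1; ring.
Qed.

Let form_split (a a0 b b0 : ell2 mu) : ipe (mapS a) b - ipe (mapS a0) b0 =
  ipe (mapS (a - a0)) b + ipe (mapS a0) (b - b0).
Proof.
have E1 : ipe (mapS (a - a0)) b = ipe (mapS a) b - ipe (mapS a0) b.
  by apply: (eq_trans (congr1 (fun u => ipe u b) (mapSB a a0))); exact: (ipBl ipE).
have E2 : ipe (mapS a0) (b - b0) = ipe (mapS a0) b - ipe (mapS a0) b0 by exact: (ipBr ipE).
by apply: esym; apply: (eq_trans (congr2 +%R E1 E2)); exact: subrKA.
Qed.

Let form_dist (a a0 b b0 : ell2 mu) (k1 k2 k3 k4 : R) : `[a - a0] <= k1 -> `[b] <= k2 ->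
  `[a0] <= k3 -> `[b - b0] <= k4 ->
  modc (ipe (mapS a) b - ipe (mapS a0) b0) <= k1 * k2 + k3 * k4.
Proof.
move=> h1 h2 h3 h4; rewrite form_split; apply: (le_trans (ler_modcD _ _)); apply: lerD.
  exact: (le_trans (modc_ip_le ipE _ _)
    (ler_pM (hnorm_ge0 _ _) (hnorm_ge0 _ _) (le_trans (mapS_le _) h1) h2)).
exact: (le_trans (modc_ip_le ipE _ _)
  (ler_pM (hnorm_ge0 _ _) (hnorm_ge0 _ _) (le_trans (mapS_le _) h3) h4)).
Qed.

(** Both families are compared as vectors of the Hilbert sum, on which [S] acts componentwise as a
    contraction; the bound is therefore uniform in [S]. *)
Lemma slice_estimate :
  modc (ultraweak_form (slice xi f) (slice eta f) S - ipe xi eta * inner (S f) f) <=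
  (slice_error xi * `[eta] + `[xi] * slice_error eta) * l2norm f.
Proof.
have h := form_dist (alB_norm V_xi) (al_norm eta) (al0_norm xi) (alB_norm V_eta).
rewrite form_al -form_al0; apply: (le_trans h).
by rewrite mulrDl mulrA [`[xi] * _ * _]mulrAC.
Qed.

End Estimate.
End Product.
End Coefficients.

(** * Functionals vanishing on a common kernel *)

Section LinearFunctionals.
Context (K : fieldType) (V : lmodType K).

(** Linearity is asked on [M] only, because the values of a [functional] count on [VN mu] alone. The
    induction restricts to the kernel of the last functional, then corrects by one coefficient. *)
Lemma linear_functional_span n (M : set V) (phi : 'I_n -> V -> K) (v : V -> K) :
  M 0 -> (forall a x y, M x -> M y -> M (a *: x + y)) ->
  (forall i a x y, M x -> M y -> phi i (a *: x + y) = a * phi i x + phi i y) ->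
  (forall a x y, M x -> M y -> v (a *: x + y) = a * v x + v y) ->
  (forall x, M x -> (forall i, phi i x = 0) -> v x = 0) ->
  exists c : 'I_n -> K, forall x, M x -> v x = \sum_(i < n) c i * phi i x.
Proof.
elim: n M phi v => [|n IH] M phi v M0 Ml phil vl ker.
  exists (fun=> 0) => x Mx; rewrite big_ord0; apply: ker => // -[].
  by [].
pose f := phi ord_max; pose psi (i : 'I_n) := phi (widen_ord (leqnSn n) i).
pose M' := [set x | M x /\ f x = 0].
have f0 : f 0 = 0.
  have := phil ord_max (-1) 0 0 M0 M0; rewrite scaler0 addr0 mulN1r addNr; exact.
have [c hc] : exists c : 'I_n -> K, forall x, M' x -> v x = \sum_(i < n) c i * psi i x.
  apply: IH => //.
  - move=> a x y [Mx fx] [My fy]; split; first exact: Ml.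
    by rewrite /f phil// -/f fx fy mulr0 addr0.
  - by move=> i a x y [Mx _] [My _]; exact: phil.
  - by move=> a x y [Mx _] [My _]; exact: vl.
  - move=> x [Mx fx] px; apply: ker => // i.
    have [j ->|->//] := unliftP ord_max i.
    have := px j; rewrite /psi => h; rewrite -[RHS]h; congr (phi _ x).
    by apply: val_inj; rewrite /= /bump leqNgt ltn_ord.
pose v' x := v x - \sum_(i < n) c i * psi i x.
pose ext (k : K) (i : 'I_n.+1) := if unlift ord_max i is Some j then c j else k.
have sumE k x : \sum_(i < n.+1) ext k i * phi i x = \sum_(i < n) c i * psi i x + k * f x.
  rewrite big_ord_recr /=; congr (_ + _); last by rewrite /ext unlift_none.
  apply: eq_bigr => i _; congr (_ * _); rewrite /ext.
  have -> : widen_ord (leqnSn n) i = lift ord_max i.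
    by apply: val_inj; rewrite /= /bump leqNgt ltn_ord.
  by rewrite liftK.
have [fM|/existsNP[z /not_implyP[Mz /eqP fz]]] := pselect (forall x, M x -> f x = 0).
  exists (ext 0) => x Mx; rewrite sumE mul0r addr0; apply: hc; split => //; exact: fM.
exists (ext (v' z / f z)) => x Mx; rewrite sumE.
pose t := f x / f z.
have My : M (- t *: z + x) by exact: Ml.
have : M' (- t *: z + x).
  by split => //; rewrite /f phil// -/f mulNr divfK// addNr.
move=> /hc; rewrite vl// (eq_bigr (fun i : 'I_n => - t * (c i * psi i z) + c i * psi i x)); last first.
  by move=> i _; rewrite /psi phil//; ring.
rewrite big_split /= -mulr_sumr => h.
have -> : v x = t * v z + (- t * \sum_(i < n) c i * psi i z + \sum_(i < n) c i * psi i x).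
  by rewrite -h; ring.
by rewrite /v' /t; field.
Qed.

End LinearFunctionals.

(** A scalar identity: [D a] stands for the value of a sesquilinear form at [a x + y], and [B] for
    its value at the pair of [x] and [y]. *)
Lemma polarization (R : realType) (A B C E : R[i]) :
  let i : R[i] := Complex 0 1 in
  let D a := (modc a ^+ 2)%:C%C * A + a * B + (a^*%C * C + E) in
  B = (4^-1)%:C%C * (D 1 + (-1) * D (-1) + ((- i) * D i + i * D (- i))).
Proof.
move=> i D.
have ii : i * i = -1 by apply: complexP => /=; ring.
have ci : i^*%C = - i by apply: complexP => /=; rewrite ?oppr0.
have cn : (- i)^*%C = i by rewrite conjcN ci opprK.
have c1 : (1 : R[i])^*%C = 1 by exact: conjc1.
have mi : modc i = 1 by rewrite /modc /= expr0n expr1n add0r sqrtr1.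
rewrite /D !modcN modc1 mi ci cn conjcN c1 expr1n rmorph1.
have -> : (4^-1)%:C%C = (4%:R : R[i])^-1 by rewrite fmorphV rmorph_nat.
have n4 : (4%:R : R[i]) != 0 by rewrite pnatr_eq0.
apply: (mulfI n4); rewrite [RHS]mulrA mulfV// mul1r.
transitivity (2 * B + 2 * C - i * i * 2 * B + i * i * 2 * C); last by ring.
by rewrite ii; ring.
Qed.

(** * Ultraweak forms and the Fourier algebra *)

Section FourierAlgebra.
Context (R : realType) (G : topologicalGroupType).
Variable mu : {measure set (borel G) -> \bar R}.
Hypothesis haar : left_haar_measure mu.
Let ipL2 := inner_product_L2 mu.
Let ipE := inner_product_ell2 mu.
Local Notation lam := (@left_regular R G mu).
Local Notation ipe := (@ell2_inner _ _ _ mu).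
Local Notation "`[ x ]" := (hnorm ipe x) (format "`[ x ]").
Implicit Types (p q : ell2 mu) (S Q : L2 mu -> L2 mu).

Lemma VN_bounded S : VN mu S -> bounded_operator S. Proof. by case. Qed.

Lemma VN_left_regular x : VN mu (lam x).
Proof.
split; first exact: left_regular_bounded.
by move=> Q [_ hQ]; rewrite hQ//; exists x.
Qed.

Lemma VN_id : VN mu id.
Proof.
split; last by move=> Q _.
by split => //; exists 1 => f; rewrite mul1r.
Qed.

Lemma VN_linear a S Q : VN mu S -> VN mu Q -> VN mu (a *: S + Q).
Proof.
move=> [bS cS] [bQ cQ]; split.
  have [Sl _] := bS; have [Ql _] := bQ.
  have [M M0 hM] := hbounded_gt0 bS; have [N N0 hN] := hbounded_gt0 bQ; split.
    move=> b f g; have E h : (a *: S + Q) h = a *: S h + Q h by [].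
    by rewrite !E Sl Ql !scalerDr !scalerA [a * b]mulrC addrACA.
  exists (modc a * M + N) => f; have -> : (a *: S + Q) f = a *: S f + Q f by [].
  apply: (le_trans (ler_l2normD _ _)); rewrite l2normZ mulrDl; apply: lerD; last exact: hN.
  by rewrite -mulrA ler_wpM2l ?modc_ge0//; exact: hM.
move=> A hA; apply/funext => f; have [[Al _] _] := hA.
have SA : S (A f) = A (S f) by have /(congr1 (fun F => F f)) := cS A hA.
have QA : Q (A f) = A (Q f) by have /(congr1 (fun F => F f)) := cQ A hA.
have -> : ((a *: S + Q) \o A) f = a *: S (A f) + Q (A f) by [].
by rewrite SA QA -Al.
Qed.

Lemma VN0 : VN mu 0.
Proof.
have := VN_linear (-1) VN_id VN_id; rewrite scaleN1r addNr; exact.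
Qed.

Lemma ultraweak_formZD a S Q p q : bounded_operator S -> bounded_operator Q ->
  ultraweak_form p q (a *: S + Q) = a * ultraweak_form p q S + ultraweak_form p q Q.
Proof.
move=> bS bQ; apply: complex_seriesE.
have hS := ultraweak_form_cvg p q bS; have hQ := ultraweak_form_cvg p q bQ.
apply: eq_ccvg (ccvgD (ccvgZ a hS) hQ) => n; rewrite -psumZ -psumD; apply: eq_bigr => k _.
apply: esym; apply: (eq_trans (ipDl ipL2 (a *: S (p k)) (Q (p k)) (q k))).
by congr (_ + _); exact: (ipZl ipL2).
Qed.

Lemma ultraweak_form_id p q : ultraweak_form p q id = ipe p q.
Proof. by []. Qed.

Lemma ultraweak_form_ge0 p S : bounded_operator S -> positive_operator S ->
  0 <= ultraweak_form p p S.
Proof.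
move=> bS S0; have h := ultraweak_form_cvg p p bS.
have re n : 0 <= complex.Re (psum (fun k => inner (S (p k)) (p k)) n).
  rewrite /psum Rec_sum sumr_ge0// => k _.
  by have := S0 (p k); rewrite lecE => /andP[].
have im n : complex.Im (psum (fun k => inner (S (p k)) (p k)) n) = 0.
  rewrite /psum Imc_sum big1// => k _.
  by have := S0 (p k); rewrite lecE => /andP[/eqP].
rewrite lecE; apply/andP; split; last exact: (ccvg_Re_ge (N := 0%N) (fun n _ => re n) h).
have := ccvg_Im h; under eq_fun do rewrite im; move=> hc.
by apply/eqP/esym/(cvg_unique _ _ hc); [exact: norm_hausdorff|exact: cvg_cst].
Qed.

Let ultraweak_continuousZ p (k : R) (phi : functional mu) : 0 < k ->
  (forall S, VN mu S -> phi S = (k^-1)%:C%C * ultraweak_form p p S) ->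
  ultraweakly_continuous (VN mu) phi.
Proof.
move=> k0 hphi S0 VS0 eps eps0.
exists 1%N, (fun=> p), (fun=> p); split.
  by move=> i; split; exact: ell2P.
exists (k * eps); first by rewrite mulr_gt0.
move=> S VS /(_ ord0) h; rewrite !hphi// -mulrBr modcM modc_real gtr0_norm ?invr_gt0//.
rewrite mulrC ltr_pdivrMr// mulrC.
have -> // : ultraweak_form p p S - ultraweak_form p p S0 = ultraweak_form p p (S - S0).
have := ultraweak_formZD (-1) p p (VN_bounded VS0) (VN_bounded VS).
by rewrite scaleN1r mulN1r [- S0 + S]addrC => ->; rewrite addrC.
Qed.

Lemma P1_normalized p : 0 < `[p] ->
  P1 (fun S => ((`[p] ^+ 2)^-1)%:C%C * ultraweak_form p p S).
Proof.
move=> p0; have p2 : 0 < `[p] ^+ 2 by rewrite exprn_gt0.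
split.
- move=> a S Q VS VQ; rewrite ultraweak_formZD; [ring|exact: VN_bounded|exact: VN_bounded].
- move=> S VS S0; rewrite mulr_ge0//; first by rewrite ler0c invr_ge0 ltW.
  by apply: ultraweak_form_ge0 => //; exact: VN_bounded.
- by rewrite ultraweak_form_id (ipxx ipE) -rmorphM mulVf ?rmorph1// gt_eqF.
- exact: (ultraweak_continuousZ p2).
Qed.

Lemma fourier_algebraD (w w' : functional mu) : fourier_algebra w -> fourier_algebra w' ->
  fourier_algebra (fun S => w S + w' S).
Proof.
move=> [n [c [u [uP wE]]]] [n' [c' [u' [uP' wE']]]].
exists (n + n')%N, (fun i => match fintype.split i with inl j => c j | inr j => c' j end),
  (fun i => match fintype.split i with inl j => u j | inr j => u' j end); split.
  by move=> i; case: (fintype.split i).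
have El (i : 'I_n) : fintype.split (lshift n' i) = inl i := unsplitK (inl i).
have Er (i : 'I_n') : fintype.split (rshift n i) = inr i := unsplitK (inr i).
move=> S VS; rewrite big_split_ord wE// wE'//; congr (_ + _); apply: eq_bigr => i _.
  by rewrite El.
by rewrite Er.
Qed.

Lemma fourier_algebraZ a (w : functional mu) : fourier_algebra w ->
  fourier_algebra (fun S => a * w S).
Proof.
move=> [n [c [u [uP wE]]]]; exists n, (fun i => a * c i), u; split => // S VS.
by rewrite wE// mulr_sumr; apply: eq_bigr => i _; rewrite mulrA.
Qed.

Lemma eq_fourier_algebra (w w' : functional mu) : (forall S, VN mu S -> w' S = w S) ->
  fourier_algebra w -> fourier_algebra w'.
Proof.
move=> ww [n [c [u [uP wE]]]]; exists n, c, u; split => // S VS.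
by rewrite ww// wE.
Qed.

Lemma fourier_algebra0 : fourier_algebra ((fun=> 0) : functional mu).
Proof.
exists 0%N, (fun=> 0), (fun=> fun=> 0); split; first by case.
by move=> S _; rewrite big_ord0.
Qed.

Lemma fourier_algebra_sum n (w : 'I_n -> functional mu) : (forall i, fourier_algebra (w i)) ->
  fourier_algebra (fun S => \sum_(i < n) w i S).
Proof.
elim: n w => [|n IH] w hw.
  apply: eq_fourier_algebra fourier_algebra0 => S _; exact: big_ord0.
apply: (@eq_fourier_algebra (fun S => \sum_(i < n) w (widen_ord (leqnSn n) i) S + w ord_max S)).
  by move=> S _; rewrite big_ord_recr.
by apply: fourier_algebraD => //; apply: IH.
Qed.

Let fourier_algebra_diag p : fourier_algebra (fun S => ultraweak_form p p S).
Proof.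
have [p0|/eqP p0] := eqVneq `[p] 0.
  apply: eq_fourier_algebra fourier_algebra0 => S VS.
  rewrite (ultraweak_formE p p (VN_bounded VS)).
  have p00 : p = 0 by exact: (hnorm_eq0 ipE).
  by apply: (eq_trans (congr1 (fun q => ipe (ell2_map S p) q) p00)); exact: (ip0r ipE).
have pp : 0 < `[p] by rewrite lt_def hnorm_ge0 andbT; exact/eqP.
have p2 : `[p] ^+ 2 != 0 by rewrite expf_neq0//; exact/eqP.
exists 1%N, (fun=> (`[p] ^+ 2)%:C%C), (fun=> fun S => ((`[p] ^+ 2)^-1)%:C%C * ultraweak_form p p S).
split; first by move=> _; exact: P1_normalized.
by move=> S VS; rewrite big_ord1 mulrA -rmorphM mulfV// rmorph1 mul1r.
Qed.

Let mapZD S a p q : bounded_operator S -> ell2_map S (a *: p + q) = a *: ell2_map S p + ell2_map S q.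
Proof.
move=> bS; have [M M0 hM] := hbounded_gt0 bS; apply: ell2_ext => k.
have E r : ell2_map S r k = S (r k) := ell2_mapE (ltW M0) hM r k.
apply: (eq_trans (E _)); apply: (eq_trans (bS.1 a (p k) (q k))).
by congr (_ *: _ + _); exact: esym (E _).
Qed.

Let diagZD S a p q : bounded_operator S ->
  ultraweak_form (a *: p + q) (a *: p + q) S =
  (modc a ^+ 2)%:C%C * ultraweak_form p p S + a * ultraweak_form p q S +
  (a^*%C * ultraweak_form q p S + ultraweak_form q q S).
Proof.
move=> bS; rewrite !(ultraweak_formE _ _ bS).
apply: (eq_trans (congr1 (fun r => ipe r (a *: p + q)) (mapZD a p q bS))).
exact: (ip_comb ipE).
Qed.

(** Polarization reduces to four diagonal forms, each a nonnegative multiple of a normal state. *)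
Lemma fourier_algebra_ultraweak p q : fourier_algebra (fun S => ultraweak_form p q S).
Proof.
pose D r : functional mu := fun S => ultraweak_form r r S.
pose i : R[i] := Complex 0 1.
apply: (@eq_fourier_algebra (fun S =>
  (4^-1)%:C%C * (D (1 *: p + q) S + (-1) * D ((-1) *: p + q) S +
  ((- i) * D (i *: p + q) S + i * D ((- i) *: p + q) S)))).
  move=> S VS; have bS := VN_bounded VS; rewrite /D !(diagZD _ p q bS).
  exact: polarization.
apply: fourier_algebraZ; apply: fourier_algebraD; apply: fourier_algebraD.
- exact: fourier_algebra_diag.
- by apply: fourier_algebraZ; exact: fourier_algebra_diag.
- by apply: fourier_algebraZ; exact: fourier_algebra_diag.
- by apply: fourier_algebraZ; exact: fourier_algebra_diag.
Qed.

(** Continuity at 0 bounds [v] by 1 on a set cut out by finitely many forms. On their common kernel,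
    scaling forces [v] to vanish, and linear algebra concludes. *)
Lemma normal_state_ultraweak (v : functional mu) : P1 v ->
  exists (n : nat) (a : 'I_n -> R[i]) (p q : 'I_n -> ell2 mu),
    forall S, VN mu S -> v S = \sum_(i < n) a i * ultraweak_form (p i) (q i) S.
Proof.
move=> [vl _ _ vc].
have [n [f [g [fg [c c0 hc]]]]] := vc 0 VN0 1 ltr01.
pose p i := ell2_of (f i); pose q i := ell2_of (g i).
have pf i : p i = f i :> (nat -> L2 mu) by apply: ell2_ofK; case: (fg i).
have qg i : q i = g i :> (nat -> L2 mu) by apply: ell2_ofK; case: (fg i).
have v0 : v 0 = 0.
  have := vl (-1) 0 0 VN0 VN0; rewrite scaler0 addr0 mulN1r addNr; exact.
have [a ha] : exists a : 'I_n -> R[i], forall S, VN mu S ->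
    v S = \sum_(i < n) a i * ultraweak_form (p i) (q i) S.
  apply: (linear_functional_span (M := VN mu) (phi := fun i S => ultraweak_form (p i) (q i) S)).
  - exact: VN0.
  - by move=> b x y; exact: VN_linear.
  - move=> i b x y Vx Vy; apply: ultraweak_formZD; exact: VN_bounded.
  - exact: vl.
  - move=> S VS hS; apply/modc_eq0/eqP; rewrite eq_le modc_ge0 andbT.
    apply/ler_addgt0Pr => e e0; rewrite add0r.
    have VeS : VN mu ((e^-1)%:C%C *: S) by rewrite -[_ *: S]addr0; apply: VN_linear => //; exact: VN0.
    have := hc _ VeS; rewrite v0 !subr0.
    have -> : v ((e^-1)%:C%C *: S) = (e^-1)%:C%C * v S.
      by rewrite -[_ *: S]addr0 vl ?v0 ?addr0//; exact: VN0.
    rewrite modcM modc_real gtr0_norm ?invr_gt0// mulrC ltr_pdivrMr// mul1r => h.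
    apply/ltW/h => i; rewrite -pf -qg.
    have := ultraweak_formZD (e^-1)%:C%C (p i) (q i) (VN_bounded VS) (VN_bounded VN0).
    rewrite addr0 => ->; rewrite hS mulr0 add0r.
    have := ultraweak_formZD (-1) (p i) (q i) (VN_bounded VN0) (VN_bounded VN0).
    by rewrite scaler0 addr0 mulN1r addNr => ->; rewrite modc0.
by exists n, a, p, q.
Qed.

End FourierAlgebra.

(** * Vector states and their supports *)

Section VectorStates.
Context (R : realType) (G : topologicalGroupType).
Variable mu : {measure set (borel G) -> \bar R}.
Hypothesis haar : left_haar_measure mu.
Let ipL2 := inner_product_L2 mu.
Let Vc := @L2_complete _ _ R mu.
Local Notation lam := (@left_regular R G mu).
Local Notation ip := (@inner _ _ _ mu).
Local Notation VNc := (commutant (range lam)).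
Implicit Types (f g h : L2 mu) (A B S Q : L2 mu -> L2 mu).

Definition vector_state f : functional mu := fun S => inner (S f) f.

Lemma eq_P1 (u u' : functional mu) : (forall S, VN mu S -> u' S = u S) -> P1 u -> P1 u'.
Proof.
move=> E [ul up u1 uc]; split.
- by move=> a S Q VS VQ; rewrite !E ?ul//; exact: VN_linear.
- by move=> S VS; rewrite E//; exact: up.
- by rewrite E//; exact: VN_id.
- move=> S0 V0 e e0; have [n [f [g [fg [c c0 hc]]]]] := uc S0 V0 e e0.
  exists n, f, g; split=> //; exists c => // S VS h; rewrite !E//; exact: hc.
Qed.

Lemma P1_vector f : l2norm f = 1 -> P1 (vector_state f).
Proof.
(* A sequence with a single nonzero term, to which [P1_normalized] applies. *)
move=> f1; pose s k : L2 mu := if k is 0%N then f else 0.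
have sn n : \sum_(k < n) l2norm (s k) ^+ 2 <= 1.
  case: n => [|n]; first by rewrite big_ord0.
  rewrite big_ord_recl /= f1 expr1n big1 ?addr0// => i _.
  by rewrite l2norm0 expr0n.
have ss : square_summable s by exact: le_square_summable sn.
pose p := ell2_of s; have ps : p = s :> (nat -> L2 mu) by exact: ell2_ofK.
have form S : bounded_operator S -> ultraweak_form p p S = inner (S f) f.
  move=> [Sl _]; apply: complex_seriesE => e e0; exists 1%N => -[//|n] _.
  rewrite ps /psum big_ord_recl /= big1 ?addr0 ?subrr ?modc0// => i _.
  by rewrite (ip0r ipL2).
have p1 : hnorm (@ell2_inner _ _ _ mu) p ^+ 2 = 1.
  rewrite (sqr_hnorm (inner_product_ell2 mu)) -ultraweak_form_id form.
    by rewrite -(sqr_hnorm ipL2 f) [hnorm _ _]f1 expr1n.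
  by split => //; exists 1 => x; rewrite mul1r.
have p0 : 0 < hnorm (@ell2_inner _ _ _ mu) p.
  rewrite lt_def hnorm_ge0 andbT; apply/eqP => h; move: p1; rewrite h expr0n/= => /esym/eqP.
  by rewrite oner_eq0.
apply: eq_P1 (P1_normalized p0) => S VS.
by rewrite p1 invr1 rmorph1 mul1r form//; exact: VN_bounded.
Qed.

Lemma commutant_comp (X : set (L2 mu -> L2 mu)) A B : commutant X A -> commutant X B -> commutant X (A \o B).
Proof.
move=> [bA cA] [bB cB]; split.
  have [M M0 hM] := hbounded_gt0 bA; have [N N0 hN] := hbounded_gt0 bB; split.
    by move=> a f g /=; rewrite (bB.1 a f g) (bA.1 a).
  exists (M * N) => f; apply: (le_trans (hM (B f))).
  by rewrite -mulrA ler_wpM2l ?(ltW M0)//; exact: hN.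
by move=> Q XQ; rewrite -compA cB// compA cA.
Qed.

Lemma VNc_id : VNc id.
Proof. by split; [split => //; exists 1 => f; rewrite mul1r|move=> Q _]. Qed.

Lemma VNc_lam A x f : VNc A -> A (lam x f) = lam x (A f).
Proof.
move=> [_ cA].
have /(congr1 (fun F => F f)) := cA (lam x) (ex_intro2 _ _ x I erefl); exact.
Qed.

(** The adjoint of a translation is a translation, so the commutant is closed under adjoints. *)
Lemma VNc_adjoint A : VNc A -> exists2 A', VNc A' & forall f g, inner (A f) g = inner f (A' g).
Proof.
move=> cA; have [A' [bA' AA']] := adjoint_exists ipL2 Vc cA.1; exists A' => //.
split => // _ [x _ <-]; apply/funext => v; apply: (ip_extl ipL2) => w.
rewrite (ipC ipL2 w) [RHS](ipC ipL2 w); congr (_^*%C).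
transitivity (inner (A w) (lam x v)); first exact: esym (AA' w (lam x v)).
transitivity (inner (lam x^-1%g (A w)) v).
  by rewrite (left_regular_adjoint haar x^-1%g (A w) v) invgK.
rewrite -(VNc_lam x^-1%g w cA) AA'.
by rewrite (left_regular_adjoint haar x^-1%g w (A' v)) invgK.
Qed.

(** Invariance under the commutant, itself closed under adjoints, makes the projection commute with
    it; this is membership in the bicommutant. *)
Lemma VN_hproj (K : set (L2 mu)) : closed_subspace ip K ->
  (forall A, VNc A -> forall f, K f -> K (A f)) -> VN mu (hproj ip K).
Proof.
move=> cK KA; split; first exact: hproj_bounded.
move=> A cA; have [A' cA' AA'] := VNc_adjoint cA; apply/funext => f /=.
by apply: (hproj_commute ipL2 cK Vc cA.1.1 AA') => g; exact: KA.
Qed.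

Lemma hproj_orthogonal_projection (K : set (L2 mu)) : closed_subspace ip K ->
  orthogonal_projection (hproj ip K).
Proof.
move=> cK; split; first exact: hproj_bounded.
  by apply/funext => f; exact: (hproj_idem ipL2 cK Vc).
exact: (hproj_sym ipL2 cK Vc).
Qed.

(** The closure of the orbit of [f] under the commutant, encoded as a double orthogonal
    complement. *)
Definition cyclic_subspace f : set (L2 mu) :=
  orthocomp ip (orthocomp ip [set A f | A in VNc]).

Lemma cyclic_subspace_closed f : closed_subspace ip (cyclic_subspace f).
Proof. exact: orthocomp_closed. Qed.

Lemma cyclic_subspace_id f : cyclic_subspace f f.
Proof.
move=> s /(_ f) h; rewrite (ipC ipL2 s f) h ?conjc0//; exists id => //; exact: VNc_id.
Qed.

Lemma cyclic_subspace_stable f A : VNc A -> forall g, cyclic_subspace f g ->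
  cyclic_subspace f (A g).
Proof.
move=> cA g gf s sf; have [A' cA' AA'] := VNc_adjoint cA; rewrite AA'; apply: gf => _ [B cB <-].
have [B' cB' BB'] := VNc_adjoint cB; rewrite (ipC ipL2) -AA'.
by rewrite (ipC ipL2) conjcK; apply: sf; exists (A \o B) => //; exact: commutant_comp.
Qed.

Lemma VN_cyclic f : VN mu (hproj ip (cyclic_subspace f)).
Proof.
by apply: VN_hproj; [exact: cyclic_subspace_closed|exact: cyclic_subspace_stable].
Qed.

(** Here [|Q f|^2] and [inner (Q f) f] are both 1, so [|f - Q f|^2 = 1 + 1 - 2]. *)
Lemma vector_state_carrier f Q : l2norm f = 1 -> orthogonal_projection Q ->
  vector_state f Q = 1 -> Q f = f.
Proof.
move=> f1 [[Ql _] QQ Qs] uQ; apply/eqP; rewrite eq_sym -subr_eq0; apply/eqP/(hnorm_eq0 ipL2).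
have QQf : Q (Q f) = Q f by have /(congr1 (fun F => F f)) := QQ.
apply/eqP; rewrite -sqrf_eq0 (sqr_hnormB ipL2) (ipC ipL2 (Q f) f).
rewrite [hnorm ip f]f1 (sqr_hnorm ipL2 (Q f)) -Qs QQf.
by rewrite [inner (Q f) f]uQ RecJ /= expr1n mulr1 subrr.
Qed.

Lemma vector_state_support f : l2norm f = 1 ->
  is_support (VN mu) (vector_state f) (hproj ip (cyclic_subspace f)).
Proof.
move=> f1; have cK := cyclic_subspace_closed f.
have VP := VN_cyclic f; have oP := hproj_orthogonal_projection cK.
split => //; last first.
  move=> P' VP' oP'; apply; split => //.
  rewrite /vector_state (hproj_id ipL2 cK Vc (@cyclic_subspace_id f)).
  by rewrite (ipxx ipL2) [hnorm _ _]f1 expr1n.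
move=> Q [VQ oQ uQ] g; have Qf := vector_state_carrier f1 oQ uQ.
have [[Ql _] QQ Qs] := oQ.
(* [Q] fixes [f] and commutes with the commutant, so it fixes the orbit; by symmetry [w - Q w] is
   orthogonal to the orbit for every [w]. *)
have QK k : cyclic_subspace f k -> Q k = k.
  move=> Kk; apply: (ip_extl ipL2) => w; apply/eqP; rewrite Qs eq_sym -subr_eq0 -(ipBr ipL2).
  apply/eqP/Kk => _ [A cA <-]; rewrite (ipBl ipL2) Qs.
  have /(congr1 (fun F => F f)) /= -> := VQ.2 A cA.
  by rewrite Qf subrr.
set P := hproj ip (cyclic_subspace f).
(* This turns the operator inequality into [|P (Q w)| <= |Q w|]. *)
have PQ w : P (Q w) = P w.
  apply: (ip_extl ipL2) => z; rewrite (hproj_sym ipL2 cK Vc) Qs QK.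
    by rewrite -(hproj_sym ipL2 cK Vc).
  exact (hproj_in ipL2 cK Vc z).
have Pn w : inner (P w) w = ((hnorm ip (P w)) ^+ 2)%:C%C.
  by rewrite -(ipxx ipL2) -(hproj_sym ipL2 cK Vc) (hproj_idem ipL2 cK Vc).
have Qn w : inner (Q w) w = ((hnorm ip (Q w)) ^+ 2)%:C%C.
  rewrite -(ipxx ipL2) -Qs.
  by have /(congr1 (fun F => F w)) /= -> := QQ.
have -> : inner ((Q - hproj ip (cyclic_subspace f)) g) g = inner (Q g) g - inner (P g) g.
  exact: (ipBl ipL2 (Q g) (P g) g).
rewrite Pn Qn -rmorphB ler0c subr_ge0 ler_pXn2r// ?nnegrE ?hnorm_ge0//.
by rewrite -(PQ g); exact: (hproj_le ipL2 cK Vc).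
Qed.

(** The commutant is closed under products and adjoints, so the hypothesis makes the whole orbits of
    [f] and [g] orthogonal. *)
Lemma vector_state_orthogonal f g : l2norm f = 1 -> l2norm g = 1 ->
  (forall A, VNc A -> inner (A f) g = 0) ->
  orthogonal_states (VN mu) (vector_state f) (vector_state g).
Proof.
move=> f1 g1 fg.
exists (hproj ip (cyclic_subspace f)), (hproj ip (cyclic_subspace g)).
split; [exact: vector_state_support|exact: vector_state_support|].
have fg' A B : VNc A -> VNc B -> inner (A f) (B g) = 0.
  move=> cA cB; have [B' cB' BB'] := VNc_adjoint cB.
  rewrite (ipC ipL2) BB' -(ipC ipL2).
  exact: (fg (B' \o A) (commutant_comp cB' cA)).
apply/funext => h.
have K0 : cyclic_subspace f 0 by case: (cyclic_subspace_closed f).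
apply: (hproj_unique ipL2 (cyclic_subspace_closed f) Vc K0) => k Kk; rewrite subr0 (ipC ipL2) Kk ?conjc0// => _ [A cA <-].
apply: (hproj_in ipL2 (cyclic_subspace_closed g) Vc h) => _ [B cB <-].
exact: fg'.
Qed.

End VectorStates.

(** * Neighborhoods of the identity and their Haar measure *)

Section SmallNeighborhoods.
Context (R : realType) (G : topologicalGroupType).
Variable mu : {measure set (borel G) -> \bar R}.
Hypotheses (G_hausdorff : hausdorff_space G) (G_lc : locally_compact [set: G]).
Hypothesis haar : left_haar_measure mu.

Lemma open_ltranslate (x : G) (U : set G) : open U -> open (ltranslate x @^-1` U : set G).
Proof. by move=> oU; apply: open_comp => // y _; exact: continuous_mulgl. Qed.

(** Otherwise every compact set, being covered by finitely many translates of [U], would be null,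
    and by inner regularity so would [G]. *)
Lemma haar_open_gt0 (U : set G) : open U -> U 1%g -> (0 < mu U)%E.
Proof.
move=> oU U1; rewrite lt0e measure_ge0 andbT; apply/eqP => U0.
have [T0 _ _ _ inner_reg] := haar.
have null (K : set G) : compact K -> mu K = 0%E.
  move=> cK; have mK := compact_measurable G_hausdorff cK.
  move: (cK); rewrite compact_cover => /(_ G [set: G] (fun x => ltranslate x @^-1` U)).
  case=> [x _|x Kx|D _ KD]; first exact: open_ltranslate.
    by exists x => //; rewrite /ltranslate /= mulVg.
  move: KD; rewrite /cover bigcup_fset; set E := (X in _ `<=` X) => KE.
  suff h : mu.-negligible (E : set (borel G)).
    by apply: (measure_negligible mK); exact (@negligibleS _ (borel G) R mu E K KE h).
  apply: (big_ind (fun A : set (borel G) => mu.-negligible A)).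
  - exact: negligible_set0.
  - by move=> A B; exact: negligibleU.
  move=> x _; have mxU := open_measurable_borel (open_ltranslate x oU).
  apply/negligibleP => //.
  exact: eq_trans (measure_ltranslate haar x (open_measurable_borel oU)) U0.
move/eqP: T0; apply; apply/eqP; rewrite eq_le measure_ge0 andbT.
rewrite (inner_reg _ openT); apply: ge_ereal_sup => _ [K [cK _] <-].
by rewrite null.
Qed.

(* A nontrivial neighborhood of 1 contains two disjoint translates of a smaller one. *)
Lemma haar_halve (U W : set G) : ~ open [set (1%g : G)] -> open U -> U 1%g -> nbhs (1%g : G) W ->
  exists V : set G, [/\ open V, V 1%g, V `<=` U `&` W & (mu V + mu V <= mu U)%E].
Proof.
move=> nd oU U1 W1.
have [x Ux x1] : exists2 x, U x & x <> 1%g.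
  apply: contra_notP nd => /forall2NP h; rewrite (_ : [set 1%g] = U)//.
  rewrite eqEsubset; split => [_ ->//|x Ux /=]; have [//|/contrapT] := h x.
  exact.
move: (G_hausdorff); rewrite open_hausdorff => /(_ 1%g x).
have x1' : (1%g : G) != x by apply/eqP => /esym.
move=> /(_ x1') [[A B] /= [A1 Bx] [oA oB AB]].
(* Both [V] and its translate by [x] lie in [U], the first inside [A] and the second inside [B],
   hence they are disjoint. *)
pose V : set G := (U `&` W°) `&` (A `&` (ltranslate x^-1%g @^-1` (U `&` B))).
have oV : open V.
  apply: openI; apply: openI => //; first exact: open_interior.
  by apply: open_ltranslate; exact: openI.
have mV := open_measurable_borel oV; have mU := open_measurable_borel oU.
have oxV := open_ltranslate x oV; have mxV := open_measurable_borel oxV.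
exists V; split => //.
- split; first by split.
  split; first exact: set_mem.
  by rewrite /= /ltranslate invgK mulg1; split => //; exact: set_mem.
- by move=> y [[Uy /interior_subset Wy] _]; split.
rewrite -{2}(measure_ltranslate haar x mV) -measureU//.
  rewrite le_measure ?inE//; first exact: measurableU.
  move=> y [[[]//]|[_ [_ []]]]; rewrite /ltranslate invgK mulVKg.
  by [].
rewrite -subset0 => y [[_ [Ay _]] [_ [_ [_]]]]; rewrite /ltranslate invgK mulVKg => By.
by rewrite -(eqP AB); split.
Qed.

(** In a discrete group the identity would have a neighborhood basis with a single member. *)
Lemma nondiscrete : min_nbhs_basis_card (1%g : G) [set: nat] -> ~ open [set (1%g : G)].
Proof.
move=> [_ h] o1; apply: infinite_nat.
have /h /card_le_finite : nbhs_basis (1%g : G) [set [set 1%g]].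
  split => [_ ->|V V1]; first exact: open_nbhs_nbhs.
  by exists [set 1%g] => // _ ->; exact: nbhs_singleton.
by apply; exact: finite_set1.
Qed.

Lemma small_neighborhoods : min_nbhs_basis_card (1%g : G) [set: nat] ->
  exists V : nat -> set G,
    [/\ forall n, open (V n) /\ V n 1%g, forall n, (mu (V n) < +oo)%E,
        forall n k, (n <= k)%N -> V k `<=` V n,
        forall n, (mu (V n.+1) + mu (V n.+1) <= mu (V n))%E &
        forall W, nbhs (1%g : G) W -> exists n, V n `<=` W].
Proof.
move=> G_card; have nd := nondiscrete G_card.
have [[B [B1 Bb]] + _] := G_card.
rewrite card_eq_le => /andP[/countable_injP[k kB] _].
(* The basis set numbered [n] by the injection [k], or all of [G] when there is none. *)
pose E n : set G := [set x | forall U, B U -> k U = n -> U x].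
have E1 n : nbhs (1%g : G) (E n).
  have [[U [BU kU]]|h] := pselect (exists U, B U /\ k U = n).
    apply: filterS (B1 U BU) => x Ux W BW kW; suff -> : W = U by [].
    by apply: kB; rewrite ?inE// kW.
  by apply: filterS filterT => x _ U BU kU; case: h; exists U.
move: (G_lc (I : [set: G] 1%g)) => [K K1 [cK _]].
have {}K1 : nbhs (1%g : G) K by apply: (@filterS _ (nbhs (1%g : G)) _ _ _ _ K1) => x; exact.
have [_ _ Koo _ _] := haar.
pose good (V : set G) := [/\ open V, V 1%g & (mu V < +oo)%E].
have V0 : good K°.
  split; [exact: open_interior|exact: K1|].
  apply: le_lt_trans (Koo K cK); rewrite le_measure ?inE//.
  - by apply: open_measurable_borel; exact: open_interior.
  - exact: compact_measurable.
  - exact: interior_subset.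
(* Starting from the interior of a compact neighborhood, each step halves the measure and enters one
   more basis set. The default [set0] is never met, since every set of the sequence is [good]. *)
have /choice[next hnext] (p : nat * set G) : exists V', good p.2 ->
    good V' /\ V' `<=` p.2 `&` E p.1 /\ (mu V' + mu V' <= mu p.2)%E.
  have [[oV V1 Voo]|h] := pselect (good p.2); last by exists set0.
  have [V' [oV' V'1 V'V le]] := haar_halve nd oV V1 (E1 p.1).
  exists V' => _; split => //; split => //; apply: le_lt_trans Voo.
  rewrite le_measure ?inE//; [exact: open_measurable_borel..|].
  by move=> x /V'V[].
pose V := fix V n := if n is m.+1 then next (m, V m) else K°.
have gV n : good (V n).
  by elim: n => [//|n IH]; case: (hnext (n, V n) IH).
exists V; split => [n|n|n j nj|n|W W1].
- by case: (gV n).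
- by case: (gV n).
- rewrite -(subnK nj); elim: (j - n)%N => [//|i IH] x.
  by case: (hnext (i + n, V (i + n))%N (gV _)) => _ [h _] /h[+ _]; exact: IH.
- by case: (hnext (n, V n) (gV n)) => _ [_ h]; exact: h.
have [U BU UW] := Bb W W1; exists (k U).+1 => x.
by case: (hnext (k U, V (k U)) (gV _)) => _ [h _] /h[_ Ex]; apply: UW; exact: Ex.
Qed.

End SmallNeighborhoods.

(** * Averages of the left regular representation *)

Section Averaging.
Context (R : realType) (G : topologicalGroupType).
Variable mu : {measure set (borel G) -> \bar R}.
Hypotheses (G_hausdorff : hausdorff_space G) (haar : left_haar_measure mu).
Let ipL2 := inner_product_L2 mu.
Let Vc := @L2_complete _ _ R mu.
Local Notation lam := (@left_regular R G mu).
Local Notation ip := (@inner _ _ _ mu).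
Local Notation VNc := (commutant (range lam)).
Implicit Types (f g : L2 mu) (U : set G).

(** Strong continuity makes the coefficient continuous, hence measurable, so that it can be
    averaged. *)
Lemma cbounded_left_regular f g : cbounded (fun y : borel G => inner (lam y f) g).
Proof.
have near_le y0 (e : R) : 0 < e ->
    nbhs (y0 : G) (fun y => modc (inner (lam y0 f) g - inner (lam y f) g) < e).
  move=> e0; have g1 : 0 < l2norm g + 1 by rewrite ltr_wpDl// l2norm_ge0.
  apply: (@filterS _ (nbhs (y0 : G)) _ _ _ _
    (left_regular_cvg G_hausdorff haar y0 f (divr_gt0 e0 g1))) => y.
  rewrite ltr_pdivlMr// => h; rewrite -(ipBl ipL2).
  apply: (le_lt_trans (modc_ip_le ipL2 _ _)); rewrite (hdistC ipL2).
  by apply: le_lt_trans h; rewrite ler_wpM2l ?hnorm_ge0// lerDl.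
split; last first.
  exists (l2norm f * l2norm g) => y; apply: (le_trans (modc_ip_le ipL2 _ _)).
  by rewrite -[l2norm f](left_regular_norm haar y).
split; apply: continuous_measurable_borel => y0; apply/cvgrPdist_lt => e e0.
  apply: filterS (near_le y0 e e0) => y; apply: le_lt_trans.
  by rewrite -RecN -RecD modc_Re.
apply: filterS (near_le y0 e e0) => y; apply: le_lt_trans.
by rewrite -ImcN -ImcD modc_Im.
Qed.

Variable V : set G.
Hypotheses (oV : open V) (V1 : V 1%g) (Voo : (mu V < +oo)%E).

Let m := fine (mu V).

Let m0 : 0 < m.
Proof. by rewrite fine_gt0// Voo (haar_open_gt0 G_hausdorff haar oV V1). Qed.

Let mV : measurable (V : set (borel G)) := open_measurable_borel oV.

Let cut (h : borel G -> R[i]) (y : borel G) := indic_fun R (V : set (borel G)) y * h y.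

Let mean h : R[i] := (m^-1)%:C%C * cint mu (cut h).

Let cut_measurable h : cbounded h -> cmeasurable (cut h).
Proof. by move=> [mh _]; apply: cmeasurableM => //; exact: cmeasurable_indic. Qed.

Let modc_cut (h : borel G -> R[i]) (k : R) (y : borel G) : (V y -> modc (h y) <= k) -> modc (cut h y) <= k * \1_(V : set (borel G)) y.
Proof.
move=> hk; rewrite modcM modc_indic indicE; have [|_] := boolP (y \in V).
  by rewrite inE => /hk; rewrite mul1r mulr1.
by rewrite mul0r mulr0.
Qed.

Let cut_integrable h : cbounded h -> cintegrable mu (cut h).
Proof.
move=> bh; have [_ [k hk]] := bh.
apply: (@cintegrable_le _ _ _ mu _ (fun y => k * \1_(V : set (borel G)) y)).
- exact: cut_measurable.
- have := integrableZl measurableT k (integrable_indic_lty mV Voo).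
  by under eq_fun do rewrite -EFinM.
- by move=> y; apply: modc_cut.
Qed.

Let meanZD a h h' : cbounded h -> cbounded h' ->
  mean (fun y => a * h y + h' y) = a * mean h + mean h'.
Proof.
move=> bh bh'; have bah : cbounded (fun y => a * h y).
  have [mh [k hk]] := bh; split; first by apply: cmeasurableM => //; exact: cmeasurable_cst.
  by exists (modc a * k) => y; rewrite modcM ler_wpM2l ?modc_ge0.
rewrite /mean; have -> : cut (fun y => a * h y + h' y) = fun y => cut (fun y => a * h y) y + cut h' y.
  by apply/funext => y; rewrite /cut mulrDr.
rewrite cintD; [|exact: cut_integrable|exact: cut_integrable].
have -> : cut (fun y => a * h y) = fun y => a * cut h y.
  by apply/funext => y; rewrite /cut mulrCA.
by rewrite cintZ ?mulrDr; [rewrite mulrCA|exact: cut_integrable].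
Qed.

Let mean_le_on h (k : R) U : cbounded h -> measurable (U : set (borel G)) -> (mu U < +oo)%E ->
  (forall y : borel G, modc (cut h y) <= k * \1_(U : set (borel G)) y) -> modc (mean h) * m <= 2 * k * fine (mu U).
Proof.
move=> bh mU Uoo hk; rewrite modcM modc_real gtr0_norm ?invr_gt0// mulrAC mulVf ?gt_eqF// mul1r.
by apply: modc_cint_le => //; exact: cut_measurable.
Qed.

Let mean_le h (k : R) : cbounded h -> (forall y : borel G, V y -> modc (h y) <= k) -> modc (mean h) <= 2 * k.
Proof.
move=> bh hk; rewrite -(ler_pM2r m0); apply: mean_le_on => // y.
by apply: modc_cut; exact: hk.
Qed.

Let mean_cst z : mean (fun=> z) = z.
Proof.
rewrite /mean; have -> : cut (fun=> z) = fun y => z * indic_fun R (V : set (borel G)) y.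
  by apply/funext => y; rewrite /cut mulrC.
have i1 : cintegrable mu (indic_fun R (V : set (borel G))).
  have := cut_integrable (cbounded_cst (borel G) 1); congr (cintegrable mu _).
  by apply/funext => y; rewrite /cut mulr1.
rewrite cintZ// mulrCA -[RHS]mulr1; congr (z * _).
have -> : cint mu (indic_fun R (V : set (borel G))) = m%:C%C.
  apply: complexP => /=; last by rewrite /Rintegral integral0.
  by rewrite /Rintegral integral_indic// setIT.
by rewrite -rmorphM mulVf ?rmorph1// gt_eqF.
Qed.

(** The operator is defined weakly, by the mean of [inner (lam y f) g] over [y] in [V]. The last
    bound rests on [inner (lam z f) (lam y f)] vanishing unless [y^-1 z] lies in [U]: its mean over
    [z] is at most a multiple of [mu U / mu V], and a second mean, over [y], gives [|B f|^2]. Each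
    mean costs a factor 2. *)
Lemma averaging_operator : exists B : L2 mu -> L2 mu,
  [/\ hlinear B /\ forall f, l2norm (B f) <= 2 * l2norm f,
      forall A, VNc A -> forall f, B (A f) = A (B f),
      forall f (e : R), (forall y, V y -> l2norm (lam y f - f) <= e) -> l2norm (B f - f) <= 2 * e &
      forall f U, measurable (U : set (borel G)) -> (mu U < +oo)%E -> l2norm f = 1 ->
        (forall x, ~ U x -> inner (lam x f) f = 0) ->
        l2norm (B f) ^+ 2 * fine (mu V) <= 4 * fine (mu U)].
Proof.
pose q f g := mean (fun y => inner (lam y f) g).
have bq f g := cbounded_left_regular f g.
have [|||B [Bl B2 BE]] := @form_operator _ _ _ ipL2 Vc q 2.
- move=> a f g h; rewrite /q -meanZD//; congr mean; apply/funext => y.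
  by rewrite (left_regular_linear haar y a f g) (ipDl ipL2) (ipZl ipL2).
- move=> a f g h; rewrite /q -meanZD//; congr mean; apply/funext => y.
  by rewrite (ipDr ipL2) (ipZr ipL2).
- move=> f g; rewrite -mulrA; apply: mean_le => // y _.
  by apply: (le_trans (modc_ip_le ipL2 _ _)); rewrite -[hnorm ip f](left_regular_norm haar y).
exists B; split => //.
- move=> A cA f; have [A' cA' AA'] := VNc_adjoint haar cA; apply: (ip_extl ipL2) => g.
  rewrite AA' -!BE; congr mean; apply/funext => y.
  by rewrite -(VNc_lam y f cA) AA'.
- move=> f e fe; have e0 : 0 <= e by apply: le_trans (fe _ V1); exact: l2norm_ge0.
  set d := B f - f.
  have E : inner d d = mean (fun y => inner (lam y f - f) d).
    rewrite /d (ipBl ipL2) -BE -(mean_cst (inner f d)) -mulN1r addrC -meanZD//; last exact: cbounded_cst.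
    by congr mean; apply/funext => y; rewrite (ipBl ipL2) mulN1r addrC.
  have [->|d0] := eqVneq (l2norm d) 0; first by rewrite mulr_ge0.
  have dp : 0 < l2norm d by rewrite lt_def d0 l2norm_ge0.
  rewrite -(ler_pM2r dp) -expr2 -[leLHS](ger0_norm (sqr_ge0 _)) -modc_real.
  rewrite -[X in modc X](ipxx ipL2) E -mulrA; apply: mean_le.
    have := cboundedB (bq f d) (cbounded_cst (borel G) (inner f d)).
    by congr cbounded; apply/funext => y; rewrite (ipBl ipL2).
  move=> y Vy; apply: (le_trans (modc_ip_le ipL2 _ _)).
  by rewrite ler_wpM2r ?l2norm_ge0//; exact: fe.
move=> f U mU Uoo f1 fU.
have step y : modc (inner (B f) (lam y f)) * m <= 2 * 1 * fine (mu U).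
  rewrite -BE -(measure_ltranslate haar y mU); apply: mean_le_on => //.
  - by rewrite -[_ @^-1` _]setTI; exact: measurable_ltranslate.
  - by rewrite measure_ltranslate.
  move=> z; rewrite modcM modc_indic mul1r.
  have [Uz|Uz] := pselect ((ltranslate y @^-1` U) z).
    have -> : \1_(ltranslate y @^-1` U : set (borel G)) z = 1 * 1 :> R by rewrite /indic mem_set// mulr1.
    apply: ler_pM; rewrite ?modc_ge0//.
    apply: (le_trans (modc_ip_le ipL2 _ _)).
    by rewrite [hnorm _ _](left_regular_norm haar z) [hnorm _ (lam y f)](left_regular_norm haar y) f1 mulr1.
  have -> : inner (lam z f) (lam y f) = inner (lam (y^-1 * z)%g f) f.
    by rewrite (left_regularM haar) (left_regular_adjoint haar y^-1%g) invgK.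
  by rewrite fU// modc0 mulr0.
have E : (l2norm (B f) ^+ 2)%:C%C = mean (fun y => inner (lam y f) (B f)) by rewrite -(ipxx ipL2) -BE.
have h : l2norm (B f) ^+ 2 <= 2 * (2 * fine (mu U) / m).
  rewrite -[leLHS](ger0_norm (sqr_ge0 _)) -modc_real E; apply: mean_le => // y _.
  rewrite (ipC ipL2) modcJ ler_pdivlMr//; have := step y; rewrite mulr1; exact.
rewrite -(ler_pM2r m0) in h; apply: (le_trans h); rewrite mulrA divfK ?gt_eqF// mulrA.
by rewrite -natrM.
Qed.

End Averaging.

(** * A positive injective operator with small energy on the peaks *)

Section SeparatingOperator.
Context (R : realType) (G : topologicalGroupType).
Variable mu : {measure set (borel G) -> \bar R}.
Hypotheses (G_hausdorff : hausdorff_space G) (haar : left_haar_measure mu).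
Let ipL2 := inner_product_L2 mu.
Let ipE := inner_product_ell2 mu.
Let Vc := @L2_complete _ _ R mu.
Local Notation lam := (@left_regular R G mu).
Local Notation ip := (@inner _ _ _ mu).
Local Notation ipe := (@ell2_inner _ _ _ mu).
Local Notation VNc := (commutant (range lam)).
Implicit Types (f g : L2 mu) (U : set G).

Section WeightedSum.
Variable B : nat -> L2 mu -> L2 mu.
Hypotheses (Bl : forall j, hlinear (B j)) (B2 : forall j f, l2norm (B j f) <= 2 * l2norm f).

Let weight j : R := 2^-1 ^+ j.

Let weight_gt0 j : 0 < weight j. Proof. by rewrite exprn_gt0// invr_gt0. Qed.

Let weight_le1 j : weight j <= 1.
Proof. by rewrite exprn_ile1 ?invr_ge0// invf_le1// ler1n. Qed.

Let sum_weight n : \sum_(j < n) weight j <= 2.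
Proof.
suff -> : \sum_(j < n) weight j = 2 - 2 * weight n.
  by rewrite gerBl mulr_ge0// ltW.
elim: n => [|n IH]; first by rewrite big_ord0 /weight expr0 mulr1 subrr.
by rewrite big_ord_recr /= IH /weight exprS; field.
Qed.

Let terms f j : L2 mu := (weight j)%:C%C *: B j f.

Let terms_norm f j : l2norm (terms f j) ^+ 2 = weight j * (weight j * l2norm (B j f) ^+ 2).
Proof. by rewrite l2normZ modc_real gtr0_norm// exprMn expr2 mulrA. Qed.

(** One factor [weight j] is summed and the other stays in the bound. It is then enough that each
    weighted squared norm be small: by the weight for large [j], by the average itself for the
    others. *)
Let terms_sum_le f (c : R) n : (forall j, weight j * l2norm (B j f) ^+ 2 <= c) ->
  \sum_(j < n) l2norm (terms f j) ^+ 2 <= 2 * c.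
Proof.
move=> h; have c0 : 0 <= c by apply: le_trans (h 0%N); rewrite mulr_ge0 ?sqr_ge0// ltW.
apply: (@le_trans _ _ (\sum_(j < n) weight j * c)).
  by apply: ler_sum => j _; rewrite terms_norm ler_pM2l.
by rewrite -mulr_suml ler_wpM2r.
Qed.

Let weight_B_le f j : weight j * l2norm (B j f) ^+ 2 <= weight j * (4 * l2norm f ^+ 2).
Proof.
have -> : 4 * l2norm f ^+ 2 = (2 * l2norm f) ^+ 2 by ring.
rewrite ler_pM2l// ler_pXn2r// nnegrE ?l2norm_ge0//.
by rewrite mulr_ge0// l2norm_ge0.
Qed.

Let terms_le f n : \sum_(j < n) l2norm (terms f j) ^+ 2 <= 2 * (4 * l2norm f ^+ 2).
Proof.
apply: terms_sum_le => j; apply: (le_trans (weight_B_le f j)).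
by rewrite ler_piMl// mulr_ge0 ?sqr_ge0.
Qed.

(** The operator sought is the adjoint of [T] composed with [T], so its positivity, symmetry and
    kernel are read off [T]. *)
Let T f : ell2 mu := ell2_of (terms f).

Let TE f j : T f j = terms f j.
Proof. by rewrite (ell2_ofK (le_square_summable (terms_le f))). Qed.

Let TZD a f g : T (a *: f + g) = a *: T f + T g.
Proof.
apply: ell2_ext => j; apply: (eq_trans (TE _ j)).
have -> : (a *: T f + T g) j = a *: terms f j + terms g j.
  by apply: (eq_trans (ell2ZD _ _ _ _)); congr (_ *: _ + _); exact: TE.
by rewrite /terms Bl scalerDr !scalerA [a * _]mulrC.
Qed.

Let T_le f : hnorm ipe (T f) <= 3 * l2norm f.
Proof.
rewrite -(@ler_pXn2r _ 2)// ?nnegrE ?mulr_ge0 ?hnorm_ge0// exprMn.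
apply: (@le_trans _ _ (2 * (4 * l2norm f ^+ 2))).
  by apply: sqr_ell2norm_le => n; under eq_bigr do rewrite TE; exact: terms_le.
by rewrite mulrA ler_wpM2r ?sqr_ge0// -natrM -natrX ler_nat.
Qed.

Let eq_ell2_inner (p q p' q' : ell2 mu) : (forall k, inner (p k) (q k) = inner (p' k) (q' k)) ->
  ipe p q = ipe p' q'.
Proof. by move=> h; congr complex_series; apply/funext. Qed.

Let T_adjoint A A' f g : VNc A -> VNc A' -> (forall u v, inner (A u) v = inner u (A' v)) ->
  (forall A j f, VNc A -> B j (A f) = A (B j f)) -> ipe (T (A f)) (T g) = ipe (T f) (T (A' g)).
Proof.
move=> cA cA' AA' BA; apply: eq_ell2_inner => j.
have E1 : terms (A f) j = A (terms f j) by rewrite /terms BA// (hlinearZ _ _ cA.1.1).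
have E2 : terms (A' g) j = A' (terms g j) by rewrite /terms BA// (hlinearZ _ _ cA'.1.1).
apply: (eq_trans (congr2 ip (eq_trans (TE (A f) j) E1) (TE g j))).
apply: (eq_trans (AA' _ _)); apply: esym.
exact: (congr2 ip (TE f j) (eq_trans (TE (A' g) j) E2)).
Qed.

Lemma weighted_sum_operator : exists a : L2 mu -> L2 mu,
  [/\ hbounded ip a, symmetric ip a /\ positive ip a,
      forall f, complex.Re (ip (a f) f) = 0 -> forall j, B j f = 0,
      forall A, VNc A -> (forall A' j f, VNc A' -> B j (A' f) = A' (B j f)) ->
        forall f, a (A f) = A (a f) &
      forall f (e : R), (forall j, 2^-1 ^+ j * l2norm (B j f) ^+ 2 <= e) ->
        complex.Re (ip (a f) f) <= 2 * e].
Proof.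
pose q f g := ipe (T f) (T g).
(* The constant 9 is the square of the bound 3 on [T], where 3 is an integer above [sqrt 8]. *)
have [|||a [al a9 aE]] := @form_operator _ _ _ ipL2 Vc q 9.
- by move=> b f g h; rewrite /q TZD (ipDl ipE) (ipZl ipE).
- by move=> b f g h; rewrite /q TZD (ipDr ipE) (ipZr ipE).
- move=> f g; apply: (le_trans (modc_ip_le ipE _ _)).
  have -> : 9 * l2norm f * l2norm g = (3 * l2norm f) * (3 * l2norm g) by ring.
  by apply: ler_pM; rewrite ?hnorm_ge0.
have Re_a f : complex.Re (ip (a f) f) = hnorm ipe (T f) ^+ 2.
  by rewrite -aE; exact: esym (sqr_hnorm ipE (T f)).
exists a; split.
- by split => //; exists 9.
- split => [f g|f]; last by rewrite Re_a sqr_ge0.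
  by rewrite -aE /q (ipC ipE) [RHS](ipC ipL2) -aE.
- move=> f; rewrite Re_a => /eqP; rewrite sqrf_eq0 => /eqP/(hnorm_eq0 ipE) Tf0 j.
  have := TE f j; rewrite Tf0 => /esym/eqP; rewrite scaler_eq0 => /orP[|/eqP//].
  by move=> /eqP/(congr1 (@complex.Re R))/= /eqP; rewrite gt_eqF.
- move=> A cA BA f; have [A' cA' AA'] := VNc_adjoint haar cA; apply: (ip_extl ipL2) => g.
  apply: (eq_trans (esym (aE (A f) g))); apply: esym; apply: (eq_trans (AA' (a f) g)).
  apply: (eq_trans (esym (aE f (A' g)))); apply: esym; exact: T_adjoint.
move=> f e h; rewrite Re_a; apply: sqr_ell2norm_le => n.
by under eq_bigr do rewrite TE; exact: terms_sum_le.
Qed.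

End WeightedSum.

Variable V : nat -> set G.
Hypotheses (oV : forall n, open (V n)) (V1 : forall n, V n 1%g).
Hypothesis Voo : forall n, (mu (V n) < +oo)%E.
Hypothesis V_mono : forall n k, (n <= k)%N -> V k `<=` V n.
Hypothesis V_half : forall n, (mu (V n.+1) + mu (V n.+1) <= mu (V n))%E.
Hypothesis V_basis : forall W, nbhs (1%g : G) W -> exists n, V n `<=` W.

Let m n := fine (mu (V n)).

Let m_gt0 n : 0 < m n.
Proof. by rewrite fine_gt0// Voo (haar_open_gt0 G_hausdorff haar (oV n) (V1 n)). Qed.

Let mE n : mu (V n) = (m n)%:E.
Proof. by rewrite fineK// ge0_fin_numE. Qed.

Let m_geometric n : m n <= 2^-1 ^+ n * m 0%N.
Proof.
elim: n => [|n IH]; first by rewrite expr0 mul1r.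
have := V_half n; rewrite !mE -EFinD lee_fin => h.
rewrite exprS -mulrA ler_pdivlMl//; apply: le_trans IH.
by rewrite mulr2n mulrDl mul1r.
Qed.

Let m_cvg (e : R) : 0 < e -> exists n, m n < e.
Proof.
move=> e0; have [N _ hN] : \forall n \near \oo, 2^-1 ^+ n * m 0%N < e.
  have : (fun n => 2^-1 ^+ n * m 0%N) @ \oo --> (0 * m 0%N : R).
    by apply: cvgMl; apply: cvg_expr; rewrite ger0_norm ?invr_ge0// invf_lt1// ltr1n.
  rewrite mul0r => /cvgrPdist_lt/(_ e e0); apply: filterS => n.
  by rewrite sub0r normrN; apply: le_lt_trans; exact: ler_norm.
by exists N; apply: le_lt_trans (m_geometric N) (hN N (leqnn N)).
Qed.

Let peak n : L2 mu := ((Num.sqrt (m n))^-1)%:C%C *: indic2 mu (V n : set (borel G)).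

Let sqr_norm_indic n : l2norm (indic2 mu (V n : set (borel G))) ^+ 2 = m n.
Proof.
apply: EFin_inj; rewrite -mE; apply: sqr_l2norm_indic => //; exact: open_measurable_borel.
Qed.

Let peak_norm n : l2norm (peak n) = 1.
Proof.
have s0 : 0 < Num.sqrt (m n) by rewrite sqrtr_gt0.
rewrite l2normZ modc_real gtr0_norm ?invr_gt0//.
have -> : l2norm (indic2 mu (V n : set (borel G))) = Num.sqrt (m n).
  by rewrite -sqr_norm_indic sqrtr_sqr ger0_norm// l2norm_ge0.
by rewrite mulVf// gt_eqF.
Qed.

Let indic_supp n : {ae mu, forall s : borel G,
  L2_repr (indic2 mu (V n : set (borel G))) s <> 0 -> V n s}.
Proof.
have h := L2_classK (sq_integrable_indic (open_measurable_borel (oV n)) (Voo n)).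
apply: filterS h => s ->; have [//|Vs] := pselect (V n s).
by rewrite /indic_fun indicE memNset.
Qed.

Let peak_supp n : {ae mu, forall s : borel G, L2_repr (peak n) s <> 0 -> V n s}.
Proof.
have h := L2_reprZD ((Num.sqrt (m n))^-1)%:C%C (indic2 mu (V n : set (borel G))) 0.
rewrite addr0 in h; apply: filterS3 h (@L2_repr0 _ _ R mu) (indic_supp n) => s -> -> h1.
by rewrite addr0 => h2; apply: h1 => h0; apply: h2; rewrite h0 mulr0.
Qed.

Let peak_orthogonal n x : (forall s : G, V n s -> ~ V n (x^-1 * s)%g) ->
  inner (lam x (peak n)) (peak n) = 0.
Proof.
move=> h.
have z : inner (lam x (indic2 mu (V n : set (borel G)))) (indic2 mu (V n : set (borel G))) = 0.
  have mV := open_measurable_borel (oV n).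
  rewrite (left_regular_indic haar x mV (Voo n)) inner_class.
  - rewrite (_ : (fun _ => _) = fun=> 0); first by apply: complexP => /=; rewrite /Rintegral integral0.
    apply/funext => s; rewrite /indic_fun !indicE.
    have [Vs|Vs] := pselect (V n s); last by rewrite (memNset Vs) conjc0 mulr0.
    have Vxs : ~ (ltranslate x @^-1` V n) s by exact: h.
    by rewrite (memNset Vxs) mul0r.
  - apply: sq_integrable_indic; first by rewrite -[_ @^-1` _]setTI; exact: measurable_ltranslate.
    by rewrite measure_ltranslate.
  - exact: sq_integrable_indic.
rewrite /peak (hlinearZ _ _ (left_regular_linear haar x)) (ipZl ipL2) (ipZr ipL2) z.
by rewrite !mulr0.
Qed.

(** The coefficient of [peak n] at [x] can be nonzero only if [V n] meets its translate by [x]; this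
    confines such [x] to a prescribed neighborhood of the identity. *)
Let difference_cvg U : nbhs (1%g : G) U -> exists N, forall n, (N <= n)%N ->
  forall x s : G, V n s -> V n (x^-1 * s)%g -> U x.
Proof.
move=> U1; have U11 : nbhs (1 * 1 : G)%g U by rewrite mulg1.
have [[P Q] /= [P1 Q1] PQ] := @mulg_continuous G (1%g, 1%g) U U11.
have Q1' : nbhs (1^-1 : G)%g Q by rewrite invg1.
have [N hN] := V_basis (filterI P1 (nbhs_invg Q1')).
exists N => n Nn x s Vs Vxs.
have -> : x = (s * (x^-1 * s)^-1)%g by rewrite invgM invgK mulVKg.
apply: (PQ (s, (x^-1 * s)^-1)%g); split => /=; first by case: (hN s (V_mono Nn Vs)).
by case: (hN _ (V_mono Nn Vxs)).
Qed.

Lemma separating_operator : exists (a : L2 mu -> L2 mu) (f : nat -> L2 mu),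
  [/\ hbounded ip a /\ symmetric ip a, positive ip a,
      forall f, complex.Re (ip (a f) f) = 0 -> f = 0,
      forall A, VNc A -> forall f, a (A f) = A (a f) &
      [/\ forall n, l2norm (f n) = 1,
          forall n, {ae mu, forall s : borel G, L2_repr (f n) s <> 0 -> V n s} &
          forall e : R, 0 < e -> exists N, forall n, (N <= n)%N ->
            complex.Re (ip (a (f n)) (f n)) < e]].
Proof.
have /choice[B hB] := fun j => averaging_operator G_hausdorff haar (oV j) (V1 j) (Voo j).
have Bl j : hlinear (B j) by case: (hB j) => -[].
have B2 j f : l2norm (B j f) <= 2 * l2norm f by case: (hB j) => -[].
have BA A j f : VNc A -> B j (A f) = A (B j f) by move=> cA; case: (hB j) => _ h _ _; exact: h.
have Bid j f (e : R) : (forall y, V j y -> l2norm (lam y f - f) <= e) -> l2norm (B j f - f) <= 2 * e.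
  by case: (hB j) => _ _ h _; exact: h.
have Bsmall j f U : measurable (U : set (borel G)) -> (mu U < +oo)%E -> l2norm f = 1 ->
    (forall x, ~ U x -> inner (lam x f) f = 0) -> l2norm (B j f) ^+ 2 * m j <= 4 * fine (mu U).
  by case: (hB j) => _ _ _; exact.
have [a [ba [as_ ap] a0 aA ae]] := weighted_sum_operator Bl B2.
exists a, peak; split => //.
(* All averages of [f] vanish, while those over small [V j] are close to [f] by strong
   continuity. *)
- move=> f /a0 Bf0; apply: (hnorm_eq0 ipL2); apply/eqP; rewrite eq_le hnorm_ge0 andbT.
  apply/ler_addgt0Pr => e e0; rewrite add0r.
  have e2 : 0 < e / 2 by rewrite divr_gt0.
  have [j hj] := V_basis (left_regular_cvg1 G_hausdorff haar f e2).
  have := Bid j f (e / 2) (fun y Vy => ltW (hj y Vy)).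
  by rewrite Bf0 sub0r mulrC divfK// [l2norm _](hnormN ipL2).
- by move=> A cA f; apply: aA => // A' j g; exact: BA.
split=> // e e0.
have e4 : 0 < e / 4 by rewrite divr_gt0.
(* Beyond [J] the weight alone makes the term small; the finitely many other averages are controlled
   by taking [n] large. *)
have [J hJ] : exists J, forall j, (J <= j)%N -> 2^-1 ^+ j * 4 <= e / 4.
  have : (fun n => 2^-1 ^+ n * 4) @ \oo --> (0 * 4 : R).
    by apply: cvgMl; apply: cvg_expr; rewrite ger0_norm ?invr_ge0// invf_lt1// ltr1n.
  rewrite mul0r => /cvgrPdist_lt/(_ _ e4)[J _ hJ]; exists J => j /hJ /=.
  by rewrite sub0r normrN => /ltW; apply: le_trans; exact: ler_norm.
(* For fixed [j], the coefficient of [peak n] is eventually carried by some [V k] whose measure is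
   small compared with that of [V j]. *)
have /choice[N hN] j : exists N, forall n, (N <= n)%N -> l2norm (B j (peak n)) ^+ 2 <= e / 4.
  have [k hk] := m_cvg (mulr_gt0 e4 (divr_gt0 (m_gt0 j) (ltr0Sn _ 3))).
  have Vk : nbhs (1%g : G) (V k) by apply: open_nbhs_nbhs.
  have [N hN] := difference_cvg Vk; exists N => n Nn; rewrite -(ler_pM2r (m_gt0 j)).
  apply: (le_trans (Bsmall j (peak n) (V k) (open_measurable_borel (oV k)) (Voo k) (peak_norm n) _)).
    by move=> x Vx; apply: peak_orthogonal => s Vs Vxs; apply: Vx; exact: hN Nn x s Vs Vxs.
  rewrite -[fine _]/(m k) mulrC -ler_pdivlMr//; apply: ltW.
  by rewrite -mulrA.
exists (\max_(j < J) N j)%N => n Nn.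
apply: (@le_lt_trans _ _ (2 * (e / 4))); last first.
  have -> : 2 * (e / 4) = e / 2 by field.
  by rewrite ltr_pdivrMr// ltr_pMr// ltr1n.
apply: ae => j; have [Jj|jJ] := leqP J j.
  apply: le_trans (hJ j Jj); rewrite ler_wpM2l ?exprn_ge0 ?invr_ge0//.
  have -> : 4 = 2 ^+ 2 :> R by ring.
  rewrite ler_pXn2r// ?nnegrE ?l2norm_ge0//.
  by rewrite (le_trans (B2 j (peak n)))// peak_norm mulr1.
have Nj : (N j <= n)%N by apply: leq_trans Nn; exact: (leq_bigmax (Ordinal jJ)).
apply: le_trans (hN j n Nj); rewrite ler_piMl ?sqr_ge0//.
by rewrite exprn_ile1 ?invr_ge0// invf_le1// ler1n.
Qed.

End SeparatingOperator.

(** * Products with a state and the Fourier norm *)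

Section FourierProduct.
Context (R : realType) (G : topologicalGroupType).
Variable mu : {measure set (borel G) -> \bar R}.
Hypotheses (G_hausdorff : hausdorff_space G) (haar : left_haar_measure mu).
Local Notation lam := (@left_regular R G mu).
Local Notation ipe := (@ell2_inner _ _ _ mu).
Local Notation "`[ x ]" := (hnorm ipe x) (format "`[ x ]").
Implicit Types (f u : L2 mu) (p q : ell2 mu).

(** The square of [2 + 3 |p|] dominates [2 + 8 |p|^2], so the error is linear in [r]. *)
Lemma slice_error_le f f0 p (r : R) : 0 <= r -> l2norm f0 = 1 -> l2norm (f - f0) <= r ->
  slice_error f f0 r p <= r * (2 + 3 * `[p]).
Proof.
move=> r0 f01 ff0; rewrite /slice_error f01 expr1n mulr1.
have p0 : 0 <= `[p] by exact: hnorm_ge0.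
have d0 := l2norm_ge0 (f - f0).
have d2 : l2norm (f - f0) ^+ 2 <= r ^+ 2 by rewrite ler_pXn2r// nnegrE.
move: (l2norm (f - f0) ^+ 2) d2 => d2 hd2; move: `[p] p0 => P P0.
have k0 : 0 <= r * (2 + 3 * P) by rewrite mulr_ge0// addr_ge0// mulr_ge0.
rewrite -[leRHS]ger0_norm// -sqrtr_sqr ler_wsqrtr//.
apply: (@le_trans _ _ (2 * r ^+ 2 + 8 * P ^+ 2 * r ^+ 2)).
  by rewrite lerD2l ler_wpM2l// mulr_ge0// sqr_ge0.
rewrite -subr_ge0 [leRHS](_ : _ = r ^+ 2 * (2 + 12 * P + P ^+ 2)); last by ring.
by rewrite mulr_ge0 ?sqr_ge0// !addr_ge0 ?mulr_ge0 ?sqr_ge0.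
Qed.

Let fourier_algebra_form (x y : nat -> L2 mu) : square_summable x -> square_summable y ->
  fourier_algebra (fun S => ultraweak_form x y S).
Proof.
move=> sx sy; apply: eq_fourier_algebra (fourier_algebra_ultraweak (ell2_of x) (ell2_of y)) => S _.
exact: esym (congr2 (fun x' y' => ultraweak_form x' y' S) (ell2_ofK sx) (ell2_ofK sy)).
Qed.

Let modc_sum_le n (a z : 'I_n -> R[i]) (c : 'I_n -> R) (r : R) :
  (forall i, modc (z i) <= r * c i) ->
  modc (\sum_(i < n) a i * z i) <= r * \sum_(i < n) modc (a i) * c i.
Proof.
move=> h; apply: (le_trans (ler_modc_sum _ _)); rewrite mulr_sumr; apply: ler_sum => i _.
by rewrite modcM mulrCA ler_wpM2l ?modc_ge0.
Qed.

(** The order of quantifiers matters: [K] and [W] depend on [v] only, and [w] on [f] but not on [r],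
    so along a sequence of vectors [r] can tend to 0 with [K] fixed. The set [W r] consists of the
    [s] whose inverse moves each vector representing [v] by at most [r]. *)
Lemma fourier_product_exists (v : functional mu) : P1 v ->
  exists (K : R) (W : R -> set G),
    [/\ 0 <= K, forall r, 0 < r -> nbhs (1%g : G) (W r) &
      forall f, l2norm f = 1 -> exists2 w : functional mu,
        is_fourier_product v (vector_state f) w &
        forall (r : R) f0, 0 < r -> l2norm f0 = 1 -> l2norm (f - f0) <= r ->
          {ae mu, forall s : borel G, L2_repr f0 s <> 0 -> W r s} ->
          forall S, VN mu S -> (forall u, l2norm (S u) <= l2norm u) ->
            modc (w S - vector_state f S) <= r * K].
Proof.
move=> Pv; have [n [a [p [q vE]]]] := normal_state_ultraweak Pv.
pose c i := (2 + 3 * `[p i]) * `[q i] + `[p i] * (2 + 3 * `[q i]).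
pose W (r : R) : set G := [set s | forall i, `[lamE s^-1%g (p i) - p i] <= r /\
  `[lamE s^-1%g (q i) - q i] <= r].
exists (\sum_(i < n) modc (a i) * c i), W; split.
- apply: sumr_ge0 => i _; apply: mulr_ge0; first exact: modc_ge0.
  by apply: addr_ge0; apply: mulr_ge0; rewrite ?hnorm_ge0// addr_ge0// mulr_ge0 ?hnorm_ge0.
- move=> r r0; apply: filter_forall => i.
  have near1 x : nbhs (1%g : G) (fun s => `[lamE s^-1%g x - x] <= r).
    have h : nbhs (1^-1%g : G) (fun s => `[lamE s x - x] <= r).
      rewrite invg1; have := lamE_cvg G_hausdorff haar x 1%g r0.
      by rewrite (lamE1 haar); apply: filterS => s; exact: ltW.
    exact: nbhs_invg h.
  exact: filterI (near1 (p i)) (near1 (q i)).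
move=> f f1.
have [C0 sC0 fC0] := sigma_compact_carrier G_hausdorff haar f.
have s1 : sigma_compact [set (1%g : G)].
  by exists (fun=> [set 1%g]); [move=> _; exact: compact_set1|rewrite bigcup_const//; exists 0%N].
(* Adding the identity makes the sequence [y i] approximate [q i] itself, as [slice_estimate]
   requires. *)
pose C := C0 `|` [set 1%g]; have sC : sigma_compact C := sigma_compactU sC0 s1.
have C1 : C 1%g by right.
have fC : {ae mu, forall s : borel G, ~ C s -> L2_repr f s = 0}.
  have {}fC0 : {ae mu, forall s : borel G, ~ C0 s -> L2_repr f s = 0} := fC0.
  by apply: filterS fC0 => s h Cs; apply: h => C0s; apply: Cs; left.
have /choice[y hy] := fun i => dense_translates G_hausdorff haar (q i) sC.
pose form i := ultraweak_form (slice (y i) (p i) f) (slice (y i) (q i) f).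
exists (fun S => \sum_(i < n) a i * form i S).
  split.
    apply: fourier_algebra_sum => i; apply: fourier_algebraZ.
    by apply: fourier_algebra_form; exact: slice_summable.
  move=> x; rewrite vE; last exact: VN_left_regular.
  rewrite mulr_suml; apply: eq_bigr => i _.
  by rewrite /form (slice_product G_hausdorff haar (p i) fC (hy i)) mulrA.
move=> r f0 r0 f01 ff0 f0W S VS S1.
(* The normalization of [v] makes the multiples of [vector_state f] that approximate the terms add
   up to [vector_state f]. *)
have v1 : \sum_(i < n) a i * ipe (p i) (q i) = 1.
  by case: Pv => _ _ <- _; rewrite vE//; exact: VN_id.
have -> : \sum_(i < n) a i * form i S - vector_state f S =
    \sum_(i < n) a i * (form i S - ipe (p i) (q i) * vector_state f S).
  rewrite -[vector_state f S]mul1r -{1}v1 mulr_suml -sumrB.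
  by apply: eq_bigr => i _; rewrite mul1r mulrBr mulrA.
apply: modc_sum_le => i.
have Sl : hlinear S := (VN_bounded VS).1.
have Wp s : W r s -> `[lamE s^-1%g (p i) - p i] <= r by move=> /(_ i)[].
have Wq s : W r s -> `[lamE s^-1%g (q i) - q i] <= r by move=> /(_ i)[].
have := slice_estimate G_hausdorff haar f (hy i) C1 (ltW r0) f0W Wp Wq Sl S1.
move=> h; apply: (le_trans h); rewrite f1 mulr1 mulrDr; apply: lerD.
  rewrite mulrA; apply: ler_wpM2r; first exact: hnorm_ge0.
  exact: slice_error_le (ltW r0) f01 ff0.
rewrite mulrCA; apply: ler_wpM2l; first exact: hnorm_ge0.
exact: slice_error_le (ltW r0) f01 ff0.
Qed.

Lemma opnorm_contraction (S : L2 mu -> L2 mu) u : bounded_operator S -> opnorm S = 1 ->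
  l2norm (S u) <= l2norm u.
Proof.
move=> bS S1; have [M M0 hM] := hbounded_gt0 bS; have Sl : hlinear S := bS.1.
have [u0|u0] := eqVneq (l2norm u) 0.
  by have := hM u; rewrite -!l2normE u0 mulr0.
have up : 0 < l2norm u by rewrite lt_def u0 l2norm_ge0.
have -> : S u = (l2norm u)%:C%C *: S (((l2norm u)^-1)%:C%C *: u).
  by rewrite (hlinearZ _ _ Sl) scalerA -rmorphM mulfV// rmorph1 scale1r.
rewrite l2normZ modc_real gtr0_norm// ger_pMr// -S1; apply: ub_le_sup.
  by exists M => _ [g g1 <-]; apply: (le_trans (hM g)); rewrite ler_piMr// ltW.
exists (((l2norm u)^-1)%:C%C *: u) => //=.
by rewrite l2normZ modc_real gtr0_norm ?invr_gt0// mulVf.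
Qed.

Lemma opnorm_id (f : L2 mu) : l2norm f = 1 -> opnorm (@id (L2 mu)) = 1.
Proof.
move=> f1; apply/eqP; rewrite eq_le; apply/andP; split.
  by apply: ge_sup; [exists (l2norm f), f => //=; rewrite f1|move=> _ [g g1 <-]].
by rewrite -[leLHS]f1; apply: ub_le_sup; [exists 1 => _ [g g1 <-]|exists f => //=; rewrite f1].
Qed.

Lemma fourier_norm_cvg0 (d : nat -> functional mu) (f : L2 mu) : l2norm f = 1 ->
  (forall e : R, 0 < e -> exists N, forall n, (N <= n)%N -> forall S, VN mu S ->
    (forall u, l2norm (S u) <= l2norm u) -> modc (d n S) <= e) ->
  fourier_norm (d n) @[n --> \oo] --> 0%E.
Proof.
move=> f1 h.
(* The unit vector [f] ensures that the identity has norm 1, so the supremum is not over the empty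
   set, where it would be [-oo]. *)
have ge0 n : (0 <= fourier_norm (d n))%E.
  apply: (@le_trans _ _ (modc (d n id))%:E); first by rewrite lee_fin modc_ge0.
  by apply: ereal_sup_ubound; exists id => //; split; [exact: VN_id|exact: opnorm_id f1].
have le_e (e : R) : 0 < e -> exists N, forall n, (N <= n)%N -> (fourier_norm (d n) <= e%:E)%E.
  move=> /h[N hN]; exists N => n Nn; apply: ge_ereal_sup => _ [S [VS S1] <-].
  rewrite lee_fin; apply: hN => // u; exact: opnorm_contraction (VN_bounded VS) S1.
have fin_le n (e : R) : (fourier_norm (d n) <= e%:E)%E -> fourier_norm (d n) \is a fin_num.
  by move=> le; rewrite ge0_fin_numE// (le_lt_trans le)// ltry.
apply/fine_cvgP; split.
  by have [N hN] := le_e 1 ltr01; exists N => // n /= /hN; exact: fin_le.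
apply/cvgrPdist_le => e /le_e[N hN]; exists N => // n /= /hN le.
rewrite sub0r normrN ger0_norm ?fine_ge0//.
by rewrite -lee_fin fineK//; exact: fin_le le.
Qed.

End FourierProduct.

(** * The orthogonal sequence and its asymptotic invariance *)

Theorem lemma7p9 (R : realType) (G : topologicalGroupType)
    (G_hausdorff : hausdorff_space G) (G_lc : locally_compact [set: G])
    (mu : {measure set (borel G) -> \bar R}) (mu_haar : left_haar_measure mu)
    (G_card : min_nbhs_basis_card (1%g : G) [set: nat]) :
  exists u : nat -> functional mu,
    [/\ forall n, P1 (u n),
        forall m n, m <> n -> orthogonal_states (VN mu) (u m) (u n) &
        forall v : functional mu, P1 v ->
          exists w : nat -> functional mu,
            (forall n, is_fourier_product v (u n) (w n)) /\
            fourier_norm (fun S => w n S - u n S) @[n --> \oo] --> 0%E].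
Proof.
have [V [/all_and2[oV V1] Voo V_mono V_half V_basis]] :=
  small_neighborhoods G_hausdorff G_lc mu_haar G_card.
have [a [f [[ba sa] pa a0 aA [f1 fV fa]]]] :=
  separating_operator G_hausdorff mu_haar oV V1 Voo V_mono V_half V_basis.
have [r [g [kr g1 gf g_orth]]] :=
  orthogonalize (inner_product_L2 mu) (@L2_complete _ _ R mu) ba sa pa a0 f1 fa.
have comm A : commutant (range (@left_regular R G mu)) A -> commutes_with (@inner _ _ _ mu) a A.
  by move=> cA; split; [exact: cA.1|move=> x; rewrite aA].
exists (fun n => vector_state (g n)); split.
- by move=> n; exact: P1_vector (g1 n).
- move=> j k jk; apply: (vector_state_orthogonal mu_haar (g1 j) (g1 k)) => A cA.
  have [A' cA' AA'] := VNc_adjoint mu_haar cA.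
  exact: g_orth jk (comm A cA) (comm A' cA') AA'.
move=> v Pv.
have [K [W [K0 W1 hK]]] := fourier_product_exists G_hausdorff mu_haar Pv.
have /choice[w hw] n : exists w : functional mu, is_fourier_product v (vector_state (g n)) w /\
    forall (t : R) f0, 0 < t -> l2norm f0 = 1 -> l2norm (g n - f0) <= t ->
      {ae mu, forall s : borel G, L2_repr f0 s <> 0 -> W t s} ->
      forall S, VN mu S -> (forall u, l2norm (S u) <= l2norm u) ->
        modc (w S - vector_state (g n) S) <= t * K.
  by have [w w1 w2] := hK (g n) (g1 n); exists w.
exists w; split=> [n|]; first by case: (hw n).
apply: (fourier_norm_cvg0 (f1 0%N)) => e e0.
have K1 : 0 < K + 1 by rewrite ltr_wpDl.
(* Adding 1 covers the case [K = 0] and still gives [t * K <= e]. *)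
pose t := e / (K + 1); have t0 : 0 < t by rewrite divr_gt0.
have [N VW] := V_basis _ (W1 t t0).
have [N' _ hN'] := near_infty_natSinv_lt (PosNum t0).
exists (maxn N N') => n; rewrite geq_max => /andP[Nn N'n] S VS S1.
(* The localized vector is [f (r n)]: as [r n >= n >= N], it is carried by [V N], which is contained
   in [W t]. *)
case: (hw n) => _ /(_ t (f (r n)) t0 (f1 (r n))) h.
apply: (@le_trans _ _ (t * K)).
  apply: h => //.
    by apply: (le_trans (gf n)); apply: ltW; exact: hN'.
  apply: filterS (fV (r n)) => s hs /hs Vs; apply: VW.
  exact: V_mono (leq_trans Nn (kr n)) _ Vs.
rewrite /t mulrAC ler_pdivrMr// ler_wpM2l ?(ltW e0)//.
by rewrite lerDl.
Qed.
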